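(* Let $F:\mathcal{S}_n\to\mathbb{R}$ be of class $C^2$, quasiconcave, and uniformly parabolic in the sense $\lambda|\xi|^2\leq F_{ij}(M)\xi_i\xi_j\leq\Lambda|\xi|^2$ for all $M\in\mathcal{S}_n$, $\xi\in\mathbb{R}^n$, with $0<\lambda\le\Lambda$. Let $u\in C^{4,2}(Q_1)$ be a solution of $F(D^2u)-\partial_tu=0$ in $Q_1=B_1\times(-1,0]$. Then $u\in C^{2+\alpha,1+\alpha/2}(\overline{Q}_{1/2})$ and \[ \|u\|_{C^{2+\alpha,1+\alpha/2}(\overline{Q}_{1/2})}\leq C, \] where $\alpha\in(0,1)$ depends only on $n,\lambda,\Lambda$ and $C$ depends on $n,\lambda,\Lambda$ and $\|u\|_{C^{2,1}(\overline{Q}_1)}$.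
   Context: $\mathcal{S}_n$ is the space of real symmetric $n\times n$ matrices; $F_{ij}=\partial F/\partial m_{ij}$. $F$ is quasiconcave if $F(\theta M_1+(1-\theta)M_2)\geq\min\{F(M_1),F(M_2)\}$. $Q_r=B_r\times(-r^2,0]$. $C^{4,2}$ means four continuous space derivatives and two continuous time derivatives. With parabolic distance $d((x,t),(y,s))=|x-y|+|t-s|^{1/2}$, $C^{\alpha,\alpha/2}$ is the space of bounded functions Hölder continuous of order $\alpha$ w.r.t. $d$; $\|u\|_{C^{2+\alpha,1+\alpha/2}(Q)}=\sup_Q|u|+\sup_Q|Du|+\|D^2u\|_{C^{\alpha,\alpha/2}(Q)}+\|\partial_tu\|_{C^{\alpha,\alpha/2}(Q)}$; $\|u\|_{C^{2,1}(Q)}=\sum_{2i+j\le2}\sup_Q|\partial_t^iD_x^ju|$. *)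

(* Defs.v *)
From mathcomp Require Import all_boot all_order all_algebra.
From mathcomp Require Import all_classical all_reals all_analysis.
Import Order.TTheory GRing.Theory Num.Theory.
Import numFieldNormedType.Exports.

Set Implicit Arguments.
Unset Strict Implicit.
Unset Printing Implicit Defensive.

Local Open Scope ring_scope.
Local Open Scope classical_set_scope.

Section ParabolicDefs.
Variables (R : realType) (n : nat).

Definition spt := ('rV[R]_n * R)%type.

Definition enorm (x : 'rV[R]_n) : R := Num.sqrt (\sum_(i < n) x 0 i ^+ 2).

Definition pdist (p q : spt) : R := enorm (p.1 - q.1) + Num.sqrt `|p.2 - q.2|.

Definition Q1 : set spt := [set p | enorm p.1 < 1 /\ -1 < p.2 <= 0].

Definition Qhalf_closed : set spt :=
  [set p | enorm p.1 <= 2^-1 /\ - 4^-1 <= p.2 <= 0].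

Definition dx (i : 'I_n) (f : spt -> R) : spt -> R :=
  fun p => derive1 (fun s : R => f (p.1 + s *: delta_mx 0 i, p.2)) 0.

(* time derivative, taken from the left (Q_1 is closed at the top t = 0;
   at interior times it coincides with the usual derivative) *)
Definition dt (f : spt -> R) : spt -> R :=
  fun p => lim ((fun h : R => h^-1 * (f (p.1, p.2 + h) - f p)) @ 0^'-).

Definition pd (d : option 'I_n) (f : spt -> R) : spt -> R :=
  if d is Some i then dx i f else dt f.

Definition has_pd (d : option 'I_n) (f : spt -> R) (p : spt) : Prop :=
  if d is Some i then derivable (fun s : R => f (p.1 + s *: delta_mx 0 i, p.2)) 0 1
  else cvg ((fun h : R => h^-1 * (f (p.1, p.2 + h) - f p)) @ 0^'-).

Definition pder (ds : seq (option 'I_n)) (f : spt -> R) : spt -> R :=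
  foldr pd f ds.

Definition pweight (ds : seq (option 'I_n)) : nat :=
  foldr (fun d w => ((if d is Some _ then 1 else 2) + w)%N) 0%N ds.

Definition C42_on (A : set spt) (f : spt -> R) : Prop :=
  (forall d ds, (pweight (d :: ds) <= 4)%N ->
     forall p, A p -> has_pd d (pder ds f) p) /\
  (forall ds, (pweight ds <= 4)%N -> {within A, continuous (pder ds f)}).

Definition hess (f : spt -> R) (p : spt) : 'M[R]_n :=
  \matrix_(i < n, j < n) pder [:: Some i; Some j] f p.

Definition C21_bounded (A : set spt) (K : R) (f : spt -> R) : Prop :=
  forall ds, (pweight ds <= 2)%N -> forall p, A p -> `|pder ds f p| <= K.

Definition holder_on (A : set spt) (a C : R) (g : spt -> R) : Prop :=
  forall p q, A p -> A q -> `|g p - g q| <= C * (pdist p q) `^ a.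

Definition C2a1a_bounded (A : set spt) (a C : R) (f : spt -> R) : Prop :=
  (forall ds, (pweight ds <= 2)%N -> forall p, A p -> `|pder ds f p| <= C) /\
  (forall ds, pweight ds = 2%N -> holder_on A a C (pder ds f)).

Definition sym_mx : set 'M[R]_n := [set M | M^T = M].

Definition mdir (E : 'M[R]_n) (G : 'M[R]_n -> R) : 'M[R]_n -> R :=
  fun M => derive1 (fun s : R => G (M + s *: E)) 0.

Definition Esym (i j : 'I_n) : 'M[R]_n := delta_mx i j + delta_mx j i.

Definition C2_sym (F : 'M[R]_n -> R) : Prop :=
  {within sym_mx, continuous F} /\
  (forall i j, {within sym_mx, continuous (mdir (Esym i j) F)}) /\
  (forall i j k l,
     {within sym_mx, continuous (mdir (Esym k l) (mdir (Esym i j) F))}) /\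
  (forall M, sym_mx M -> forall i j,
     derivable (fun s : R => F (M + s *: Esym i j)) 0 1) /\
  (forall M, sym_mx M -> forall i j k l,
     derivable (fun s : R => mdir (Esym i j) F (M + s *: Esym k l)) 0 1).

Definition quasiconcave (F : 'M[R]_n -> R) : Prop :=
  forall M1 M2, sym_mx M1 -> sym_mx M2 -> forall th : R, 0 <= th <= 1 ->
    Num.min (F M1) (F M2) <= F (th *: M1 + (1 - th) *: M2).

(* lam |xi|^2 <= F_ij(M) xi_i xi_j <= Lam |xi|^2; with the symmetric
   convention F_ij = F_ji, F_ij(M) xi_i xi_j is the derivative of F at M
   in the direction of the symmetric matrix xi xi^T = (xi_i xi_j)_ij. *)
Definition unif_parabolic (lam Lam : R) (F : 'M[R]_n -> R) : Prop :=
  forall M, sym_mx M -> forall xi : 'rV[R]_n,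
    lam * enorm xi ^+ 2 <= mdir (xi^T *m xi) F M <= Lam * enorm xi ^+ 2.

End ParabolicDefs.

(* Main.v *)
Require Import Defs.
From mathcomp Require Import all_boot all_order all_algebra.
From mathcomp Require Import all_classical all_reals all_analysis.
From mathcomp Require Import ring lra zify.
Import Order.TTheory GRing.Theory Num.Theory.
Import numFieldNormedType.Exports.
Set Implicit Arguments.
Unset Strict Implicit.
Unset Printing Implicit Defensive.
Local Open Scope ring_scope.
Local Open Scope classical_set_scope.

(** Parabolic Evans-Krylov theory by finite counting.  A nonnegative supersolution
   of the Pucci operator that is small at one point is small on most of a dyadic
   cube at an earlier time: the contact points with sliding paraboloids are counted
   on a grid, an explicit barrier carries smallness from scale to scale, and a
   dyadic covering argument iterates this.  The density estimate makes the
   oscillation of the time difference quotients of [u] decay geometrically, so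
   [u_t] is Hoelder continuous.  By quasiconcavity, sums of pure second differences
   of [u] are one-sided solutions of a linear equation, up to an error controlled by
   the oscillation of [u_t].  Take points [p], [q] and an orthogonal projection [B]
   that almost maximize a weighted Hoelder quotient of [tr (B (D^2 u(p) - D^2 u(q)))].
   Applied to the distances of [tr (B D^2 u)] and [tr ((1 - B) D^2 u)] from their
   suprema, the density estimate yields a point [y] at which the former almost
   attains its maximum and the latter is not much smaller than at [q]; then
   [D^2 u(y) - D^2 u(q)] has a large positive and a small negative part, whereas
   [F] differs little at the two matrices, against ellipticity. *)

(** Volumes are replaced by numbers of mesh cells. The regularity constants [K], [d] of the function
    at hand only decide how fine the mesh must be; the fractions of cells obtained depend on [n],
    [lam], [Lam] alone. The regularity of [u] thus enters qualitatively, to allow fine meshes and to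
    make the supremum of the Hoelder quotients finite. Quasiconcavity only says that the superlevel
    sets of [F] are convex. Averaging Hessians taken at several points needs them in one superlevel
    set, and by the equation their levels differ by the oscillation of [u_t]. This forces the order:
    first the Hoelder bound for [u_t], then an exponent for [D^2 u] not above the one for [u_t], so
    that the error is a small fraction of the nearly maximal oscillation once the weighted quotient
    is large. Projections enter because the trace of the positive part of a symmetric matrix [N] is
    the maximum of [tr (B N)] over orthogonal projections [B]. *)

(** * Bilinear forms, norms and positive semidefinite matrices *)

Section LinearAlgebra.
Context {R : realType} {n : nat}.
Implicit Types (x y z : 'rV[R]_n) (H M P N : 'M[R]_n) (a b s t : R).

Definition bf H x y : R := (x *m H *m y^T) 0 0.
Definition qf H x : R := bf H x x.
Definition dot x y : R := (x *m y^T) 0 0.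
(** The sum norm is the working norm for Taylor remainders, since a path along the coordinate axes
    splits it exactly into its edges. *)
Definition vn x : R := \sum_i `|x 0 i|.
Definition mn H : R := \sum_i \sum_j `|H i j|.
Definition psd P : Prop := P^T = P /\ forall x, 0 <= qf P x.

Lemma dotE x y : dot x y = \sum_i x 0 i * y 0 i.
Proof. by rewrite /dot mxE; apply: eq_bigr => i _; rewrite mxE. Qed.

Lemma dotC x y : dot x y = dot y x.
Proof. by rewrite !dotE; apply: eq_bigr => i _; rewrite mulrC. Qed.

Lemma dotDl x y z : dot (x + y) z = dot x z + dot y z.
Proof. by rewrite /dot mulmxDl mxE. Qed.

Lemma dotNl x z : dot (- x) z = - dot x z.
Proof. by rewrite /dot mulNmx mxE. Qed.

Lemma dotZl a x z : dot (a *: x) z = a * dot x z.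
Proof. by rewrite /dot -scalemxAl mxE. Qed.

Lemma dotDr x y z : dot z (x + y) = dot z x + dot z y.
Proof. by rewrite dotC dotDl !(dotC z). Qed.

Lemma dotNr x z : dot z (- x) = - dot z x.
Proof. by rewrite dotC dotNl (dotC z). Qed.

Lemma dotZr a x z : dot z (a *: x) = a * dot z x.
Proof. by rewrite dotC dotZl (dotC z). Qed.

Lemma dot0r x : dot x 0 = 0.
Proof. by rewrite -(scale0r (0 : 'rV_n)) dotZr mul0r. Qed.

Lemma dot_ge0 x : 0 <= dot x x.
Proof. by rewrite dotE; apply: sumr_ge0 => i _; rewrite -expr2 sqr_ge0. Qed.

Lemma dot_eq0 x : (forall y, dot x y = 0) -> x = 0.
Proof.
move=> h; apply/rowP => i; have := h (delta_mx 0 i).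
rewrite dotE (bigD1 i) //= big1 ?addr0 => [|j ji]; rewrite !mxE ?eqxx ?mulr1 //.
by rewrite (negbTE ji) andbF mulr0.
Qed.

Lemma sqr_coord_le x (i : 'I_n) : x 0 i ^+ 2 <= dot x x.
Proof.
rewrite dotE (bigD1 i) //= -expr2 lerDl; apply: sumr_ge0 => j _.
by rewrite -expr2 sqr_ge0.
Qed.

Lemma enorm_sqr x : enorm x ^+ 2 = dot x x.
Proof.
rewrite /enorm sqr_sqrtr ?dotE; last by apply: sumr_ge0 => i _; rewrite sqr_ge0.
by apply: eq_bigr => i _; rewrite expr2.
Qed.

Lemma enorm_ge0 x : 0 <= enorm x.
Proof. exact: sqrtr_ge0. Qed.

Lemma bfDm H M x y : bf (H + M) x y = bf H x y + bf M x y.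
Proof. by rewrite /bf mulmxDr mulmxDl mxE. Qed.

Lemma bfNm H x y : bf (- H) x y = - bf H x y.
Proof. by rewrite /bf mulmxN mulNmx mxE. Qed.

Lemma bfZm a H x y : bf (a *: H) x y = a * bf H x y.
Proof. by rewrite /bf -scalemxAr -scalemxAl mxE. Qed.

Lemma bfDl H x y z : bf H (x + y) z = bf H x z + bf H y z.
Proof. by rewrite /bf !mulmxDl mxE. Qed.

Lemma bfZl H a x z : bf H (a *: x) z = a * bf H x z.
Proof. by rewrite /bf -!scalemxAl mxE. Qed.

Lemma bfDr H x y z : bf H z (x + y) = bf H z x + bf H z y.
Proof. by rewrite /bf linearD mulmxDr mxE. Qed.

Lemma bfZr H a x z : bf H z (a *: x) = a * bf H z x.
Proof. by rewrite /bf linearZ -scalemxAr mxE. Qed.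

Lemma bf_dot H x y : bf H x y = dot (x *m H) y.
Proof. by []. Qed.

Lemma bfE H x y : bf H x y = \sum_i \sum_j x 0 i * H i j * y 0 j.
Proof.
rewrite /bf mxE exchange_big /=; apply: eq_bigr => j _.
by rewrite !mxE big_distrl.
Qed.

Lemma bf_delta H i j : bf H (delta_mx 0 i) (delta_mx 0 j) = H i j.
Proof.
rewrite bfE (bigD1 i) //= (bigD1 j) //= !mxE !eqxx mulr1 mul1r.
rewrite !big1 ?addr0 // => [k /negbTE ki|k /negbTE kj].
  by apply: big1 => l _; rewrite !mxE ki andbF !mul0r.
by rewrite !mxE kj andbF mulr0.
Qed.

Lemma qfDm H M x : qf (H + M) x = qf H x + qf M x.
Proof. exact: bfDm. Qed.

Lemma qfNm H x : qf (- H) x = - qf H x.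
Proof. exact: bfNm. Qed.

Lemma qfZm a H x : qf (a *: H) x = a * qf H x.
Proof. exact: bfZm. Qed.

Lemma qfZ a H x : qf H (a *: x) = a ^+ 2 * qf H x.
Proof. by rewrite /qf bfZl bfZr mulrA -expr2. Qed.

Lemma qf1 x : qf 1%:M x = dot x x.
Proof. by rewrite /qf /bf mulmx1. Qed.

Lemma qf_outer y x : qf (y^T *m y) x = dot x y ^+ 2.
Proof.
rewrite /qf /bf /dot mulmxA -mulmxA mxE big_ord1 expr2; congr (_ * _).
by rewrite -[y in LHS]trmxK -trmx_mul mxE.
Qed.

Lemma trace_outer y : \tr (y^T *m y) = dot y y.
Proof. by rewrite mxtrace_mulC /dot /mxtrace big_ord1. Qed.

Lemma vn_ge0 x : 0 <= vn x.
Proof. exact: sumr_ge0. Qed.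

Lemma vn0 : vn 0 = 0.
Proof. by rewrite /vn big1 // => i _; rewrite mxE normr0. Qed.

Lemma vnD x y : vn (x + y) <= vn x + vn y.
Proof.
by rewrite /vn -big_split; apply: ler_sum => i _ /=; rewrite mxE ler_normD.
Qed.

Lemma vnZ a x : vn (a *: x) = `|a| * vn x.
Proof. by rewrite /vn mulr_sumr; apply: eq_bigr => i _; rewrite mxE normrM. Qed.

Lemma coord_vn x i : `|x 0 i| <= vn x.
Proof. by rewrite /vn (bigD1 i) //= lerDl; apply: sumr_ge0. Qed.

Lemma vn_le x a : (forall i, `|x 0 i| <= a) -> vn x <= n%:R * a.
Proof.
move=> h; rewrite (le_trans (ler_sum _ (fun i _ => h i))) //.
by rewrite sumr_const card_ord mulr_natl.
Qed.

Lemma mn_ge0 H : 0 <= mn H.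
Proof. by apply: sumr_ge0 => i _; apply: sumr_ge0. Qed.

Lemma dot_le x y : `|dot x y| <= vn x * vn y.
Proof.
rewrite dotE (le_trans (ler_norm_sum _ _ _)) // /vn mulr_suml.
apply: ler_sum => i _; rewrite normrM ler_wpM2l // .
exact: coord_vn.
Qed.

Lemma vn_mulmx x H : vn (x *m H) <= vn x * mn H.
Proof.
rewrite /vn /mn mulr_suml.
apply: (@le_trans _ _ (\sum_j \sum_i `|x 0 i| * `|H i j|)).
  apply: ler_sum => j _; rewrite mxE (le_trans (ler_norm_sum _ _ _)) //.
  by apply: ler_sum => i _; rewrite normrM.
rewrite exchange_big; apply: ler_sum => i _ /=.
rewrite -mulr_sumr ler_wpM2l // [leRHS](bigD1 i) //= lerDl.
by apply: sumr_ge0 => k _; apply: sumr_ge0.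
Qed.

Lemma qf_le H x : `|qf H x| <= mn H * vn x ^+ 2.
Proof.
rewrite /qf bf_dot (le_trans (dot_le _ _)) // expr2 mulrA.
by rewrite ler_wpM2r ?vn_ge0 // mulrC vn_mulmx.
Qed.

Lemma mnD H M : mn (H + M) <= mn H + mn M.
Proof.
rewrite /mn -big_split; apply: ler_sum => i _ /=; rewrite -big_split.
by apply: ler_sum => j _ /=; rewrite mxE ler_normD.
Qed.

Lemma mnZ a H : mn (a *: H) = `|a| * mn H.
Proof.
rewrite /mn mulr_sumr; apply: eq_bigr => i _; rewrite mulr_sumr.
by apply: eq_bigr => j _; rewrite mxE normrM.
Qed.

Lemma mn1 : mn 1%:M = n%:R.
Proof.
rewrite /mn (eq_bigr (fun=> 1)) => [|i _]; first by rewrite sumr_const card_ord.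
rewrite (bigD1 i) //= mxE eqxx normr1 big1 ?addr0 // => j ji.
by rewrite mxE eq_sym (negbTE ji) normr0.
Qed.

Lemma psd_sym P : psd P -> P^T = P.
Proof. by case. Qed.

Lemma psd_ge0 P x : psd P -> 0 <= qf P x.
Proof. by case=> _ /(_ x). Qed.

Lemma psdD P N : psd P -> psd N -> psd (P + N).
Proof.
move=> [sP hP] [sN hN]; split=> [|x]; first by rewrite linearD /= sP sN.
by rewrite qfDm addr_ge0.
Qed.

Lemma psdZ a P : 0 <= a -> psd P -> psd (a *: P).
Proof.
move=> a0 [sP hP]; split=> [|x]; first by rewrite linearZ /= sP.
by rewrite qfZm mulr_ge0.
Qed.

Lemma psd0 : psd 0.
Proof. by split=> [|x]; rewrite ?trmx0 // /qf /bf mulmx0 mul0mx mxE. Qed.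

Lemma psd1 : psd 1%:M.
Proof. by split=> [|x]; rewrite ?trmx1 // qf1 dot_ge0. Qed.

Lemma psd_outer y : psd (y^T *m y).
Proof. by split=> [|x]; rewrite ?trmx_mul ?trmxK // qf_outer sqr_ge0. Qed.

Lemma psd_diag P i : psd P -> 0 <= P i i.
Proof. by move=> hP; rewrite -bf_delta; apply: (psd_ge0 _ hP). Qed.

Lemma psd_tr P : psd P -> 0 <= \tr P.
Proof. by move=> hP; apply: sumr_ge0 => i _; apply: psd_diag. Qed.

Lemma psd_diag_tr P i : psd P -> P i i <= \tr P.
Proof.
by move=> hP; rewrite /mxtrace (bigD1 i) //= lerDl sumr_ge0 // => j _; exact: psd_diag.
Qed.

(** Testing the form at [e_i + e_j] and at [e_i - e_j] bounds [2 |P i j|] by [P i i + P j j], and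
    each diagonal entry is at most the trace. *)
Lemma psd_entry P i j : psd P -> `|P i j| <= \tr P.
Proof.
move=> hP; have [sP _] := hP.
have e : P j i = P i j by rewrite -[in LHS]sP mxE.
have h1 := psd_ge0 (delta_mx 0 i + delta_mx 0 j) hP.
have h2 := psd_ge0 (delta_mx 0 i + (-1) *: delta_mx 0 j) hP.
move: h1 h2; rewrite /qf !(bfDl, bfDr, bfZl, bfZr) !bf_delta e.
have := psd_diag_tr i hP; have := psd_diag_tr j hP.
by rewrite ler_norml => *; apply/andP; split; lra.
Qed.

Lemma psd_mn P : psd P -> mn P <= n%:R ^+ 2 * \tr P.
Proof.
move=> hP; apply: (@le_trans _ _ (\sum_(i < n) \sum_(j < n) \tr P)).
  by apply: ler_sum => i _; apply: ler_sum => j _; apply: psd_entry.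
by rewrite !sumr_const !card_ord -mulrnA -[X in X <= _]mulr_natl -natrX expnS expn1.
Qed.

Lemma dot_vn x : dot x x <= vn x ^+ 2.
Proof. by rewrite (le_trans (ler_norm _)) // (le_trans (dot_le _ _)) // expr2. Qed.

Lemma enorm_vn x : enorm x <= vn x.
Proof. by rewrite -(ler_pXn2r (n := 2)) ?nnegrE ?enorm_ge0 ?vn_ge0 // enorm_sqr dot_vn. Qed.

Lemma coord_enorm x i : `|x 0 i| <= enorm x.
Proof.
rewrite -(ler_pXn2r (n := 2)) ?nnegrE ?enorm_ge0 // enorm_sqr real_normK ?num_real //.
exact: sqr_coord_le.
Qed.

Lemma enormN x : enorm (- x) = enorm x.
Proof. by rewrite /enorm; congr Num.sqrt; apply: eq_bigr => i _; rewrite mxE sqrrN. Qed.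

Lemma enormZ a x : enorm (a *: x) = `|a| * enorm x.
Proof.
rewrite /enorm -sqrtr_sqr -sqrtrM ?sqr_ge0 //; congr Num.sqrt.
by rewrite mulr_sumr; apply: eq_bigr => i _; rewrite mxE exprMn.
Qed.

Lemma cauchy_schwarz x y : dot x y <= enorm x * enorm y.
Proof.
have [x0|x0] := eqVneq (enorm x) 0.
  have -> : x = 0.
    by apply/rowP => i; have := coord_enorm x i; rewrite x0 normr_le0 mxE => /eqP.
  by rewrite dotC dot0r mulr_ge0 ?enorm_ge0.
have [y0|y0] := eqVneq (enorm y) 0.
  have -> : y = 0.
    by apply/rowP => i; have := coord_enorm y i; rewrite y0 normr_le0 mxE => /eqP.
  by rewrite dot0r mulr_ge0 ?enorm_ge0.
have ax : 0 < enorm x by rewrite lt_neqAle eq_sym x0 enorm_ge0.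
have ay : 0 < enorm y by rewrite lt_neqAle eq_sym y0 enorm_ge0.
have := dot_ge0 (enorm y *: x - enorm x *: y).
rewrite !(dotDl, dotDr, dotNl, dotNr, dotZl, dotZr) -!enorm_sqr (dotC y x).
set d := dot x y; set p := enorm x; set q := enorm y => h.
have : 0 <= (2 * p * q) * (p * q - d) by nra.
by rewrite pmulr_rge0 ?subr_ge0 // !mulr_gt0.
Qed.

Lemma enormD x y : enorm (x + y) <= enorm x + enorm y.
Proof.
rewrite -(ler_pXn2r (n := 2)) ?nnegrE ?addr_ge0 ?enorm_ge0 // enorm_sqr.
rewrite !(dotDl, dotDr) -!enorm_sqr (dotC y x).
have := cauchy_schwarz x y; nra.
Qed.

End LinearAlgebra.

(** * Functions with uniform parabolic Taylor expansions, and contact tests *)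

Section SmoothFunctions.
Context {R : realType} {n : nat}.
Notation pt := ('rV[R]_n * R)%type.
Implicit Types (D : set pt) (w tau : pt -> R) (g : pt -> 'rV[R]_n)
  (H : pt -> 'M[R]_n) (z : pt) (lam Lam : R).

(* [g], [H], [tau] are the spatial gradient, the Hessian and the time
   derivative of [w]. *)
Definition smoothC (K d : R) D w g H tau : Prop :=
  [/\ 0 <= K, 0 < d &
    forall z1 z2, D z1 -> D z2 ->
      vn (z2.1 - z1.1) <= d -> `|z2.2 - z1.2| <= d ->
    let dx := z2.1 - z1.1 in let dt := z2.2 - z1.2 in
    [/\ (H z1)^T = H z1,
        `|w z2 - w z1 - dot (g z1) dx - qf (H z1) dx / 2 - tau z1 * dt|
          <= K * (vn dx ^+ 3 + vn dx * `|dt| + dt ^+ 2),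
        vn (g z2 - g z1 - dx *m H z1) <= K * (vn dx ^+ 2 + `|dt|) &
        `|w z2 - w z1| <= K * (vn dx + `|dt|)]].

Definition smooth D w g H tau : Prop :=
  exists K d : R, smoothC K d D w g H tau.

(* [tau >= M^-(H)] for the Pucci operator [M^-] with constants [lam], [Lam]. *)
Definition pucci_super lam Lam (H : 'M[R]_n) (tau : R) : Prop :=
  forall P N, psd P -> psd N -> H = P - N -> lam * \tr P - Lam * \tr N <= tau.

Lemma eq_imp_le (x y : R) : x = y -> x <= y.
Proof. by move=> ->. Qed.

Lemma smoothC_sub (K d : R) D D' w g H tau :
  D' `<=` D -> smoothC K d D w g H tau -> smoothC K d D' w g H tau.
Proof. by move=> sD [K0 d0 h]; split => // z1 z2 /sD D1 /sD D2; apply: h. Qed.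

Lemma smooth_sub D D' w g H tau :
  D' `<=` D -> smooth D w g H tau -> smooth D' w g H tau.
Proof. by move=> sD [K [d h]]; exists K, d; apply: smoothC_sub h. Qed.

Lemma smooth_sym D w g H tau z : smooth D w g H tau -> D z -> (H z)^T = H z.
Proof.
move=> [K [d [K0 d0 h]]] Dz; have [] // := h z z Dz Dz.
  by rewrite subrr vn0 ltW.
by rewrite subrr normr0 ltW.
Qed.

Lemma smoothD D w1 g1 H1 tau1 w2 g2 H2 tau2 :
  smooth D w1 g1 H1 tau1 -> smooth D w2 g2 H2 tau2 ->
  smooth D (fun z => w1 z + w2 z) (fun z => g1 z + g2 z)
    (fun z => H1 z + H2 z) (fun z => tau1 z + tau2 z).
Proof.
move=> [K1 [d1 [K10 d10 h1]]] [K2 [d2 [K20 d20 h2]]].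
exists (K1 + K2), (Num.min d1 d2); split; [exact: addr_ge0|by rewrite lt_min d10|].
move=> z1 z2 D1 D2; rewrite !le_min => /andP[x1 x2] /andP[t1 t2] dx dt.
have [s1 a1 b1 c1] := h1 _ _ D1 D2 x1 t1; have [s2 a2 b2 c2] := h2 _ _ D1 D2 x2 t2.
split.
- by rewrite linearD /= s1 s2.
- rewrite [leRHS]mulrDl; apply: le_trans (lerD a1 a2); apply: le_trans (ler_normD _ _).
  by rewrite dotDl qfDm -/dx -/dt; apply: eq_imp_le; congr `|_|; ring.
- rewrite [leRHS]mulrDl; apply: le_trans (lerD b1 b2); apply: le_trans (vnD _ _).
  rewrite mulmxDr -/dx; apply: eq_imp_le; congr vn.
  by apply/rowP => i; rewrite !mxE; ring.
- rewrite [leRHS]mulrDl; apply: le_trans (lerD c1 c2); apply: le_trans (ler_normD _ _).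
  by apply: eq_imp_le; congr `|_|; ring.
Qed.

Lemma smoothCZ (K d : R) D c w g H tau : smoothC K d D w g H tau ->
  smoothC (`|c| * K) d D (fun z => c * w z) (fun z => c *: g z)
    (fun z => c *: H z) (fun z => c * tau z).
Proof.
move=> [K0 d0 h]; split; [exact: mulr_ge0|by []|].
move=> z1 z2 D1 D2 hx ht dx dt; have [s1 a1 b1 c1] := h _ _ D1 D2 hx ht.
split.
- by rewrite linearZ /= s1.
- rewrite -[leRHS]mulrA; apply: le_trans (ler_wpM2l (normr_ge0 c) a1).
  by rewrite -normrM dotZl qfZm -/dx -/dt; apply: eq_imp_le; congr `|_|; ring.
- rewrite -[leRHS]mulrA; apply: le_trans (ler_wpM2l (normr_ge0 c) b1).
  rewrite -vnZ -/dx; apply: eq_imp_le; congr vn; rewrite !scalerBr.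
  by rewrite -scalemxAr.
- rewrite -[leRHS]mulrA; apply: le_trans (ler_wpM2l (normr_ge0 c) c1).
  by rewrite -normrM; apply: eq_imp_le; congr `|_|; ring.
Qed.

Lemma smoothZ D c w g H tau : smooth D w g H tau ->
  smooth D (fun z => c * w z) (fun z => c *: g z)
    (fun z => c *: H z) (fun z => c * tau z).
Proof. by move=> [K [d h]]; exists (`|c| * K), d; apply: smoothCZ. Qed.

(** Adding such a function shifts a supersolution by a constant, or absorbs a constant error of the
    equation into linear growth in time. *)
Lemma smooth_time D (c e : R) :
  smooth D (fun z => c + e * z.2) (fun=> 0) (fun=> 0) (fun=> e).
Proof.
exists `|e|, 1; split => // z1 z2 _ _ hx ht dx dt; split.
- by rewrite trmx0.
- rewrite dotC dot0r /qf /bf mulmx0 mul0mx mxE -/dt.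
  rewrite (_ : _ - _ = 0) ?normr0; last by rewrite /dt; ring.
  by rewrite mulr_ge0 // !addr_ge0 ?sqr_ge0 ?exprn_ge0 ?mulr_ge0 ?vn_ge0.
- by rewrite mulmx0 !subrr vn0 mulr_ge0 // addr_ge0 ?exprn_ge0 ?vn_ge0.
- rewrite (_ : _ - _ = e * dt); last by rewrite /dt; ring.
  by rewrite normrM ler_wpM2l // lerDr vn_ge0.
Qed.

Lemma smooth_sum D (I : Type) (r : seq I) (w tau : I -> pt -> R)
    (g : I -> pt -> 'rV[R]_n) (H : I -> pt -> 'M[R]_n) :
  (forall i, smooth D (w i) (g i) (H i) (tau i)) ->
  smooth D (fun z => \sum_(i <- r) w i z) (fun z => \sum_(i <- r) g i z)
    (fun z => \sum_(i <- r) H i z) (fun z => \sum_(i <- r) tau i z).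
Proof.
move=> h; elim: r => [|i r IH].
  have := smooth_time D 0 0; congr smooth; apply/funext => z; rewrite big_nil //.
  by rewrite mul0r addr0.
have := smoothD (h i) IH; congr smooth; apply/funext => z; by rewrite big_cons.
Qed.

(** The constants are explicit because the contact count is applied to the rescalings of one
    function to many dyadic cubes and needs a common regularity bound for them; [m] dominates the
    scaling factors. *)
Lemma smoothC_affine (K d : R) D D' w g H tau (x0 : 'rV[R]_n) (r t0 s : R) :
  (forall z, D' z -> D (x0 + r *: z.1, t0 + s * z.2)) ->
  smoothC K d D w g H tau ->
  let p z := (x0 + r *: z.1, t0 + s * z.2) in
  let m := 1 + `|r| + `|s| in
  smoothC (m ^+ 3 * K) (d / m) D' (fun z => w (p z)) (fun z => r *: g (p z))
    (fun z => r ^+ 2 *: H (p z)) (fun z => s * tau (p z)).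
Proof.
move=> hD [K0 d0 h] p m.
have r0 := normr_ge0 r; have s0 := normr_ge0 s.
have m1 : 1 <= m by rewrite /m; lra.
have m0 : 0 < m by lra.
have rm : `|r| <= m by rewrite /m; lra.
have sm : `|s| <= m by rewrite /m; lra.
have m2 : m <= m ^+ 2 by rewrite expr2; nra.
have m3 : m ^+ 2 <= m ^+ 3 by rewrite [leRHS]exprS ler_peMl ?exprn_ge0 // ltW.
split.
- by rewrite mulr_ge0 // exprn_ge0 // ltW.
- by rewrite divr_gt0.
move=> z1 z2 D1 D2; rewrite !ler_pdivlMr // => hx ht dx dt.
have ex : (p z2).1 - (p z1).1 = r *: dx.
  by rewrite /p /dx /= scalerBr opprD addrACA subrr add0r.
have et : (p z2).2 - (p z1).2 = s * dt by rewrite /p /dt /=; ring.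
rewrite -/dx in hx; rewrite -/dt in ht; clearbody dx dt.
have X0 := vn_ge0 dx; have T0 := normr_ge0 dt.
have [] := h (p z1) (p z2) (hD _ D1) (hD _ D2).
- rewrite ex vnZ mulrC; apply: le_trans hx; exact: ler_wpM2l.
- rewrite et normrM mulrC; apply: le_trans ht; exact: ler_wpM2l.
rewrite ex et vnZ normrM; set X := vn dx; set T := `|dt|; move=> sH a1 b1 c1.
have rr : `|r| ^+ 2 <= m ^+ 3.
  by apply: le_trans m3; rewrite ler_pXn2r // nnegrE ltW.
have rrr : `|r| ^+ 3 <= m ^+ 3 by rewrite ler_pXn2r // nnegrE ltW.
have sm3 : `|s| <= m ^+ 3 := le_trans sm (le_trans m2 m3).
have rm3 : `|r| <= m ^+ 3 := le_trans rm (le_trans m2 m3).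
have ss : s ^+ 2 <= m ^+ 3.
  by apply: le_trans m3; rewrite -real_normK ?num_real // ler_pXn2r // nnegrE ltW.
have rs : `|r| * `|s| <= m ^+ 3.
  by apply: le_trans m3; rewrite expr2 ler_pM.
split.
- by rewrite linearZ /= sH.
- apply: (@le_trans _ _ (K * ((`|r| * X) ^+ 3 + `|r| * X * (`|s| * T) + (s * dt) ^+ 2))).
    apply: le_trans a1; rewrite dotZl dotZr qfZ qfZm.
    by apply: eq_imp_le; congr `|_|; ring.
  rewrite -[leRHS]mulrA [leRHS]mulrCA; apply: ler_wpM2l => //; rewrite !mulrDr.
  apply: lerD; first apply: lerD.
  + by rewrite exprMn ler_wpM2r // exprn_ge0.
  + by rewrite mulrACA ler_wpM2r // mulr_ge0.
  + by rewrite exprMn ler_wpM2r ?sqr_ge0.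
- apply: (@le_trans _ _ (`|r| * (K * ((`|r| * X) ^+ 2 + `|s| * T)))).
    apply: le_trans (ler_wpM2l r0 b1); rewrite -vnZ.
    apply: eq_imp_le; congr vn; rewrite !scalerBr -scalemxAr -scalemxAl scalerA.
    by rewrite -expr2.
  rewrite [leLHS]mulrCA -[leRHS]mulrA [leRHS]mulrCA; apply: ler_wpM2l => //; rewrite !mulrDr.
  apply: lerD.
  + by rewrite exprMn mulrA -exprS ler_wpM2r // exprn_ge0.
  + by rewrite mulrA ler_wpM2r.
- apply: le_trans c1 _; rewrite -[leRHS]mulrA [leRHS]mulrCA; apply: ler_wpM2l => //.
  by rewrite mulrDr; apply: lerD; rewrite ler_wpM2r.
Qed.

Lemma smooth_affine D D' w g H tau (x0 : 'rV[R]_n) (r t0 s : R) :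
  (forall z, D' z -> D (x0 + r *: z.1, t0 + s * z.2)) ->
  smooth D w g H tau ->
  let p z := (x0 + r *: z.1, t0 + s * z.2) in
  smooth D' (fun z => w (p z)) (fun z => r *: g (p z))
    (fun z => r ^+ 2 *: H (p z)) (fun z => s * tau (p z)).
Proof.
move=> hD [K [d h]] p; eexists; eexists; exact: (smoothC_affine hD h).
Qed.

Lemma pucci_superZ lam Lam (c : R) (H : 'M[R]_n) (tau : R) : 0 < c ->
  pucci_super lam Lam H tau -> pucci_super lam Lam (c *: H) (c * tau).
Proof.
move=> c0 h P N hP hN e.
have := h (c^-1 *: P) (c^-1 *: N).
rewrite -scalerBr -e scalerA mulVf ?gt_eqF // scale1r !mxtraceZ.
move=> /(_ (psdZ _ hP) (psdZ _ hN) erefl); rewrite invr_ge0 ltW // => /(_ isT isT).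
rewrite -(ler_pM2l c0) => /(le_trans _); apply; apply: eq_imp_le.
by field; rewrite gt_eqF.
Qed.

(** Replaces passages to the limit [s -> 0], so that later arguments handle only inequalities with
    explicit remainders. *)
Lemma ge0_of_small (A C r : R) : 0 < r ->
  (forall s, 0 < s -> s <= r -> - (s * C) <= A) -> 0 <= A.
Proof.
move=> r0 h; rewrite leNgt; apply/negP => A0.
have C1 : 0 < `|C| + 1 by rewrite ltr_wpDl.
pose s := Num.min r (- A / (2 * (`|C| + 1))).
have q0 : 0 < - A / (2 * (`|C| + 1)) by rewrite divr_gt0 ?mulr_gt0 // oppr_gt0.
have s0 : 0 < s by rewrite lt_min r0.
have sq : s * (2 * (`|C| + 1)) <= - A by rewrite -ler_pdivlMr ?mulr_gt0 // ge_min lexx orbT.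
have := h s s0; rewrite ge_min lexx => /(_ isT).
have := ler_norm C; nra.
Qed.

Lemma second_order_test (A B C r : R) : 0 < r -> 0 <= C ->
  (forall s, `|s| <= r -> 0 <= s * A + s ^+ 2 * B + C * `|s| ^+ 3) ->
  A = 0 /\ 0 <= B.
Proof.
move=> r0 C0 h.
have key (D : R) : (forall s, 0 < s -> s <= r -> 0 <= s * D + s ^+ 2 * B + C * s ^+ 3) -> 0 <= D.
  move=> hD; apply: (@ge0_of_small _ (`|B| + C * r) r) => // s s0 sr.
  have := hD s s0 sr; rewrite !exprS expr0 !mulr1 => h1.
  have : 0 <= s * (D + s * B + C * (s * s)) by nra.
  rewrite pmulr_rge0 // => h2; have := ler_norm B; have : s * s <= r * s by nra.
  move=> h3 h4; have : C * (s * s) <= C * (r * s) by rewrite ler_wpM2l.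
  have : s * B <= s * `|B| by rewrite ler_wpM2l // ltW.
  by nra.
have A0 : 0 <= A.
  apply: key => s s0 sr; have := h s; rewrite gtr0_norm //; exact.
have A1 : 0 <= - A.
  apply: key => s s0 sr; have := h (- s); rewrite normrN gtr0_norm // => /(_ sr).
  by rewrite sqrrN mulrN mulNr.
have eA : A = 0 by apply/eqP; rewrite eq_le A0 -oppr_ge0 A1.
split => //; apply: (@ge0_of_small _ C r) => // s s0 sr.
have := h s; rewrite gtr0_norm // eA mulr0 add0r => /(_ sr).
rewrite !exprS expr0 !mulr1 => h1.
have : 0 <= (s * s) * (B + C * s) by nra.
by rewrite pmulr_rge0 ?mulr_gt0 //; nra.
Qed.

(** Taylor's formula along each line through the contact point reduces this to [second_order_test].
    The cubic slack admits test functions that are not quadratic, such as the barrier. *)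
Lemma touch_space D w g H tau z0 (p : 'rV[R]_n) (A : 'M[R]_n) (C r : R) :
  smooth D w g H tau -> D z0 -> 0 < r -> 0 <= C -> A^T = A ->
  (forall x, vn (x - z0.1) <= r -> D (x, z0.2) /\
     w z0 + dot p (x - z0.1) + qf A (x - z0.1) / 2 - C * vn (x - z0.1) ^+ 3
       <= w (x, z0.2)) ->
  g z0 = p /\ psd (H z0 - A).
Proof.
move=> [K [d [K0 d0 h]]] D0 r0 C0 sA ht.
have key xi : dot (g z0 - p) xi = 0 /\ 0 <= qf (H z0 - A) xi / 2.
  have v1 : 0 < vn xi + 1 by rewrite ltr_wpDl ?vn_ge0.
  apply: (@second_order_test _ _ ((K + C) * vn xi ^+ 3) (Num.min r d / (vn xi + 1))).
  - by rewrite divr_gt0 // lt_min r0.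
  - by rewrite mulr_ge0 ?exprn_ge0 ?vn_ge0 // addr_ge0.
  move=> s; rewrite ler_pdivlMr // le_min => /andP[sr sd].
  pose x := z0.1 + s *: xi; have ex : x - z0.1 = s *: xi by rewrite /x addrAC subrr add0r.
  have le1 : vn (s *: xi) <= `|s| * (vn xi + 1).
    by rewrite vnZ ler_wpM2l // lerDl ler01.
  have vx : vn (x - z0.1) <= r by rewrite ex (le_trans le1).
  have [Dx] := ht x vx; rewrite ex.
  have := h z0 (x, z0.2) D0 Dx; rewrite /= ex subrr normr0.
  move=> /(_ (le_trans le1 sd) (ltW d0)) [_ + _ _].
  rewrite mulr0 expr0n /= !addr0 subr0 ler_norml => /andP[_ h1] h2.
  move: (lerD h1 h2); rewrite dotDl dotNl qfDm qfNm !dotZr !qfZ vnZ exprMn => h3.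
  by lra.
split.
  by apply/eqP; rewrite -subr_eq0; apply/eqP/dot_eq0 => y; have [] := key y.
split=> [|x].
  rewrite linearB /= sA; congr (_ - _).
  have [] // := h z0 z0 D0 D0; first by rewrite subrr vn0 ltW.
  by rewrite subrr normr0 ltW.
by have [_] := key x; rewrite pmulr_lge0 // invr_gt0.
Qed.

(** Contact is required at earlier times only, which is what a first touching time provides; hence a
    one-sided bound for [tau]. *)
Lemma touch_time D w g H tau z0 (b C r : R) :
  smooth D w g H tau -> D z0 -> 0 < r ->
  (forall s, 0 < s -> s <= r -> D (z0.1, z0.2 - s) /\
     w z0 - b * s - C * s ^+ 2 <= w (z0.1, z0.2 - s)) ->
  tau z0 <= b.
Proof.
move=> [K [d [K0 d0 h]]] D0 r0 ht; rewrite -subr_ge0.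
apply: (@ge0_of_small _ (K + C) (Num.min r d)); first by rewrite lt_min r0.
move=> s s0; rewrite le_min => /andP[sr sd].
have [Ds h1] := ht s s0 sr.
have := h z0 (z0.1, z0.2 - s) D0 Ds; rewrite /= subrr vn0.
rewrite (_ : z0.2 - s - z0.2 = - s); last by ring.
rewrite normrN gtr0_norm // dot0r /qf /bf trmx0 mulmx0 mxE.
move=> /(_ (ltW d0) sd) [_ + _ _]; rewrite expr0n /= mul0r !add0r mul0r !subr0 sqrrN.
rewrite ler_norml => /andP[_ h2].
have : 0 <= s * (b - tau z0 + s * (K + C)) by rewrite !expr2 in h1 h2; nra.
by rewrite pmulr_rge0 //; lra.
Qed.

End SmoothFunctions.

(** * First contact with sliding paraboloids *)

Section ContactPoints.
Context {R : realType} {n : nat}.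
Notation pt := ('rV[R]_n * R)%type.
Implicit Types (D : set pt) (f w tau : pt -> R) (g : pt -> 'rV[R]_n)
  (H : pt -> 'M[R]_n) (z : pt).

Definition near_pt (d : R) z1 z2 : Prop :=
  (forall i, `|z1.1 0 i - z2.1 0 i| < d) /\ `|z1.2 - z2.2| < d.

Lemma near_pt_nbhs z (A : set pt) :
  nbhs z A <-> exists2 d, 0 < d & forall z', near_pt d z z' -> A z'.
Proof.
split=> [/nbhs_ballP[d d0 hd]|[d d0 hd]].
  exists d => // z' [h1 h2]; apply: hd; split => //=.
  split => // i j; rewrite ord1; exact: h1.
apply/nbhs_ballP; exists d => // z' [h1 h2]; apply: hd; split=> // i.
have [_ h] := h1; exact: (h 0 i).
Qed.

Lemma within_contP D f :
  {within D, continuous f} <-> forall z, D z -> forall e, 0 < e ->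
    exists2 d, 0 < d & forall z', D z' -> near_pt d z z' -> `|f z - f z'| < e.
Proof.
split=> [/subspace_continuousP h z Dz e e0|h].
  have /cvgrPdist_lt/(_ e e0) := h z Dz; rewrite near_withinE.
  move=> /near_pt_nbhs[d d0 hd]; exists d => // z' Dz' nz; exact: (hd _ nz Dz').
apply/subspace_continuousP => z Dz; apply/cvgrPdist_lt => e e0.
rewrite near_withinE; apply/near_pt_nbhs; have [d d0 hd] := h z Dz e e0.
by exists d => // z' nz Dz'; apply: hd.
Qed.

Lemma smooth_continuous D w g H tau : smooth D w g H tau -> {within D, continuous w}.
Proof.
move=> [K [d [K0 d0 h]]]; apply/within_contP => z Dz e e0.
have n1 : 0 < n%:R + 1 :> R by rewrite ltr_wpDl.
have K1 : 0 < K + 1 by rewrite ltr_wpDl.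
pose m := Num.min d (e / (K + 1)) / (n%:R + 1).
have m0 : 0 < m by rewrite divr_gt0 // lt_min d0 divr_gt0.
exists m => // z' Dz' [hx ht].
have hv : vn (z'.1 - z.1) <= n%:R * m.
  by apply: vn_le => i; rewrite !mxE distrC ltW.
rewrite distrC in ht.
have e1 : (n%:R + 1) * m <= d by rewrite mulrC divfK ?gt_eqF // ge_min lexx.
have e2 : (n%:R + 1) * m <= e / (K + 1).
  by rewrite mulrC divfK ?gt_eqF // ge_min lexx orbT.
have n0 : 0 <= n%:R * m by rewrite mulr_ge0 // ltW.
have [] := h z z' Dz Dz'; [by nra|by nra|move=> _ _ _ hw].
rewrite distrC (le_lt_trans hw) //.
have : (K + 1) * (vn (z'.1 - z.1) + `|z'.2 - z.2|) < e.
  rewrite mulrC -ltr_pdivlMr //; nra.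
have := vn_ge0 (z'.1 - z.1); have := normr_ge0 (z'.2 - z.2); nra.
Qed.

Definition boxT (r a b : R) : set pt :=
  [set z : pt | (forall i, `|z.1 0 i| <= r) /\ a <= z.2 <= b].

Lemma boxT_compact (r a b : R) : compact (boxT r a b).
Proof.
have -> : boxT r a b =
    [set v : 'rV[R]_n | forall i, `[- r, r] (v ord0 i)] `*` `[a, b].
  by apply/seteqP; split=> z [h1 h2]; split => //= i; have := h1 i;
     rewrite /= in_itv /= ler_norml.
apply: compact_setX; last exact: segment_compact.
apply: (@rV_compact R n (fun=> `[- r, r]%classic)) => i; exact: segment_compact.
Qed.

Lemma sublevel_compact D f : compact D -> {within D, continuous f} ->
  compact [set z | D z /\ f z <= 0].
Proof.
move=> cD /within_contP cf; apply: (subclosed_compact _ cD) => [|z []//].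
move=> z cz; have Dz : D z.
  apply: (compact_closed (@norm_hausdorff _ _) cD) => B nB.
  by have [y [[Dy _] By]] := cz B nB; exists y.
split => //; rewrite leNgt; apply/negP => fz.
have [d d0 hd] := cf z Dz _ fz.
have [|y [[Dy fy] ny]] := cz [set y | near_pt d z y].
  by apply/near_pt_nbhs; exists d.
by have := hd y Dy ny; rewrite ltr_norml => /andP[_]; lra.
Qed.

(** Minimizes the time over the compact set where [f <= 0]; positivity before the minimum is the
    one-sided contact used by [touch_time]. *)
Lemma first_touch D f : compact D -> {within D, continuous f} ->
  (exists2 z, D z & f z <= 0) ->
  exists z, [/\ D z, f z <= 0 & forall z', D z' -> z'.2 < z.2 -> 0 < f z'].
Proof.
move=> cD cf [z0 Dz0 fz0].
have [||z] := @compact_EVT_min _ R (fun z : pt => z.2) _ _ (sublevel_compact cD cf).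
- by exists z0.
- by apply/within_contP => z _ e e0; exists e => // z' _ [].
rewrite inE => -[Dz fz] h; exists z; split => // z' Dz' lt.
rewrite ltNge; apply/negP => fz'; have := h z'; rewrite inE => /(_ (conj Dz' fz')).
by rewrite leNgt lt.
Qed.

(** Speed 3 and opening 4 are tuned to the unit box: for [h <= 5/2] and [|y| <= 1/8] the paraboloid
    is negative on the lateral sides and at time -1, and for [h >= 3/2] it exceeds 1 at the
    origin. *)
Definition paraboloid (y : 'rV[R]_n) (h : R) z : R :=
  h + 3 * z.2 - 4 * dot (z.1 - y) (z.1 - y).

Lemma paraboloid_continuous D y h : {within D, continuous (paraboloid y h)}.
Proof.
apply: continuous_subspaceT => z.
have c1 i : {for z, continuous (fun z : pt => z.1 0 i)}.
  apply/cvgrPdist_lt => e e0; apply/near_pt_nbhs; exists e => // z' [h1 _].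
  exact: h1.
have -> : paraboloid y h =
    (fun z : pt => h + 3 * z.2 - 4 * \sum_i (z.1 0 i - y 0 i) * (z.1 0 i - y 0 i)).
  apply/funext => z'; rewrite /paraboloid dotE; congr (_ - _ * _).
  by apply: eq_bigr => i _; rewrite !mxE.
apply: cvgB; first by apply: cvgD; [exact: cvg_cst|apply: cvgMr; exact: cvg_snd].
apply: cvgMr; apply: cvg_big => [|i _]; first exact: add_continuous.
by apply: cvgM; apply: cvgB; by [exact: c1|exact: cvg_cst].
Qed.

Lemma paraboloid_expand y h z (x : 'rV[R]_n) :
  paraboloid y h (x, z.2) =
  paraboloid y h z + dot ((- 8) *: (z.1 - y)) (x - z.1)
    - 4 * dot (x - z.1) (x - z.1).
Proof.
rewrite /paraboloid /=.
have -> : x - y = (z.1 - y) + (x - z.1) by rewrite [RHS]addrC addrA subrK.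
move: (z.1 - y) (x - z.1) => a b; rewrite dotZl dotDl !dotDr (dotC b a); ring.
Qed.

Definition contact w g H tau y h z : Prop :=
  [/\ boxT 1 (-1) 0 z, w z = paraboloid y h z, g z = (- 8) *: (z.1 - y),
      psd (H z + 8%:M) & tau z <= 3].

Lemma contact_exists w g H tau y h :
  smooth (boxT 1 (-1) 0) w g H tau ->
  (forall z, boxT 1 (-1) 0 z -> 0 <= w z) -> w (0, 0) <= 1 ->
  dot y y <= 64^-1 -> 3 / 2 <= h -> h <= 5 / 2 ->
  exists z, contact w g H tau y h z.
Proof.
move=> sm w0 w00 hy h1 h2; set D := boxT 1 (-1) 0.
have cf : {within D, continuous (fun z => w z - paraboloid y h z)}.
  move=> z; apply: (@cvgB _ _ _ _ _ w (paraboloid y h)); last exact: paraboloid_continuous.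
  exact: (smooth_continuous sm).
have [|z [Dz fz hz]] := first_touch (@boxT_compact 1 (-1) 0) cf.
  exists (0, 0).
    by split=> [i|]; rewrite /= ?mxE ?normr0 ?ler01 // lexx oppr_le0 ler01.
  rewrite /paraboloid /= sub0r dotNl dotNr opprK; lra.
have wz := w0 z Dz.
have [Dzx /andP[Dzt1 Dzt2]] := Dz.
have hd : 4 * dot (z.1 - y) (z.1 - y) <= h + 3 * z.2.
  by move: fz; rewrite /paraboloid; lra.
have zt : - (5 / 6) <= z.2 by have := dot_ge0 (z.1 - y); lra.
have zx i : `|z.1 0 i| <= 19 / 20.
  have a1 := sqr_coord_le (z.1 - y) i; have a2 := sqr_coord_le y i.
  rewrite !mxE in a1.
  have sq (a b : R) : 0 <= b -> a ^+ 2 <= b ^+ 2 -> `|a| <= b.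
    by move=> b0 ab; rewrite -(ler_pXn2r (n := 2)) ?nnegrE // real_normK ?num_real.
  have b1 : `|z.1 0 i - y 0 i| <= 4 / 5 by apply: sq; [lra|nra].
  have b2 : `|y 0 i| <= 8^-1 by apply: sq; [lra|nra].
  move: b1 b2; rewrite !ler_norml => /andP[b1 b2] /andP[b3 b4].
  by apply/andP; split; move: b1 b2 b3 b4; clear; lra.
(* At earlier times this is the choice of [z]; at the time of [z] itself it follows by letting
   earlier times approach. *)
have above z' : D z' -> z'.2 <= z.2 -> -1 < z'.2 -> paraboloid y h z' <= w z'.
  move=> Dz'; rewrite le_eqVlt => /orP[/eqP et|lt] z1; last first.
    by have := hz z' Dz' lt; lra.
  have [K [d [K0 d0 hK]]] := sm.
  rewrite -subr_ge0; apply: (@ge0_of_small _ _ (3 + K) (Num.min d (z'.2 + 1))).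
    by rewrite lt_min d0 -ltrBlDr sub0r.
  move=> s s0; rewrite le_min => /andP[sd st].
  have [Dx' /andP[Dt1 Dt2]] := Dz'.
  have Ds : D (z'.1, z'.2 - s).
    by split => //=; apply/andP; split; move: s0 st Dt2; clear; lra.
  have := hz _ Ds; rewrite /= -et => /(_ ltac:(lra)); rewrite /paraboloid /=.
  have [] := hK z' (z'.1, z'.2 - s) Dz' Ds; rewrite /= ?subrr ?vn0 ?(ltW d0) //.
    by rewrite (_ : _ - _ = - s) ?normrN ?gtr0_norm //; ring.
  rewrite (_ : z'.2 - s - z'.2 = - s); last by ring.
  move=> _ _ _; rewrite normrN (gtr0_norm s0) ?subrr ?vn0 ?add0r ler_norml => /andP[_ b1].
  by nra.
have ez : w z = paraboloid y h z.
  by apply/eqP; rewrite eq_le above // ?andbT; lra.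
have [eg hH] : g z = (- 8) *: (z.1 - y) /\ psd (H z - (- 8)%:M).
  apply: (@touch_space _ _ _ _ _ _ _ _ _ _ 0 (20^-1) sm Dz) => //; first by rewrite tr_scalar_mx.
  move=> x hx.
  have Dx : D (x, z.2).
    split=> [i|] /=; last by rewrite Dzt1.
    have a1 := coord_vn (x - z.1) i; rewrite !mxE in a1.
    have -> : x 0 i = z.1 0 i + (x 0 i - z.1 0 i) by ring.
    rewrite (le_trans (ler_normD _ _)) //; have := zx i; lra.
  split => //; have := above _ Dx (lexx _); rewrite /= => /(_ ltac:(lra)).
  rewrite paraboloid_expand ez mul0r subr0; apply: le_trans.
  by rewrite -scalemx1 qfZm qf1; lra.
exists z; split => //.
- by rewrite (_ : _ + _ = H z - (- 8)%:M) // raddfN opprK.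
- apply: (@touch_time _ _ _ _ _ _ _ _ 3 0 (12^-1) sm Dz) => [|s s0 s1]; first by lra.
  have Ds : D (z.1, z.2 - s).
    by split => //=; apply/andP; split; move: s0 s1 zt Dzt2; clear; lra.
  split => //; have := above _ Ds; rewrite /= => /(_ ltac:(move: s0; clear; lra) ltac:(move: s1 zt; clear; lra)).
  by rewrite ez /paraboloid /=; lra.
Qed.

End ContactPoints.

(** * Counting contact points on a grid *)

Lemma eq_modn_close (R : realType) (m a b : nat) (c : R) :
  c < m%:R -> `|a%:R - b%:R| <= c -> (a %% m = b %% m)%N -> a = b.
Proof.
move=> cm; wlog ab : a b / (a <= b)%N => [hw|h e].
  case: (leqP a b) => [/hw//|/ltnW /hw h1 h2 /esym /h1 ->//].
  by rewrite distrC.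
have : (m %| b - a)%N by rewrite -eqn_mod_dvd // e.
have : (b - a < m)%N.
  rewrite -(ltr_nat R) natrB // (le_lt_trans _ cm) // (le_trans (ler_norm _)) //.
  by rewrite distrC.
case: (posnP (b - a)) => [e0 _ _|p l /(dvdn_leq p)]; last by rewrite leqNgt l.
by apply/eqP; rewrite eqn_leq ab -subn_eq0 e0.
Qed.

Section ContactCount.
Context {R : realType} {n : nat}.
Notation pt := ('rV[R]_n * R)%type.
Implicit Types (w tau : pt -> R) (g : pt -> 'rV[R]_n) (H : pt -> 'M[R]_n) (z : pt).
Variables (lam Lam : R).
Hypothesis lam0 : 0 < lam.

Definition hess_bound : R := n%:R ^+ 2 * ((3 + 8 * Lam * n%:R) / lam) + 8 * n%:R.

(** Testing the supersolution inequality with [H = (H + 8) - 8] bounds [tr (H + 8)] from above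
    because [tau <= 3], and bounds [tau] from below because this trace is nonnegative. *)
Lemma contact_bounds w g H tau y h z :
  contact w g H tau y h z -> pucci_super lam Lam (H z) (tau z) ->
  mn (H z) <= hess_bound /\ - (8 * Lam * n%:R) <= tau z.
Proof.
move=> [_ _ _ hP ht] hS.
have h8 : psd (8%:M : 'M[R]_n) by rewrite -scalemx1; apply: psdZ; [lra|exact: psd1].
have := hS _ _ hP h8; rewrite addrK mxtrace_scalar => /(_ erefl) h1.
have t0 := psd_tr hP.
rewrite -[8 *+ n]mulr_natr in h1.
have tb : \tr (H z + 8%:M) <= (3 + 8 * Lam * n%:R) / lam.
  by rewrite ler_pdivlMr //; lra.
split; last by have := mulr_ge0 (ltW lam0) t0; lra.
have -> : H z = (H z + 8%:M) + (- 8) *: 1%:M.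
  by rewrite scalemx1 raddfN addrK.
rewrite (le_trans (mnD _ _)) // mnZ mn1 normrN ger0_norm // lerD2r.
by rewrite (le_trans (psd_mn hP)) // ler_wpM2l // exprn_ge0.
Qed.

Let C1 : R := 1 + (n%:R * hess_bound + n%:R ^+ 2 + 1) / 8.
Let C2 : R := hess_bound * n%:R ^+ 2 / 2 + (8 * Lam * n%:R + 6) + 4 * n%:R ^+ 2
  + (n%:R ^+ 3 + n%:R + 1).

Ltac lran := clear -lam0 C1 C2; intros; lra.

(** Discrete counterpart of the Jacobian bound in the Krylov-Tso area argument: the vertex
    [y = x + g / 8] and, for a fixed vertex, the height [h] are functions of the contact point,
    whose increments are controlled by the bounded Hessian and time derivative. Since [K * l <= 1],
    the Taylor remainders are no larger than the main terms, and [C1], [C2] do not depend on [K].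
    Heights are compared only for equal vertices, as otherwise they may differ by order [l] instead
    of [l ^+ 2]. *)
Lemma contact_close (K d l : R) w g H tau y h z y' h' z' :
  smoothC K d (boxT 1 (-1) 0) w g H tau ->
  (forall z, boxT 1 (-1) 0 z -> pucci_super lam Lam (H z) (tau z)) ->
  contact w g H tau y h z -> contact w g H tau y' h' z' ->
  0 < l -> l <= 1 -> K * l <= 1 -> n%:R * l <= d -> l <= d ->
  (forall i, `|z'.1 0 i - z.1 0 i| <= l) -> `|z'.2 - z.2| <= l ^+ 2 ->
  (forall i, `|y' 0 i - y 0 i| <= C1 * l) /\ (y' = y -> `|h' - h| <= C2 * l ^+ 2).
Proof.
move=> [K0 d0 hK] hS c c' l0 l1 Kl nl ld hx ht.
have [Dz ez eg hP hT] := c; have [Dz' ez' eg' _ _] := c'.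
have [hm hT'] := contact_bounds c (hS z Dz).
have ll : l ^+ 2 <= l by rewrite expr2 ler_piMl // ltW.
have vx : vn (z'.1 - z.1) <= n%:R * l by apply: vn_le => i; rewrite !mxE.
have v0 := vn_ge0 (z'.1 - z.1).
have vxd : vn (z'.1 - z.1) <= d := le_trans vx nl.
have htd : `|z'.2 - z.2| <= d := le_trans ht (le_trans ll ld).
have [_ a1 a2 _] := hK z z' Dz Dz' vxd htd.
have m0 := mn_ge0 (H z).
have vx2 : vn (z'.1 - z.1) ^+ 2 <= n%:R ^+ 2 * l ^+ 2.
  by rewrite -exprMn ler_pXn2r // nnegrE mulr_ge0 // ltW.
have n0 : 0 <= n%:R :> R by [].
split=> [i|ey].
  have b1 : `|g z' 0 i - g z 0 i| <= l * (n%:R * hess_bound + n%:R ^+ 2 + 1).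
    have := coord_vn (g z' - g z - (z'.1 - z.1) *m H z) i.
    have := coord_vn ((z'.1 - z.1) *m H z) i; have := vn_mulmx (z'.1 - z.1) (H z).
    set q := (_ *m _) in a2 *; clearbody q; rewrite !mxE => b1 b2 b3.
    have -> : g z' 0 i - g z 0 i = (g z' 0 i - g z 0 i - q 0 i) + q 0 i by ring.
    rewrite (le_trans (ler_normD _ _)) //.
    have b4 : vn (z'.1 - z.1) * mn (H z) <= n%:R * l * hess_bound by apply: ler_pM.
    have b5 : K * (vn (z'.1 - z.1) ^+ 2 + `|z'.2 - z.2|) <= l * (n%:R ^+ 2 + 1).
      apply: (@le_trans _ _ (K * (n%:R ^+ 2 * l ^+ 2 + l ^+ 2))).
        by rewrite ler_wpM2l // lerD.
      have : 0 <= (1 - K * l) * (l * (n%:R ^+ 2 + 1)).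
        by rewrite mulr_ge0 ?subr_ge0 // mulr_ge0 ?(ltW l0) // addr_ge0 // exprn_ge0.
      by rewrite expr2; lran.
    by move: b1 b2 b3 b4 b5 a2; move: (vn _) (vn _); lran.
  have eyi : y 0 i = z.1 0 i + g z 0 i / 8 by rewrite eg !mxE; field.
  have eyi' : y' 0 i = z'.1 0 i + g z' 0 i / 8 by rewrite eg' !mxE; field.
  rewrite eyi eyi'.
  have -> : z'.1 0 i + g z' 0 i / 8 - (z.1 0 i + g z 0 i / 8) =
    (z'.1 0 i - z.1 0 i) + (g z' 0 i - g z 0 i) / 8 by field.
  rewrite (le_trans (ler_normD _ _)) // normrM (ger0_norm (_ : 0 <= 8^-1)) //.
  by have := hx i; move: b1; rewrite /C1; lran.
(* Both paraboloids touch [w], so the height difference compares the second order expansions of [w]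
   and of the paraboloid at [z]; the linear terms cancel because the gradients agree. *)
have -> : h' - h = (w z' - w z - dot (g z) (z'.1 - z.1)
    - qf (H z) (z'.1 - z.1) / 2 - tau z * (z'.2 - z.2))
   + (qf (H z) (z'.1 - z.1) / 2 + (tau z - 3) * (z'.2 - z.2)
      + 4 * dot (z'.1 - z.1) (z'.1 - z.1)).
  have := paraboloid_expand y h z z'.1; rewrite -ez.
  have -> : paraboloid y h (z'.1, z.2) =
      paraboloid y' h' z' + (h - h') - 3 * (z'.2 - z.2).
    by rewrite ey /paraboloid /=; ring.
  by rewrite -ez' eg; lran.
have q1 : `|qf (H z) (z'.1 - z.1) / 2| <= hess_bound * n%:R ^+ 2 / 2 * l ^+ 2.
  rewrite normrM (ger0_norm (_ : 0 <= 2^-1)) //.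
  have := qf_le (H z) (z'.1 - z.1).
  have : mn (H z) * vn (z'.1 - z.1) ^+ 2 <= hess_bound * (n%:R ^+ 2 * l ^+ 2).
    by apply: ler_pM => //; exact: exprn_ge0.
  by lran.
have q2 : `|(tau z - 3) * (z'.2 - z.2)| <= (8 * Lam * n%:R + 6) * l ^+ 2.
  rewrite normrM ler_pM // ler_norml; apply/andP; split; move: hT hT'; lran.
have q3 : `|4 * dot (z'.1 - z.1) (z'.1 - z.1)| <= 4 * n%:R ^+ 2 * l ^+ 2.
  by rewrite ger0_norm ?mulr_ge0 ?dot_ge0 //; have := dot_vn (z'.1 - z.1); move: vx2; lran.
have q4 : K * (vn (z'.1 - z.1) ^+ 3 + vn (z'.1 - z.1) * `|z'.2 - z.2| + (z'.2 - z.2) ^+ 2)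
    <= (n%:R ^+ 3 + n%:R + 1) * l ^+ 2.
  apply: (@le_trans _ _ (K * (n%:R ^+ 3 * l ^+ 3 + n%:R * l ^+ 3 + l ^+ 3))).
    apply: ler_wpM2l => //; apply: lerD; first apply: lerD.
    - by rewrite -exprMn ler_pXn2r // nnegrE mulr_ge0 // ltW.
    - by rewrite (exprS l 2) mulrA ler_pM.
    - rewrite -real_normK ?num_real // (le_trans (_ : _ <= (l ^+ 2) ^+ 2)) //.
        by rewrite ler_pXn2r // nnegrE exprn_ge0 // ltW.
      by rewrite -exprM ler_wiXn2l // ltW.
  have e0 : 0 <= (n%:R ^+ 3 + n%:R + 1 : R) * l ^+ 2.
    by rewrite mulr_ge0 ?exprn_ge0 ?(ltW l0) // !addr_ge0 // exprn_ge0.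
  have := mulr_ge0 (_ : 0 <= 1 - K * l) e0; rewrite subr_ge0 => /(_ Kl).
  by rewrite (exprS l 2); lran.
rewrite (le_trans (ler_normD _ _)) // (le_trans (lerD a1 (ler_normD _ _))) //.
have := ler_normD (qf (H z) (z'.1 - z.1) / 2) ((tau z - 3) * (z'.2 - z.2)).
by move: q1 q2 q3 q4; rewrite /C2; lran.
Qed.

(** A lower bound for the measure of the set [w <= 3], with cells of size [l] by [l ^+ 2] in place
    of volume. The labelling [cell] is arbitrary, so that it can be pulled back from a dyadic mesh
    under a rescaling. *)
Definition contact_counts (mu K d l0 : R) : Prop := forall w g H tau,
    smoothC K d (boxT 1 (-1) 0) w g H tau ->
    (forall z, boxT 1 (-1) 0 z -> 0 <= w z) -> w (0, 0) <= 1 ->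
    (forall z, boxT 1 (-1) 0 z -> pucci_super lam Lam (H z) (tau z)) ->
    forall l : R, 0 < l -> l <= l0 ->
    forall (I : finType) (cell : pt -> I),
    (forall z z', boxT 1 (-1) 0 z -> boxT 1 (-1) 0 z' -> cell z = cell z' ->
      (forall i, `|z'.1 0 i - z.1 0 i| <= l) /\ `|z'.2 - z.2| <= l ^+ 2) ->
    mu <= #|[pred c | `[< exists z, [/\ boxT 1 (-1) 0 z, cell z = c & w z <= 3] >]]|%:R
          * l ^+ (n + 2).

(* Each paraboloid of a grid in [(y, h)] touches [w] from below at a point where
   the Hessian and the time derivative are bounded, so that the contact points
   lying in one cell come from boundedly many grid points. *)
Lemma contact_count :
  exists2 mu : R, 0 < mu & forall K d : R, 0 <= K -> 0 < d ->
  exists2 l0 : R, 0 < l0 & contact_counts mu K d l0.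
Proof.
(* With this choice the grid vertices satisfy [|y|^2 <= n eta^2 <= 1/64], as [contact_exists]
   requires. *)
pose eta : R := (8 * (n%:R + 1))^-1.
have n0 : 0 <= n%:R :> R by [].
have n1 : 0 < 8 * (n%:R + 1) :> R by lra.
have eta0 : 0 < eta by rewrite invr_gt0.
have eta1 : eta <= 1 by rewrite invf_le1 //; lra.
have neta : n%:R * eta ^+ 2 <= 64^-1.
  have e8 : 8 * (n%:R + 1) * eta = 1 by rewrite mulfV // gt_eqF.
  have : 0 <= n%:R * eta by rewrite mulr_ge0 // ltW.
  by rewrite expr2; nra.
pose m1 := (Num.truncn C1).+1; pose m2 := (Num.truncn C2).+1.
have C1m : C1 < m1%:R by apply: truncnS_gt.
have C2m : C2 < m2%:R by apply: truncnS_gt.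
pose M : R := m1%:R ^+ n * m2%:R.
have M0 : 0 < M by rewrite mulr_gt0 ?exprn_gt0 // ltr0n.
exists ((eta / 2) ^+ n / 2 / M); first by rewrite !divr_gt0 // exprn_gt0 // divr_gt0.
move=> K d K0 d0; have K1 : 0 < K + 1 by lra.
exists (Num.min (eta / 2) (Num.min (K + 1)^-1 (d / (n%:R + 1)))).
  by rewrite !lt_min !divr_gt0 ?invr_gt0 //; lra.
move=> w g H tau sm w0 w00 hS l l0; rewrite !le_min => /and3P[le lK ld] I cell hcell.
have Kl : K * l <= 1.
  by move: lK; rewrite -[_^-1]mul1r ler_pdivlMr // mulrDr mulr1 mulrC; lra.
have dl : l * (n%:R + 1) <= d by rewrite -ler_pdivlMr //; lra.
have nl : n%:R * l <= d by lra.
have ld' : l <= d by have := mulr_ge0 n0 (ltW l0); lra.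
have l1 : l <= 1 by lra.
pose A := Num.truncn (eta / l); pose B := Num.truncn (l ^- 2).
have Ale : A%:R <= eta / l by rewrite truncn_le // divr_ge0 // ltW.
have Ble : B%:R <= l ^- 2 by rewrite truncn_le // invr_ge0 exprn_ge0 // ltW.
have Age : eta / 2 / l <= A%:R.
  have : eta / l < A.+1%:R by apply: truncnS_gt.
  have : 1 <= eta / 2 / l by rewrite ler_pdivlMr // mul1r.
  rewrite -(natr1 A) (mulrAC eta); move: (eta / l); lran.
have Bge : (2 * l ^+ 2)^-1 <= B%:R.
  have : l ^- 2 < B.+1%:R by apply: truncnS_gt.
  have : 1 <= (2 * l ^+ 2)^-1 by rewrite invf_ge1 ?mulr_gt0 ?exprn_gt0 // expr2; nra.
  by rewrite invfM -(natr1 B); move: (l ^- 2); lran.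
pose yy (a : {ffun 'I_n -> 'I_A}) : 'rV[R]_n := \row_i (l * (a i : nat)%:R).
pose hh (b : 'I_B) : R := 3 / 2 + l ^+ 2 * (b : nat)%:R.
have hc (ab : {ffun 'I_n -> 'I_A} * 'I_B) :
    exists z, contact w g H tau (yy ab.1) (hh ab.2) z.
  apply: contact_exists => //; first by exists K, d.
  - rewrite dotE (le_trans _ neta) //.
    rewrite (le_trans (_ : _ <= \sum_(i < n) eta ^+ 2)) //; last first.
      by rewrite sumr_const card_ord mulr_natl.
    apply: ler_sum => i _; rewrite -expr2 mxE ler_pXn2r ?nnegrE ?mulr_ge0 ?(ltW l0) ?(ltW eta0) //.
    rewrite mulrC -ler_pdivlMr // (le_trans _ Ale) // ler_nat ltnW //.
  - by rewrite /hh lerDl mulr_ge0 // exprn_ge0 // ltW.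
  - have : (ab.2 : nat)%:R <= l ^- 2 by rewrite (le_trans _ Ble) // ler_nat ltnW.
    by rewrite -[_^-1]mul1r ler_pdivlMr ?exprn_gt0 // /hh mulrC; move: (_%:R); lran.
have [zc hzc] := choice hc.
set G := [pred c | _].
(* If the contact points of two grid points share a cell, the indices of their vertices differ by at
   most [C1 < m1] and, for equal vertices, those of their heights by at most [C2 < m2]. The residues
   therefore tell them apart, and [phi] is injective. *)
pose phi (ab : {ffun 'I_n -> 'I_A} * 'I_B) : I * {ffun 'I_n -> 'I_m1} * 'I_m2 :=
  (cell (zc ab), [ffun i => inord (ab.1 i %% m1)], inord (ab.2 %% m2)).
have inj : injective phi.
  move=> ab ab' [ec ea eb].
  have ea' i : (ab.1 i %% m1 = ab'.1 i %% m1)%N.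
    have /ffunP/(_ i) := ea; rewrite !ffunE => /(congr1 val).
    by rewrite /= !inordK ?ltn_mod.
  have eb' : (ab.2 %% m2 = ab'.2 %% m2)%N.
    by have /(congr1 val) := eb; rewrite /= !inordK ?ltn_mod.
  have [Dz _ _ _ _] := hzc ab; have [Dz' _ _ _ _] := hzc ab'.
  have [hx ht] := hcell _ _ Dz Dz' ec.
  have [cy ch] := contact_close sm hS (hzc ab) (hzc ab') l0 l1 Kl nl ld' hx ht.
  have e1 : ab'.1 = ab.1.
    apply/ffunP => i; apply: val_inj; apply: (eq_modn_close C1m _ (esym (ea' i))).
    have := cy i; rewrite !mxE -mulrBr normrM (gtr0_norm l0) mulrC.
    by rewrite ler_pM2r.
  have e2 : ab'.2 = ab.2.
    apply: val_inj; apply: (eq_modn_close C2m _ (esym eb')).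
    have := ch (congr1 yy e1); rewrite /hh opprD addrACA subrr add0r -mulrBr normrM.
    by rewrite (gtr0_norm (exprn_gt0 2 l0)) mulrC ler_pM2r // exprn_gt0.
  by case: (ab) (ab') e1 e2 => a b [a' b'] /= -> ->.
have card : (A ^ n * B <= #|G| * (m1 ^ n * m2))%N.
  have -> : (A ^ n * B = #|{: {ffun 'I_n -> 'I_A} * 'I_B}|)%N.
    by rewrite card_prod card_ffun !card_ord.
  rewrite -(card_codom inj).
  apply: leq_trans (_ : #|[predX [predX G & {: {ffun 'I_n -> 'I_m1}}] & 'I_m2]| <= _)%N.
    apply: subset_leq_card; apply/fintype.subsetP => _ /codomP[ab ->].
    rewrite inE /= !andbT inE /= andbT; apply/asboolP.
    exists (zc ab); have [Dz ez _ _ _] := hzc ab; split => //.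
    rewrite ez /paraboloid; have [_ /andP[_ t0]] := Dz.
    have := dot_ge0 ((zc ab).1 - yy ab.1).
    have : (ab.2 : nat)%:R <= l ^- 2 by rewrite (le_trans _ Ble) // ler_nat ltnW.
    rewrite -[_^-1]mul1r ler_pdivlMr ?exprn_gt0 // /hh mulrC; move: t0; lran.
  by rewrite !cardX card_ffun !card_ord mulnA.
rewrite ler_pdivrMr // -[X in _ <= X]mulrA (mulrC _ M) mulrA.
move: card; rewrite -(ler_nat R) !natrM !natrX -/M => card.
apply: (@le_trans _ _ (A%:R ^+ n * B%:R * l ^+ (n + 2))); last first.
  by rewrite ler_wpM2r // exprn_ge0 // ltW.
have -> : (eta / 2) ^+ n / 2 = (eta / 2 / l) ^+ n * (2 * l ^+ 2)^-1 * l ^+ (n + 2).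
  have l0n : l ^+ n != 0 by rewrite gt_eqF // exprn_gt0.
  rewrite (expr_div_n (eta / 2) l) exprD; move: ((eta / 2) ^+ n) (l ^+ n) l0n => p q q0.
  by field; rewrite q0 gt_eqF.
rewrite ler_wpM2r ?exprn_ge0 ?(ltW l0) // ler_pM //.
- by rewrite exprn_ge0 // divr_ge0 ?(ltW l0) // divr_ge0 ?(ltW eta0).
- by rewrite invr_ge0 mulr_ge0 // exprn_ge0 // ltW.
- by apply: lerXn2r; rewrite ?nnegrE // divr_ge0 ?(ltW l0) // divr_ge0 ?(ltW eta0).
Qed.

End ContactCount.

(** * A barrier on an expanding ball *)

Section Barrier.
Context {R : realType} {n : nat}.
Notation pt := ('rV[R]_n * R)%type.
Implicit Types (D : set pt) (w tau : pt -> R) (g : pt -> 'rV[R]_n)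
  (H : pt -> 'M[R]_n) (z : pt).
Variables (lam Lam : R).
Hypothesis lam0 : 0 < lam.

Lemma continuous_dot D : {within D, continuous (fun z : pt => dot z.1 z.1)}.
Proof.
have -> : (fun z : pt => dot z.1 z.1) =
    (fun z : pt => 4^-1 * (3 * z.2 - paraboloid 0 0 z)).
  by apply/funext => z; rewrite /paraboloid subr0; field.
move=> z; apply: cvgMr; apply: cvgB; last exact: paraboloid_continuous.
apply: cvgMr; apply: (continuous_subspaceT (f := snd)) => z'; exact: cvg_snd.
Qed.

Variables (eta kap Q T rb : R).
Hypotheses (eta0 : 0 < eta) (kap0 : 0 <= kap) (T0 : 0 < T) (Q0 : 0 <= Q) (rb0 : 0 < rb).
(** A discriminant condition. With [c1] the squared bracket's base, the subsolution inequality for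
    [f^2 exp(-Q t)] follows from [8 lam eta^2 - c1 f + Q f^2 >= 0]. *)
Hypothesis Qlarge :
  (8 * lam + 4 * Lam * n%:R + 2 * kap) ^+ 2 <= 32 * lam * eta ^+ 2 * Q.
Hypothesis rblarge : eta ^+ 2 + kap * T < rb ^+ 2.

Let f z : R := eta ^+ 2 + kap * z.2 - dot z.1 z.1.

Ltac lran := clear -lam0 eta0 kap0 T0 Q0 rb0 Qlarge rblarge f; intros; lra.
Ltac nran := clear -lam0 eta0 kap0 T0 Q0 rb0 Qlarge rblarge f; intros; nra.

(* [f^2 exp(-Qt)] is a subsolution on the expanding ball [f > 0]. *)
Lemma barrier_le w g H tau (c : R) :
  0 < c -> smooth (boxT rb 0 T) w g H tau ->
  (forall z, boxT rb 0 T z -> 0 <= w z) ->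
  (forall z, boxT rb 0 T z -> pucci_super lam Lam (H z) (tau z)) ->
  (forall x, dot x x <= eta ^+ 2 -> c <= w (x, 0)) ->
  forall z, boxT rb 0 T z -> 0 <= f z ->
  c / eta ^+ 4 * f z ^+ 2 * expR (- (Q * z.2)) <= w z.
Proof.
have Ql := Qlarge.
move=> c0 sm w0 hS wc z0 Dz0 fz0; rewrite leNgt; apply/negP => ltw.
pose A := c / eta ^+ 4; have A0 : 0 < A by rewrite divr_gt0 // exprn_gt0.
pose ph z := A * f z ^+ 2 * expR (- (Q * z.2)).
have [Dx0 /andP[t00 t01]] := Dz0.
(* The gap at [z0] is spent on the term [e * (1 + z.2)]: it makes the comparison strict, while the
   lowered barrier still reaches [w] at [z0]. *)
pose e := (ph z0 - w z0) / (1 + T).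
have e0 : 0 < e by rewrite divr_gt0 ?subr_gt0 // ltr_wpDr // ltW.
pose D := [set z | boxT rb 0 T z /\ - f z <= 0].
have cz2 D' : {within D', continuous (fun z : pt => z.2)}.
  by apply: (continuous_subspaceT (f := snd)) => z'; exact: cvg_snd.
have cf D' : {within D', continuous f}.
  move=> z; apply: (@cvgB _ _ _ _ _ (fun z : pt => eta ^+ 2 + kap * z.2));
    last exact: continuous_dot.
  by apply: cvgD; [exact: cvg_cst|apply: cvgMr; exact: cz2].
have cD : compact D.
  apply: sublevel_compact; first exact: boxT_compact.
  by move=> z; apply: cvgN; exact: cf.
have sD : D `<=` boxT rb 0 T by move=> z [].
have cG : {within D, continuous (fun z => w z - ph z + e * (1 + z.2))}.
  move=> z; apply: cvgD; last first.
    by apply: cvgMr; apply: cvgD; [exact: cvg_cst|exact: cz2].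
  apply: cvgB; first exact: (smooth_continuous (smooth_sub sD sm)).
  apply: (@cvgM _ _ _ _ (fun z => A * f z ^+ 2)).
    under [X in X @ _ --> _]eq_fun do rewrite expr2.
    by rewrite expr2; apply: cvgMr; apply: cvgM; exact: cf.
  apply: (@cvg_comp _ _ _ (fun z : pt => - (Q * z.2)) expR).
    by apply: cvgN; apply: cvgMr; exact: cz2.
  exact: continuous_expR.
have [|z [[Dz fz] Gz hz]] := first_touch cD cG.
  exists z0; first by split => //; rewrite oppr_le0.
  have : e * (1 + z0.2) <= e * (1 + T) by rewrite ler_wpM2l ?(ltW e0) // lerD2l.
  by rewrite [e * (1 + T)]divfK ?gt_eqF ?ltr_wpDr ?(ltW T0) //; lra.
rewrite oppr_le0 in fz; have [Dx /andP[zt0 zt1]] := Dz; have wz := w0 z Dz.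
have ex0 := expR_gt0 (- (Q * z.2)).
(* On the lateral boundary the barrier vanishes, and at time 0 it is at most [c]; so the first
   contact is interior. *)
have fpos : 0 < f z.
  rewrite lt_neqAle fz andbT eq_sym; apply/eqP => fe.
  by move: Gz; rewrite /ph fe expr0n /= mulr0 mul0r subr0; nra.
have tpos : 0 < z.2.
  rewrite lt_neqAle zt0 andbT eq_sym; apply/eqP => te.
  have d0 := dot_ge0 z.1.
  have fe : f z = eta ^+ 2 - dot z.1 z.1 by rewrite /f te mulr0 addr0.
  have : c <= w z.
    by rewrite (surjective_pairing z) te; apply: wc; rewrite fe in fz; lra.
  have : ph z <= c.
    rewrite /ph te mulr0 oppr0 expR0 mulr1 /A -mulrA ler_piMr ?(ltW c0) //.
    rewrite mulrC ler_pdivrMr ?exprn_gt0 // mul1r (exprM eta 2 2).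
    by rewrite ler_pXn2r ?nnegrE // ?exprn_ge0 ?(ltW eta0) // fe; lra.
  by move: Gz; nra.
have fine (x : 'rV[R]_n) (t : R) : dot x x < eta ^+ 2 + kap * t -> 0 <= t -> t <= T ->
    D (x, t).
  move=> h1 h2 h3.
  have h4 : dot x x < rb ^+ 2.
    by have := ler_wpM2l kap0 h3; move: rblarge h1; lran.
  split; last by move: h1; rewrite /f /=; lran.
  split=> [i|] /=; last by rewrite h2.
  rewrite -(ler_pXn2r (n := 2)) ?nnegrE ?(ltW rb0) // real_normK ?num_real //.
  by have := sqr_coord_le x i; move: h4; lran.
have [K [d [K0 d0 hK]]] := sm.
pose E := A * expR (- (Q * z.2)).
have E0 : 0 < E by rewrite mulr_gt0.
have phz : ph z = E * f z ^+ 2 by rewrite /ph /E mulrAC.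
have above x : 0 < f (x, z.2) -> ph (x, z.2) - e * (1 + z.2) <= w (x, z.2).
  move=> fx; have d1 : 0 < Num.min d (Num.min z.2 (f (x, z.2) / (kap + 1))).
    by rewrite !lt_min d0 tpos divr_gt0 // ltr_wpDl.
  rewrite -subr_ge0.
  pose B := A * f (x, z.2) ^+ 2 * expR (- (Q * z.2)).
  apply: (@ge0_of_small _ _ (K + A * (2 * kap * f (x, z.2)) * expR (- (Q * z.2)) + e) _ d1).
  move=> s s0; rewrite !le_min => /and3P[sd st sf].
  have sf' : s * kap < f (x, z.2).
    have : s * (kap + 1) <= f (x, z.2) by rewrite -ler_pdivlMr // ltr_wpDl.
    by move: s0; move: (f _) => y; lran.
  have Ds : D (x, z.2 - s).
    apply: fine; first by move: sf'; rewrite /f /=; lran.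
      by rewrite subr_ge0.
    by rewrite (le_trans _ zt1) // gerBl ltW.
  have Dx' : D (x, z.2) by apply: fine => //; move: fx; rewrite /f /=; lran.
  have st' : (x, z.2 - s).2 < z.2 by rewrite /= ltrBlDr ltrDl.
  have h1 : 0 < w (x, z.2 - s) - ph (x, z.2 - s) + e * (1 + (z.2 - s)) := hz _ Ds st'.
  have [] := hK (x, z.2) (x, z.2 - s) (sD _ Dx') (sD _ Ds); rewrite /= ?subrr ?vn0 ?(ltW d0) //.
    by rewrite (_ : _ - _ = - s) ?normrN ?gtr0_norm //; ring.
  rewrite (_ : z.2 - s - z.2 = - s); last by ring.
  move=> _ _ _; rewrite normrN (gtr0_norm s0) ?subrr ?vn0 ?add0r ler_norml => /andP[_ h2].
  have h3 : ph (x, z.2) - s * (A * (2 * kap * f (x, z.2)) * expR (- (Q * z.2)))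
      <= ph (x, z.2 - s).
    have -> : ph (x, z.2) - s * (A * (2 * kap * f (x, z.2)) * expR (- (Q * z.2))) =
        A * (f (x, z.2) ^+ 2 - 2 * kap * s * f (x, z.2)) * expR (- (Q * z.2)).
      by rewrite /ph /=; ring.
    have fs : f (x, z.2 - s) = f (x, z.2) - kap * s by rewrite /f /=; ring.
    apply: (@le_trans _ _ (A * f (x, z.2 - s) ^+ 2 * expR (- (Q * z.2)))).
      rewrite ler_wpM2r ?(ltW ex0) // ler_wpM2l ?(ltW A0) // fs.
      by have := sqr_ge0 (kap * s); rewrite !expr2; move: (f _) => y; lran.
    rewrite /ph; apply: ler_wpM2l; first by rewrite mulr_ge0 ?sqr_ge0 // ltW.
    rewrite ler_expR /=.
    by have := mulr_ge0 Q0 (ltW s0); lran.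
  have := mulr_gt0 e0 s0; rewrite -/B; move: h1 h2 h3.
  by move: (ph _) (ph _) (w _) (w _) (A * (2 * kap * _) * _) => a1 a2 a3 a4 a5; lran.
have ez : w z = ph z - e * (1 + z.2).
  have := above z.1; rewrite -surjective_pairing => /(_ fpos); move: Gz; lran.
have zq : 0 < Num.min 1 (f z / (2 * vn z.1 + 1)).
  by rewrite lt_min ltr01 divr_gt0 // ltr_wpDl // mulr_ge0 // vn_ge0.
(* The spatial Hessian of [f^2] is [8 x x^T - 4 f I]. The cubic term in the expansion of [f^2] goes
   into the slack of [touch_space], and the quartic one is nonnegative. *)
have [_ hP] : g z = (- 4 * E * f z) *: z.1 /\
    psd (H z - E *: (8 *: (z.1^T *m z.1) - (4 * f z) *: 1%:M)).
  apply: (@touch_space _ _ _ _ _ _ _ _ _ _ (4 * E * vn z.1) _ sm Dz zq).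
  - by apply: mulr_ge0; [exact: mulr_ge0 (ltW E0)|exact: vn_ge0].
  - by rewrite linearZ /= linearB /= !linearZ /= trmx_mul trmxK trmx1.
  move=> x; rewrite le_min => /andP[hx1].
  rewrite ler_pdivlMr; last by rewrite ltr_wpDl // mulr_ge0 // vn_ge0.
  move=> hx2; set y := x - z.1 in hx1 hx2 *.
  have ex : x = z.1 + y by rewrite /y addrCA subrr addr0.
  clearbody y.
  have v0 := vn_ge0 y; have vz0 := vn_ge0 z.1.
  have b1 := dot_le z.1 y; have b2 := dot_vn y; have b3 := dot_ge0 y.
  have fx : f (x, z.2) = f z - 2 * dot z.1 y - dot y y.
    by rewrite /f /= ex !dotDl !dotDr (dotC y z.1); ring.
  have b4 : dot y y <= vn y by rewrite (le_trans b2) // expr2 ler_piMl.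
  have [b5 b6] : - (vn z.1 * vn y) <= dot z.1 y /\ dot z.1 y <= vn z.1 * vn y.
    by move: b1; rewrite ler_norml => /andP[].
  have fx0 : 0 <= f (x, z.2).
    by rewrite fx; move: hx2 b4 b6; move: (f z) (dot _ _) (dot _ _) (vn _) (vn _); nran.
  have Dxx : boxT rb 0 T (x, z.2).
    have h4 : dot x x < rb ^+ 2.
      by have := ler_wpM2l kap0 zt1; move: rblarge fx0; rewrite /f /=; lran.
    split=> [i|] /=; last by rewrite zt0.
    rewrite -(ler_pXn2r (n := 2)) ?nnegrE ?(ltW rb0) // real_normK ?num_real //.
    by have := sqr_coord_le x i; move: h4; lran.
  split => //.
  have key : ph (x, z.2) - e * (1 + z.2) <= w (x, z.2).
    move: fx0; rewrite le_eqVlt => /orP[/eqP fe|]; last exact: above.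
    apply: le_trans (w0 _ Dxx); rewrite /ph -fe expr0n /= mulr0 mul0r sub0r oppr_le0.
    by rewrite mulr_ge0 ?(ltW e0) // addr_ge0.
  apply: le_trans key; rewrite ez phz.
  have -> : ph (x, z.2) = E * f (x, z.2) ^+ 2 by rewrite /ph /E /= mulrAC.
  rewrite dotZl qfZm qfDm qfNm !qfZm qf_outer qf1 fx (dotC y z.1).
  have b7 : - (vn z.1 * vn y * vn y ^+ 2) <= dot z.1 y * dot y y.
    have : 0 <= (dot z.1 y + vn z.1 * vn y) * dot y y by rewrite mulr_ge0 //; move: b5; lran.
    have : vn z.1 * vn y * dot y y <= vn z.1 * vn y * vn y ^+ 2.
      by rewrite ler_wpM2l // mulr_ge0.
    by move: (dot _ _) (dot _ _) (vn _) (vn _); nran.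
  have : 0 <= E * (4 * (dot z.1 y * dot y y + vn z.1 * vn y * vn y ^+ 2) + dot y y ^+ 2).
    by rewrite mulr_ge0 ?(ltW E0) // addr_ge0 ?sqr_ge0 // mulr_ge0 // -lerBlDr sub0r.
  rewrite (exprS _ 2); move: (dot _ _) (dot _ _) (vn _) (vn _) (f z); nran.
have ht : tau z <= E * (2 * kap * f z - Q * f z ^+ 2) - e.
  have r1 : 0 < Num.min z.2 (f z / (kap + 1)).
    by rewrite lt_min tpos divr_gt0 // ltr_wpDl.
  apply: (@touch_time _ _ _ _ _ _ _ _ _ (E * (2 * Q * kap * f z)) _ sm Dz r1).
  move=> s s0; rewrite le_min => /andP[st sf].
  have sf' : s * kap < f z.
    have : s * (kap + 1) <= f z by rewrite -ler_pdivlMr // ltr_wpDl.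
    by move: s0; move: (f _) => y; lran.
  have Ds : D (z.1, z.2 - s).
    apply: fine; first by move: sf'; rewrite /f; lran.
      by rewrite subr_ge0.
    by rewrite (le_trans _ zt1) // gerBl ltW.
  split; first exact: sD.
  have st' : (z.1, z.2 - s).2 < z.2 by rewrite /= ltrBlDr ltrDl.
  have h1 : 0 < w (z.1, z.2 - s) - ph (z.1, z.2 - s) + e * (1 + (z.2 - s)) := hz _ Ds st'.
  have fs : f (z.1, z.2 - s) = f z - kap * s by rewrite /f /=; ring.
  have h2 : E * (f z - kap * s) ^+ 2 * (1 + Q * s) <= ph (z.1, z.2 - s).
    rewrite /ph fs /= (_ : - (Q * (z.2 - s)) = - (Q * z.2) + Q * s); last by ring.
    rewrite expRD [leRHS](_ : _ = E * (f z - kap * s) ^+ 2 * expR (Q * s)); last first.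
      by rewrite /E; ring.
    apply: ler_wpM2l (expR_ge1Dx _).
    by apply: mulr_ge0; [exact: (ltW E0)|exact: sqr_ge0].
  have h3 : 0 <= E * (kap ^+ 2 * s ^+ 2 * (1 + Q * s)).
    apply: mulr_ge0; first exact: (ltW E0).
    apply: mulr_ge0; first by apply: mulr_ge0; exact: sqr_ge0.
    by rewrite addr_ge0 // mulr_ge0 // ltW.
  rewrite ez phz; move: h1 h2 h3; move: (ph _) (w _) (f z); nran.
(* The rank one part of the barrier's Hessian and the excess of [H z] form the positive part, the
   multiple of the identity the negative part. The Pucci inequality for them contradicts the bound
   [ht] with its strict term [e]. *)
pose P := (H z - E *: (8 *: (z.1^T *m z.1) - (4 * f z) *: 1%:M)) + (E * 8) *: (z.1^T *m z.1).
pose N : 'M[R]_n := (E * (4 * f z)) *: 1%:M.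
have hP' : psd P.
  by apply: psdD => //; apply: psdZ; [rewrite mulr_ge0 // ltW|exact: psd_outer].
have hN : psd N.
  by apply: psdZ; [apply: mulr_ge0 (ltW E0) _; apply: mulr_ge0|exact: psd1].
have := hS z Dz P N hP' hN.
have -> : P - N = H z.
  rewrite /P /N; move: (z.1^T *m z.1) => O; apply/matrixP => i j; rewrite !mxE; ring.
move=> /(_ erefl); rewrite mxtraceD !mxtraceZ mxtrace1 trace_outer.
set tP := \tr _; have tP0 : 0 <= tP by apply: psd_tr.
have ds : dot z.1 z.1 = eta ^+ 2 + kap * z.2 - f z by rewrite /f; ring.
rewrite ds => h1.
have kz : 0 <= kap * z.2 by rewrite mulr_ge0.
set c1 := 8 * lam + 4 * Lam * n%:R + 2 * kap in Ql.
have key : 0 <= 8 * lam * eta ^+ 2 - c1 * f z + Q * f z ^+ 2.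
  have a0 : 0 < 16 * lam * eta ^+ 2 by rewrite !mulr_gt0 // exprn_gt0.
  rewrite -(pmulr_rge0 _ (mulr_gt0 (ltr0Sn R 1) a0)).
  have := sqr_ge0 (16 * lam * eta ^+ 2 - c1 * f z).
  have : c1 ^+ 2 * f z ^+ 2 <= 32 * lam * eta ^+ 2 * Q * f z ^+ 2.
    by rewrite ler_wpM2r // sqr_ge0.
  by rewrite !expr2; nran.
have : 0 <= E * (8 * lam * eta ^+ 2 - c1 * f z + Q * f z ^+ 2) by rewrite mulr_ge0 // ltW.
have := mulr_ge0 (ltW lam0) tP0.
have : 0 <= E * (8 * lam * (kap * z.2)).
  by apply: mulr_ge0 (ltW E0) _; apply: mulr_ge0 kz; apply: mulr_ge0 (ltW lam0).
by move: h1 ht e0; rewrite /c1; move: (tau z) (f z); nran.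
Qed.

End Barrier.

(** * A Calderon-Zygmund covering by dyadic cubes *)

Section DyadicCovering.
Context {R : realType} (C : finType) (D : eqType) (anc : nat -> C -> D).
Hypothesis anc_inj : injective (anc 0).
Hypothesis ancS : forall i c c', anc i c = anc i c' -> anc i.+1 c = anc i.+1 c'.
Variables (bad : pred C) (thr : R).
Hypothesis thr1 : thr < 1.

Definition crowded (i : nat) (c : C) : bool :=
  thr * (\sum_(x | anc i x == anc i c) 1) < \sum_(x | anc i x == anc i c) (bad x)%:R.

(** The cells lying in an uncrowded parent of a crowded cube, as in the Calderon-Zygmund
    decomposition. *)
Definition selected (m : nat) (x : C) : bool :=
  `[< exists i c, [/\ (i < m)%N, anc i.+1 c = anc i.+1 x, ~~ crowded i.+1 c & crowded i c] >].

Lemma eq_crowded i c c' : anc i c = anc i c' -> crowded i c = crowded i c'.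
Proof. by rewrite /crowded => ->. Qed.

(** [P] is a union of cubes of level [i], and both sums split over one representative per cube. *)
Lemma uncrowded_sum (i : nat) (P : pred C) :
  (forall x y, P x -> anc i x = anc i y -> P y) ->
  (forall x, P x -> ~~ crowded i x) ->
  \sum_(x | P x) (bad x)%:R <= thr * \sum_(x | P x) 1.
Proof.
move=> sat nd.
pose rep x := odflt x [pick y | anc i y == anc i x].
have repP x : anc i (rep x) = anc i x.
  by rewrite /rep; case: pickP => [y /eqP|].
have repE x y : anc i x = anc i y -> rep x = rep y.
  move=> e; rewrite /rep e; case: pickP => [//|/(_ y)].
  by rewrite eqxx.
pose Q j := P j && (rep j == j).
have hQ x : P x -> Q (rep x).
  move=> Px; rewrite /Q (sat _ _ Px) ?repP //=; apply/eqP/repE; exact: repP.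
rewrite (partition_big rep Q) // [X in _ <= _ * X](partition_big rep Q) //.
rewrite mulr_sumr; apply: ler_sum => j /andP[Pj /eqP rj].
have eP x : P x && (rep x == j) = (anc i x == anc i j).
  apply/andP/eqP => [[_ /eqP <-]|e]; first by rewrite repP.
  by split; [exact: sat Pj _|rewrite (repE _ _ e) rj].
rewrite !(eq_bigl _ _ eP); have := nd j Pj; rewrite /crowded -leNgt; exact.
Qed.

(** Descends through the levels. A cube of level [i.+1] with a crowded child is selected as a whole,
    and being uncrowded it has at most the fraction [thr] of bad cells; in the other cubes all
    children are uncrowded and the induction continues. At level 0 an uncrowded cell is not bad
    because [thr < 1]. *)
Lemma covering_sum (m : nat) (P : pred C) :
  (forall x y, P x -> anc m x = anc m y -> P y) ->
  (forall x, P x -> ~~ crowded m x) ->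
  \sum_(x | P x) (bad x)%:R <= thr * \sum_(x | P x) (selected m x)%:R.
Proof.
elim: m P => [|i IH] P sat nd.
  rewrite !big1 ?mulr0 // => [x Px|x Px].
    suff -> : selected 0 x = false by [].
    by apply/negP => /asboolP [? [? []]].
  case: (boolP (bad x)) => // bx; have /negP := nd x Px; case.
  have e y : (anc 0 y == anc 0 x) = (y == x).
    by apply/eqP/eqP => [/anc_inj|->].
  by rewrite /crowded !(eq_bigl _ _ e) !big_pred1_eq bx mulr1.
pose P1 := [pred x | P x & `[< exists c, anc i.+1 c = anc i.+1 x /\ crowded i c >]].
pose P2 := [pred x | P x & ~~ `[< exists c, anc i.+1 c = anc i.+1 x /\ crowded i c >]].
have split F : \sum_(x | P x) F x = \sum_(x | P1 x) F x + \sum_(x | P2 x) F x :> R.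
  by rewrite (bigID (fun x => `[< exists c, anc i.+1 c = anc i.+1 x /\ crowded i c >])).
rewrite !split mulrDr; apply: lerD.
  have s1 x : P1 x -> (selected i.+1 x)%:R = 1 :> R.
    move=> /andP[Px /asboolP[c [ec dc]]]; suff -> : selected i.+1 x by [].
    apply/asboolP; exists i, c; split => //.
    by rewrite (eq_crowded ec) nd.
  rewrite (eq_bigr _ s1); apply: (@uncrowded_sum i.+1) => [x y|x /andP[Px _]]; last exact: nd.
  move=> /andP[Px /asboolP[c [ec dc]]] e; rewrite /= (sat x) //.
  by apply/asboolP; exists c; rewrite -e.
apply: le_trans (_ : _ <= thr * \sum_(x | P2 x) (selected i x)%:R) _.
  apply: IH => [x y /andP[Px nx] e|x /andP[Px nx]].
    have e1 := ancS e; rewrite /= (sat x) //=; move: nx; apply: contra => /asboolP[c [ec dc]].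
    by apply/asboolP; exists c; rewrite e1.
  by move: nx; apply: contra => dx; apply/asboolP; exists x.
have t0 : \sum_(x | P2 x) (selected i x)%:R = \sum_(x | P2 x) (selected i.+1 x)%:R :> R.
  apply: eq_bigr => x /andP[Px nx]; congr (_ %:R); congr nat_of_bool.
  apply/idP/idP => /asboolP[j [c [ji e1 e2 e3]]]; apply/asboolP; exists j, c; split => //.
    exact: ltnW.
  move: ji; rewrite ltnS leq_eqVlt => /orP[/eqP ej|//].
  by move: nx => /negP; case; apply/asboolP; exists c; rewrite -ej.
by rewrite t0.
Qed.

End DyadicCovering.

(* Discrete rising sun lemma. *)
Lemma rising_sun (m N : nat) (S B : pred nat) :
  (forall s, S s -> exists e, [/\ (s < e)%N, (e <= N)%N &
     (m * (e - s) <= m.+1 * \sum_(s <= b < e) B b)%N]) ->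
  forall k, (k <= N)%N ->
  (m * \sum_(k <= s < N) S s <= m.+1 * \sum_(k <= b < N) B b)%N.
Proof.
move=> h k; move: {2}(N - k)%N (leqnn (N - k)) => d.
elim: d k => [|d IH] k.
  rewrite leqn0 subn_eq0 => Nk kN.
  by rewrite !big_geq ?muln0.
move=> hd kN; move: (kN); rewrite leq_eqVlt => /orP[/eqP ->|ltk].
  by rewrite !big_geq ?muln0.
case: (boolP (S k)) => Sk; last first.
  rewrite big_ltn // (negbTE Sk) add0n; apply: leq_trans (IH k.+1 _ _) _ => //; first by lia.
  by rewrite [X in (_ <= _ * X)%N]big_ltn // leq_mul2l leq_addl orbT.
have [e [ke eN he]] := h k Sk.
have E (f : pred nat) : (\sum_(k <= s < N) f s =
    \sum_(k <= s < e) f s + \sum_(e <= s < N) f s)%N.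
  by rewrite (big_cat_nat (n := e)) // ltnW.
rewrite !E !mulnDr; apply: leq_add; last by apply: IH => //; lia.
apply: leq_trans he; rewrite leq_mul2l; apply/orP; right.
apply: leq_trans (_ : \sum_(k <= b < e) 1 <= _)%N; first by apply: leq_sum => b _; case: (S b).
by rewrite sum_nat_const_nat muln1.
Qed.

(** * Geometric decay of the number of bad cells *)

Section DensityIteration.
Context {R : realType} (n k k0 J m : nat) (thr : R).
Hypotheses (k0k : (k0 <= k)%N) (m0 : (0 < m)%N) (Jm : (J * m <= 4 ^ k0)%N).
Hypotheses (thr0 : 0 <= thr) (thr1 : thr < 1).

Local Notation cells := ({ffun 'I_n -> 'I_(2 ^ k)} * 'I_(2 * 4 ^ k))%type.

Definition ancestor (i : nat) (c : cells) : {ffun 'I_n -> nat} * nat :=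
  ([ffun x => c.1 x %/ 2 ^ i]%N, (c.2 %/ 4 ^ i)%N).

Lemma ancestor_inj : injective (ancestor 0).
Proof.
move=> [a b] [a' b'] [/ffunP ea eb]; congr (_, _); last first.
  by apply: val_inj; move: eb; rewrite expn0 !divn1.
by apply/ffunP => x; apply: val_inj; have := ea x; rewrite !ffunE /= expn0 !divn1.
Qed.

Lemma ancestorS i c c' : ancestor i c = ancestor i c' -> ancestor i.+1 c = ancestor i.+1 c'.
Proof.
move=> [/ffunP ea eb]; congr (_, _); last by rewrite !expnSr !divnMA eb.
by apply/ffunP => x; have := ea x; rewrite !ffunE !expnSr !divnMA => ->.
Qed.

(** Times are plain naturals because a stack may stick out of the mesh. *)
Variable bad : nat -> {ffun 'I_n -> 'I_(2 ^ k)} -> nat -> bool.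
Let badC j : pred cells := fun c => bad j c.1 c.2.
Let h := (k - k0)%N.
(** Height in time of the region counted at step [j]. It drops by [m * 4 ^ h] per step, so that the
    stack over a cube of the smaller region stays in the larger one; [J * m <= 4 ^ k0] keeps it at
    least [4 ^ k] to the end. *)
Let N j := ((2 * 4 ^ k0 - j * m) * 4 ^ h)%N.

Hypothesis roots : forall j (c : cells), (j < J)%N -> ~~ crowded ancestor (badC j.+1) thr h c.
Hypothesis stacks : forall j i (c : cells) (a' : {ffun 'I_n -> 'I_(2 ^ k)}) (b' : nat), (j < J)%N -> (i < h)%N ->
  crowded ancestor (badC j.+1) thr i c ->
  (forall x, a' x %/ 2 ^ i.+1 = c.1 x %/ 2 ^ i.+1)%N ->
  ((c.2 %/ 4 ^ i.+1).+1 * 4 ^ i.+1 <= b' < (c.2 %/ 4 ^ i.+1 + 1 + m) * 4 ^ i.+1)%N ->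
  bad j a' b'.

Let count j : R := \sum_(c : cells | (c.2 < N j)%N) (badC j c)%:R.

Lemma sum_columns (P : nat) (f : cells -> bool) (g : {ffun 'I_n -> 'I_(2 ^ k)} -> pred nat) :
  (forall a (b : 'I_(2 * 4 ^ k)), g a b = f (a, b) && (b < P)%N) ->
  (\sum_(c : cells | (c.2 < P)%N) f c = \sum_a \sum_(0 <= b < 2 * 4 ^ k) g a b)%N.
Proof.
move=> e; rewrite big_mkcond /= (eq_bigr (fun c : cells => g c.1 c.2 : nat)).
  rewrite -(pair_bigA _ (fun a (b : 'I_(2 * 4 ^ k)) => g a b : nat)) /=.
  by apply: eq_bigr => a _; rewrite big_mkord.
by move=> [a b] _ /=; rewrite e; case: (b < P)%N; rewrite ?andbT ?andbF.
Qed.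

(** A selected cell lies in a parent followed in time by [m] copies of it that consist of cells bad
    at the previous step. In every column the rising sun lemma then bounds the selected cells by
    [m.+1 / m] times those bad cells, and [covering_sum] contributes the factor [thr]. *)
Lemma density_step j : (j < J)%N -> m%:R * count j.+1 <= thr * m.+1%:R * count j.
Proof.
move=> jJ.
have four i : (0 < 4 ^ i)%N by rewrite expn_gt0.
have cov : count j.+1 <= thr * \sum_(c : cells | (c.2 < N j.+1)%N)
    (selected ancestor (badC j.+1) thr h c)%:R.
  apply: (covering_sum ancestor_inj ancestorS thr1) => [x y Px [_ e]|x _]; last exact: roots.
  by move: Px; rewrite /N -!ltn_divLR // e.
rewrite mulrC (le_trans (ler_wpM2r (ler0n _ m) cov)) // -!mulrA ler_wpM2l //.
rewrite /count -!natr_sum -!natrM ler_nat.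
pose S a b := `[< exists b' : 'I_(2 * 4 ^ k), [/\ b' = b :> nat, (b < N j.+1)%N &
  selected ancestor (badC j.+1) thr h (a, b')] >].
pose B a b := bad j a b && (b < N j)%N.
rewrite (sum_columns (g := S)); last first.
  move=> a b; apply/asboolP/andP => [[b' [/val_inj -> //]]|[s1 s2]].
  by exists b.
rewrite (sum_columns (g := B)) // mulnC !big_distrr /=.
apply: leq_sum => a _; apply: rising_sun => // s /asboolP[b [eb bN]].
move=> /asboolP[i [c [ih [/ffunP ea ec] _ dc]]].
have e1 x : (a x %/ 2 ^ i.+1 = c.1 x %/ 2 ^ i.+1)%N.
  by have := ea x; rewrite !ffunE.
pose q := (s %/ 4 ^ i.+1)%N.
have qc : (c.2 %/ 4 ^ i.+1 = q)%N by rewrite ec /= eb.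
have hdiv : (4 ^ h = 4 ^ (h - i.+1) * 4 ^ i.+1)%N by rewrite -expnD subnK.
have jJm : (j.+1 * m <= J * m)%N by rewrite leq_mul2r jJ orbT.
have qN : (q.+1 * 4 ^ i.+1 <= N j.+1)%N.
  move: bN; rewrite /N hdiv mulnA leq_mul2r => bN; apply/orP; right.
  by rewrite /q ltn_divLR.
have eN : ((q + 1 + m) * 4 ^ i.+1 <= N j)%N.
  have -> : (N j = N j.+1 + m * 4 ^ h)%N.
    rewrite /N -mulnDl; congr (_ * _)%N; move: jJm Jm; rewrite mulSn.
    by move: (4 ^ k0)%N (j * m)%N (J * m)%N; clear; lia.
  rewrite mulnDl addn1 leq_add // leq_mul2l; apply/orP; right.
  by rewrite leq_exp2l.
have NT : (N j <= 2 * 4 ^ k)%N.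
  rewrite /N (_ : (4 ^ k = 4 ^ k0 * 4 ^ h)%N); last by rewrite -expnD /h subnKC.
  by rewrite mulnA leq_mul2r leq_subr orbT.
have sq : (q * 4 ^ i.+1 <= s < q.+1 * 4 ^ i.+1)%N.
  by rewrite /q leq_trunc_div ltn_ceil.
have [sq1 sq2] := andP sq.
(* The end of the stack: the interval from [s] up to it has at most [m.+1] parent heights, and the
   last [m] of them are bad. *)
exists ((q + 1 + m) * 4 ^ i.+1)%N; split.
- by apply: leq_trans sq2 _; rewrite leq_mul2r addn1 leq_addr orbT.
- exact: leq_trans eN NT.
apply: leq_trans (_ : m * (m.+1 * 4 ^ i.+1) <= _)%N.
  by rewrite leq_mul2l leq_subLR -addnA mulnDl add1n leq_add2r sq1 orbT.
rewrite mulnCA leq_mul2l; apply/orP; right.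
rewrite (big_cat_nat (n := (q.+1 * 4 ^ i.+1)%N)) /=; last 2 first.
- exact: ltnW.
- by rewrite leq_mul2r addn1 leq_addr orbT.
apply: leq_trans (leq_addl _ _).
rewrite (eq_big_nat _ _ (F2 := fun=> 1%N)).
  by rewrite sum_nat_const_nat muln1 addn1 mulnDl addKn.
move=> b' /andP[b1 b2]; rewrite /B (leq_trans b2 eN) andbT.
by rewrite (stacks jJ ih dc) // qc b1 b2.
Qed.

Lemma density_iter :
  \sum_(c : cells | (c.2 < 4 ^ k)%N) (badC J c)%:R
    <= (thr * m.+1%:R / m%:R) ^+ J * (2 * ((2 ^ k) ^ n * 4 ^ k)%:R).
Proof.
have mR : 0 < m%:R :> R by rewrite ltr0n.
have N0 : (N 0 = 2 * 4 ^ k)%N.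
  by rewrite /N mul0n subn0 -mulnA -expnD /h subnKC.
have NJ : (4 ^ k <= N J)%N.
  rewrite /N (_ : (4 ^ k = 4 ^ k0 * 4 ^ h)%N); last by rewrite -expnD /h subnKC.
  by rewrite leq_mul2r; apply/orP; right; lia.
apply: (@le_trans _ _ (count J)).
  rewrite /count big_mkcond [leRHS]big_mkcond; apply: ler_sum => c _.
  case: ifP => [h1|_]; last by case: ifP.
  by rewrite (leq_trans h1 NJ).
have it j : (j <= J)%N -> count j <= (thr * m.+1%:R / m%:R) ^+ j * count 0.
  elim: j => [|j IH] jJ; first by rewrite expr0 mul1r.
  have h1 := density_step jJ.
  rewrite exprS -mulrA (le_trans (_ : _ <= thr * m.+1%:R / m%:R * count j)) //.
    by rewrite mulrAC ler_pdivlMr // mulrC.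
  by rewrite ler_wpM2l ?IH 1?ltnW // divr_ge0 // mulr_ge0.
apply: le_trans (it J (leqnn J)) _; apply: ler_wpM2l.
  by rewrite exprn_ge0 // divr_ge0 // mulr_ge0.
apply: (@le_trans _ _ (\sum_(c : cells) 1)).
  rewrite /count big_mkcond; apply: ler_sum => c _; case: ifP => // _.
  by case: (badC _ _).
rewrite sumr_const card_prod card_ffun !card_ord.
by rewrite -natrM mulnCA.
Qed.

End DensityIteration.

(** * Propagation of smallness backwards in time *)

Section CubeStep.
Context {R : realType} {n : nat}.
Notation pt := ('rV[R]_n * R)%type.
Implicit Types (D : set pt) (w tau : pt -> R) (g : pt -> 'rV[R]_n)
  (H : pt -> 'M[R]_n) (z : pt).
Variables (lam Lam : R).
Hypotheses (lam0 : 0 < lam) (Lam0 : 0 <= Lam).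

Definition barrier_reach (X2 c0 Dt eta r M : R) : Prop :=
  forall (T L : R) w g H tau (xp : 'rV[R]_n),
    c0 <= T -> T <= Dt -> 0 < L -> smooth (boxT r 0 T) w g H tau ->
    (forall z, boxT r 0 T z -> 0 <= w z) ->
    (forall z, boxT r 0 T z -> pucci_super lam Lam (H z) (tau z)) ->
    dot xp xp <= X2 -> w (xp, T) <= L ->
    exists2 x, dot x x <= eta ^+ 2 & w (x, 0) <= M * L.

(** Contrapositive of [barrier_le]: if [w] were above [M * L] on the initial ball, the barrier would
    force [w > L] at [(xp, T)]. The speed [2 * X2 / T] makes [f >= eta ^+ 2] there. As [T >= c0],
    the speed is bounded, and so [Q] and [M] can be fixed in advance. *)
Lemma barrier_back (X2 c0 Dt eta r : R) :
  0 <= X2 -> 0 < c0 -> 0 < eta -> 0 < r -> eta ^+ 2 + 2 * X2 < r ^+ 2 ->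
  exists2 M : R, 1 <= M & barrier_reach X2 c0 Dt eta r M.
Proof.
move=> X0 c00 eta0 r0 hr.
pose km := 2 * X2 / c0; have km0 : 0 <= km by rewrite divr_ge0 ?mulr_ge0 // ltW.
pose c1 k := 8 * lam + 4 * Lam * n%:R + 2 * k.
pose Q := c1 km ^+ 2 / (32 * lam * eta ^+ 2).
have den : 0 < 32 * lam * eta ^+ 2 by rewrite !mulr_gt0 // exprn_gt0.
have Q0 : 0 <= Q by rewrite divr_ge0 ?sqr_ge0 // ltW.
exists (2 * expR (Q * Num.max Dt 0)).
  have : 1 <= expR (Q * Num.max Dt 0) by rewrite -expR0 ler_expR mulr_ge0 // le_max lexx orbT.
  lra.
move=> T L w g H tau xp cT TD L0 sm w0 hS hx wL.
have T0 : 0 < T by lra.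
apply: contrapT => hn.
pose M := 2 * expR (Q * Num.max Dt 0).
have c0' : 0 < M * L by rewrite !mulr_gt0 // expR_gt0.
pose kap := 2 * X2 / T.
have kap0 : 0 <= kap by rewrite divr_ge0 ?mulr_ge0 // ltW.
have kk : kap <= km.
  by rewrite /kap /km ler_wpM2l ?mulr_ge0 // lef_pV2 ?posrE.
have kT : kap * T = 2 * X2 by rewrite divfK // gt_eqF.
have l0 := ltW lam0; have nn : 0 <= n%:R :> R by [].
have ln := mulr_ge0 Lam0 nn.
have Ql : (8 * lam + 4 * Lam * n%:R + 2 * kap) ^+ 2 <= 32 * lam * eta ^+ 2 * Q.
  rewrite [leRHS]mulrC /Q divfK ?gt_eqF // ler_pXn2r // ?nnegrE /c1;
    move: l0 ln km0 kap0 kk; clear -lam0 Lam0; lra.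
have hr' : eta ^+ 2 + kap * T < r ^+ 2 by rewrite kT.
have wc x : dot x x <= eta ^+ 2 -> M * L <= w (x, 0).
  by move=> hx2; rewrite leNgt; apply/negP => hw; apply: hn; exists x => //; exact: ltW.
have Dp : boxT r 0 T (xp, T).
  split=> [i|] /=; last by rewrite lexx (ltW T0).
  rewrite -(ler_pXn2r (n := 2)) ?nnegrE ?(ltW r0) // real_normK ?num_real //.
  by have := sqr_coord_le xp i; have := sqr_ge0 eta; lra.
pose A := M * L / eta ^+ 4 * (eta ^+ 2 + 2 * X2 - dot xp xp) ^+ 2.
have h4 : A * expR (- (Q * T)) <= w (xp, T).
  have := barrier_le lam0 eta0 kap0 T0 Q0 r0 Ql hr' c0' sm w0 hS wc Dp.
  by rewrite /= kT; apply; have := sqr_ge0 eta; lra.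
have f1 : eta ^+ 4 <= (eta ^+ 2 + 2 * X2 - dot xp xp) ^+ 2.
  by rewrite (exprM eta 2 2) ler_pXn2r ?nnegrE ?sqr_ge0 //;
    move: hx X0 (sqr_ge0 eta); clear -lam0 Lam0; lra.
have h3 : M * L <= A.
  by rewrite /A [leRHS]mulrAC ler_pdivlMr ?exprn_gt0 // ler_wpM2l // ltW.
have ex : expR (- (Q * Num.max Dt 0)) <= expR (- (Q * T)).
  by rewrite ler_expR lerN2 ler_wpM2l // le_max TD.
have h1 : M * L * expR (- (Q * Num.max Dt 0)) = 2 * L.
  by rewrite /M mulrAC -(mulrA 2) expRN mulfV ?mulr1 // gt_eqF // expR_gt0.
have := ler_pM (ltW c0') (expR_ge0 _) h3 ex; rewrite h1; lra.
Qed.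

Definition incell (k : nat) (a : 'I_n -> nat) (b : nat) z : Prop :=
  (forall i, (a i)%:R <= 2 ^+ k * z.1 0 i < (a i)%:R + 1) /\
  b%:R <= 4 ^+ k * z.2 < b%:R + 1.

Definition bad_cell w (L : R) (k : nat) (a : 'I_n -> nat) (b : nat) : bool :=
  ~~ `[< exists2 z, incell k a b z & w z <= L >].

Lemma smoothC_weaken (K d K' d' : R) D w g H tau : K <= K' -> 0 < d' -> d' <= d ->
  smoothC K d D w g H tau -> smoothC K' d' D w g H tau.
Proof.
move=> KK d0 dd [K0 _ h]; split; [exact: le_trans KK|by []|].
move=> z1 z2 D1 D2 hx ht dx dt.
have [s a b c] := h z1 z2 D1 D2 (le_trans hx dd) (le_trans ht dd).
split => //.
- apply: le_trans a _; apply: ler_wpM2r => //.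
  by rewrite !addr_ge0 ?sqr_ge0 ?exprn_ge0 ?mulr_ge0 ?vn_ge0.
- by apply: le_trans b _; apply: ler_wpM2r; rewrite // addr_ge0 ?exprn_ge0 ?vn_ge0.
- by apply: le_trans c _; apply: ler_wpM2r; rewrite // addr_ge0 ?vn_ge0.
Qed.

End CubeStep.

(** * Dyadic cells and cubes in space-time *)

Section CubeCells.
Context {R : realType} {n : nat}.
Notation pt := ('rV[R]_n * R)%type.
Implicit Types (w tau : pt -> R) (g : pt -> 'rV[R]_n) (H : pt -> 'M[R]_n) (z : pt).
Local Notation cells k := ({ffun 'I_n -> 'I_(2 ^ k)} * 'I_(2 * 4 ^ k))%type.

Lemma expn2_gt0 k : (0 < 2 ^ k)%N.
Proof. by rewrite expn_gt0. Qed.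

Lemma expn4_gt0 k : (0 < 2 * 4 ^ k)%N.
Proof. by rewrite muln_gt0 expn_gt0. Qed.

(** Coordinates outside the mesh get index 0 from [insubd]; [cellofP] speaks only of points of the
    mesh. *)
Definition cellof (k : nat) z : cells k :=
  ([ffun x => insubd (Ordinal (expn2_gt0 k)) (Num.truncn (2 ^+ k * z.1 0 x))],
   insubd (Ordinal (expn4_gt0 k)) (Num.truncn (4 ^+ k * z.2))).

Lemma cellofP k z : (forall i, 0 <= z.1 0 i < 1) -> 0 <= z.2 < 2 ->
  incell k (fun x => (cellof k z).1 x) (cellof k z).2 z.
Proof.
have p2 : 0 < 2 ^+ k :> R by rewrite exprn_gt0.
have p4 : 0 < 4 ^+ k :> R by rewrite exprn_gt0.
move=> hx /andP[t0 t1]; split=> [x|] /=.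
  have /andP[x0 x1] := hx x; rewrite ffunE val_insubd.
  have xx : 0 <= 2 ^+ k * z.1 0 x by rewrite mulr_ge0 // ltW.
  have /andP[h1 h2] := truncn_itv xx.
  rewrite ifT ?h1 ?natr1 ?h2 //.
  rewrite -(ltr_nat R) natrX (le_lt_trans h1) // -[ltRHS]mulr1.
  by rewrite ltr_pM2l.
have tt : 0 <= 4 ^+ k * z.2 by rewrite mulr_ge0 // ltW.
have /andP[h1 h2] := truncn_itv tt; rewrite val_insubd.
rewrite ifT ?h1 ?natr1 ?h2 //.
by rewrite -(ltr_nat R) natrM natrX (le_lt_trans h1) // mulrC ltr_pM2r.
Qed.

Lemma incell_close k a b z z' : incell k a b z -> incell k a b z' ->
  (forall i, `|z'.1 0 i - z.1 0 i| <= 2 ^- k) /\ `|z'.2 - z.2| <= 4 ^- k.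
Proof.
have p2 : 0 < 2 ^+ k :> R by rewrite exprn_gt0.
have p4 : 0 < 4 ^+ k :> R by rewrite exprn_gt0.
have key (p x y c : R) : 0 < p -> c <= p * x < c + 1 -> c <= p * y < c + 1 ->
    `|y - x| <= p^-1.
  move=> p0 /andP[a1 a2] /andP[b1 b2].
  rewrite -[_^-1]mul1r ler_pdivlMr //.
  have -> : `|y - x| * p = `|p * y - p * x| by rewrite -mulrBr normrM (gtr0_norm p0) mulrC.
  by rewrite ler_norml; apply/andP; split; lra.
move=> [h1 h2] [h1' h2']; split=> [i|]; first exact: (key _ _ _ _ p2 (h1 i) (h1' i)).
exact: (key _ _ _ _ p4 h2 h2').
Qed.

Lemma div_of_range (q : nat) (A a : nat) (y : R) : (0 < q)%N ->
  (A * q)%:R <= y < (A.+1 * q)%:R -> a%:R <= y < a%:R + 1 -> (a %/ q = A)%N.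
Proof.
move=> q0 /andP[h1 h2] /andP[h3 h4]; apply/eqP; rewrite eqn_leq.
rewrite -ltnS ltn_divLR // leq_divRL // -!(ltr_nat R) -ltnS -(ltr_nat R).
by rewrite (le_lt_trans h3 h2) -natr1 (le_lt_trans h1 h4).
Qed.

Lemma cube_card k i (c : cells k) :
  (#|[pred x : cells k | ancestor i x == ancestor i c]| <= (2 ^ i) ^ n * 4 ^ i)%N.
Proof.
have q2 : (0 < 2 ^ i)%N by rewrite expn_gt0.
have q4 : (0 < 4 ^ i)%N by rewrite expn_gt0.
pose f (x : cells k) : {ffun 'I_n -> 'I_(2 ^ i)} * 'I_(4 ^ i) :=
  ([ffun j => Ordinal (ltn_pmod (x.1 j) q2)], Ordinal (ltn_pmod x.2 q4)).
have inj : {in [pred x : cells k | ancestor i x == ancestor i c] &, injective f}.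
  move=> [a b] [a' b']; rewrite !inE => /eqP <- /eqP [/ffunP ea eb] [/ffunP fa fb].
  congr (_, _); last by apply: val_inj; rewrite /= (divn_eq b (4 ^ i)) -eb fb -divn_eq.
  apply/ffunP => j; apply: val_inj => /=.
  have := ea j; have := fa j; rewrite !ffunE => -[e1] e2.
  by rewrite (divn_eq (a j) (2 ^ i)) -e2 e1 -divn_eq.
rewrite -(card_in_image inj) (leq_trans (max_card _)) //.
by rewrite card_prod card_ffun !card_ord.
Qed.

Definition scale (k i : nat) : R := 2 ^+ i / 2 ^+ k.

Definition cube_center k i (c : cells k) : 'rV[R]_n :=
  \row_x (((c.1 x %/ 2 ^ i)%:R + 2^-1) * scale k i).

(** The reference time lies a quarter of the way up, so that the contact box, which extends to
    earlier times, fits into the cube below it. *)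
Definition cube_time k i (c : cells k) : R := ((c.2 %/ 4 ^ i)%:R + 4^-1) * scale k i ^+ 2.

Lemma scale_gt0 k i : 0 < scale k i.
Proof. by rewrite divr_gt0 // exprn_gt0. Qed.

Lemma scale_le1 k i : (i <= k)%N -> scale k i <= 1.
Proof. by move=> ik; rewrite ler_pdivrMr ?exprn_gt0 // mul1r ler_weXn2l // ler1n. Qed.

Lemma scale_sqr k i : scale k i ^+ 2 = 4 ^+ i / 4 ^+ k.
Proof. by rewrite /scale expr_div_n -!exprM !(mulnC _ 2%N) !exprM -!natrX. Qed.

Lemma cube_center_range k i (c : cells k) x : (i <= k)%N ->
  scale k i / 2 <= cube_center i c 0 x <= 1 - scale k i / 2.
Proof.
move=> ik; rewrite mxE; have s0 := scale_gt0 k i.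
have : ((c.1 x %/ 2 ^ i).+1 * 2 ^ i <= 2 ^ k)%N.
  rewrite [leqRHS](_ : _ = 2 ^ (k - i) * 2 ^ i)%N; last by rewrite -expnD subnK.
  by rewrite leq_mul2r ltn_divLR ?expn_gt0 // -expnD subnK // ltn_ord orbT.
rewrite -(ler_nat R) natrM !natrX -natr1.
have -> : (2 ^+ i : R) = scale k i * 2 ^+ k by rewrite divfK // gt_eqF // exprn_gt0.
rewrite mulrA ger_pMl ?exprn_gt0 // => h; apply/andP; split; last by lra.
by have := mulr_ge0 (ler0n R (c.1 x %/ 2 ^ i)) (ltW s0); lra.
Qed.

Lemma cube_time_range k i (c : cells k) : (i <= k)%N ->
  scale k i ^+ 2 / 4 <= cube_time i c <= 2 - 3 / 4 * scale k i ^+ 2.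
Proof.
move=> ik; have s0 := exprn_gt0 2 (scale_gt0 k i); rewrite /cube_time.
have : ((c.2 %/ 4 ^ i).+1 * 4 ^ i <= 2 * 4 ^ k)%N.
  rewrite [leqRHS](_ : _ = 2 * 4 ^ (k - i) * 4 ^ i)%N; last by rewrite -mulnA -expnD subnK.
  by rewrite leq_mul2r ltn_divLR ?expn_gt0 // -mulnA -expnD subnK // ltn_ord orbT.
rewrite -(ler_nat R) !natrM !natrX -natr1.
have -> : (4 ^+ i : R) = scale k i ^+ 2 * 4 ^+ k.
  by rewrite scale_sqr divfK // gt_eqF // exprn_gt0.
rewrite mulrA ler_pM2r ?exprn_gt0 // => h; apply/andP; split; last by lra.
by have := mulr_ge0 (ler0n R (c.2 %/ 4 ^ i)) (ltW s0); lra.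
Qed.

End CubeCells.

(** * Cubes preceding a point of smallness are not crowded *)

Section CubeStepMain.
Context {R : realType} {n : nat}.
Notation pt := ('rV[R]_n * R)%type.
Implicit Types (w tau : pt -> R) (g : pt -> 'rV[R]_n) (H : pt -> 'M[R]_n) (z : pt).
Local Notation cells k := ({ffun 'I_n -> 'I_(2 ^ k)} * 'I_(2 * 4 ^ k))%type.

Lemma not_crowded_of_good w (L mu : R) k i (c : cells k) (G : pred (cells k)) :
  (forall c', G c' -> ancestor i c' = ancestor i c /\ ~~ bad_cell w L k (fun x => c'.1 x) c'.2) ->
  0 <= mu -> mu * ((2 ^ i) ^ n * 4 ^ i)%:R <= #|G|%:R ->
  ~~ crowded (@ancestor n k)
       (fun c : cells k => bad_cell w L k (fun x => c.1 x) c.2) (1 - mu) i c.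
Proof.
move=> hG mu0 hc; rewrite /crowded -leNgt.
set P := fun x : cells k => ancestor i x == ancestor i c.
set b := fun c : cells k => bad_cell w L k (fun x => c.1 x) c.2.
have e1 : \sum_(x | P x) 1 = \sum_(x | P x) (b x)%:R + \sum_(x | P x) (~~ b x)%:R :> R.
  by rewrite -big_split; apply: eq_bigr => x _ /=; case: (b x); rewrite ?addr0 ?add0r.
have e2 : \sum_(x | P x) 1 <= ((2 ^ i) ^ n * 4 ^ i)%:R :> R.
  rewrite (_ : \sum_(x | P x) 1 = #|[pred x : cells k | P x]|%:R).
    by rewrite ler_nat cube_card.
  by rewrite -sum1_card natr_sum.
have e3 : #|G|%:R <= \sum_(x | P x) (~~ b x)%:R :> R.
  rewrite -sum1_card natr_sum big_mkcond [leRHS]big_mkcond; apply: ler_sum => x _.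
  case: ifP => [/hG [ea nb]|_]; last by case: ifP.
  by rewrite /P ea eqxx nb.
have e4 := ler_wpM2l mu0 e2.
change (\sum_(x | P x) (b x)%:R <= (1 - mu) * \sum_(x | P x) 1).
move: e1 e3 e4; move: (\sum_(x | P x) 1) (\sum_(x | P x) (b x)%:R) (\sum_(x | P x) (~~ b x)%:R).
by move=> S1 S2 S3; lra.
Qed.

Lemma scale2E k i : 2 ^+ i = scale k i * 2 ^+ k :> R.
Proof. by rewrite divfK // gt_eqF // exprn_gt0. Qed.

Lemma scale4E k i : 4 ^+ i = scale k i ^+ 2 * 4 ^+ k :> R.
Proof. by rewrite scale_sqr divfK // gt_eqF // exprn_gt0. Qed.

Lemma cube_cell k i (c : cells k) z : (i <= k)%N ->
  (forall x, `|z.1 0 x - cube_center i c 0 x| < scale k i / 2) ->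
  cube_time i c - scale k i ^+ 2 / 4 <= z.2 < cube_time i c + 3 / 4 * scale k i ^+ 2 ->
  incell k (fun x => (cellof k z).1 x) (cellof k z).2 z /\
  ancestor i (cellof k z) = ancestor i c.
Proof.
move=> ik zx /andP[zt1 zt2]; have s0 : 0 < scale k i :> R := @scale_gt0 R k i.
have p2 : 0 < 2 ^+ k :> R by rewrite exprn_gt0.
have p4 : 0 < 4 ^+ k :> R by rewrite exprn_gt0.
have zx' x : cube_center i c 0 x - scale k i / 2 < z.1 0 x < cube_center i c 0 x + scale k i / 2.
  move: (zx x); rewrite ltr_norml; clear => /andP[? ?]; apply/andP; split; lra.
have inc : incell k (fun x => (cellof k z).1 x) (cellof k z).2 z.
  apply: cellofP => [x|].
    move: (zx' x) (@cube_center_range R n k _ c x ik) s0; clear.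
    by move=> /andP[? ?] /andP[? ?] ?; apply/andP; split; lra.
  move: (@cube_time_range R n k _ c ik) zt1 zt2 (exprn_gt0 2 s0); clear.
  by move=> /andP[? ?] *; apply/andP; split; lra.
split => //; move: (cellof k z) inc => cz [ix it]; congr (_, _).
  apply/ffunP => x; rewrite !ffunE; apply: (div_of_range _ _ (ix x)).
    by rewrite expn_gt0.
  have := zx' x; rewrite mxE !natrM !natrX -(natr1 (_ %/ _)) (scale2E k i).
  move: (_ %/ _)%N (z.1 0 x) (scale k i) (2 ^+ k) p2 => q y s p; clear => p0 /andP[z1 z2].
  by rewrite !mulrA (mulrC p) ler_pM2r // ltr_pM2r //; apply/andP; split; lra.
apply: (div_of_range _ _ it); first by rewrite expn_gt0.
move: zt1 zt2; rewrite /cube_time !natrM !natrX -(natr1 (_ %/ _)) (scale4E k i).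
move: (_ %/ _)%N (z.2) (scale k i ^+ 2) (4 ^+ k) p4 => q y s p; clear => p0 z1 z2.
by rewrite !mulrA (mulrC p) ler_pM2r // ltr_pM2r //; apply/andP; split; lra.
Qed.

Lemma cube_corner k i (c c' : cells k) : ancestor i c' = ancestor i c ->
  exists z, [/\ incell k (fun x => c'.1 x) c'.2 z,
    (forall x, cube_center i c 0 x - scale k i / 2 <= z.1 0 x
                 <= cube_center i c 0 x + scale k i / 2) &
    cube_time i c - scale k i ^+ 2 / 4 <= z.2 <= cube_time i c + 3 / 4 * scale k i ^+ 2].
Proof.
move=> [/ffunP ea eb].
have p2 : 0 < 2 ^+ k :> R by rewrite exprn_gt0.
have p4 : 0 < 4 ^+ k :> R by rewrite exprn_gt0.
exists (\row_x ((c'.1 x)%:R / 2 ^+ k), (c'.2 : nat)%:R / 4 ^+ k); split.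
- split=> [x|] /=; first by rewrite mxE mulrC divfK ?gt_eqF // lexx ltrDl ltr01.
  by rewrite mulrC divfK ?gt_eqF // lexx ltrDl ltr01.
- move=> x; have ex : (c'.1 x %/ 2 ^ i = c.1 x %/ 2 ^ i)%N by have := ea x; rewrite !ffunE.
  rewrite !mxE -ex.
  have q0 : (0 < 2 ^ i)%N by rewrite expn_gt0.
  have := ltn_ceil (c'.1 x) q0; have := leq_trunc_div (c'.1 x) (2 ^ i).
  rewrite -(ler_nat R) -(ltr_nat R) !natrM natrX -(natr1 (_ %/ _)) (scale2E k i).
  rewrite ler_pdivlMr // ler_pdivrMr //.
  move: ((c'.1 x %/ 2 ^ i)%:R : R) ((c'.1 x)%:R : R) (scale k i) (2 ^+ k : R) => q a s p.
  clear => h1 h2.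
  by apply/andP; split; lra.
rewrite /cube_time -eb /=.
have q0 : (0 < 4 ^ i)%N by rewrite expn_gt0.
have := ltn_ceil c'.2 q0; have := leq_trunc_div c'.2 (4 ^ i).
rewrite -(ler_nat R) -(ltr_nat R) !natrM natrX -(natr1 (_ %/ _)) (scale4E k i).
rewrite ler_pdivlMr // ler_pdivrMr //.
move: ((c'.2 %/ 4 ^ i)%:R : R) (c'.2%:R : R) (scale k i ^+ 2) (4 ^+ k : R) => q a s p.
clear => h1 h2.
by apply/andP; split; lra.
Qed.

(** Cubes too small to contain a fine mesh for the contact count are handled by the Lipschitz bound:
    between [p] and the corners of the cells [w] varies by at most [Lmin], so no cell is bad. *)
Lemma small_cube_not_crowded (rb X2 Dt B K d Lmin M L r mu : R) w g H tau
    k i (c : cells k) (p : pt) :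
  smoothC K d (boxT rb 0 4) w g H tau -> (i <= k)%N -> boxT rb 0 4 p ->
  0 <= X2 -> 0 < r -> 1 <= M -> 0 < Lmin -> Lmin <= L -> mu <= 1 ->
  n%:R * (X2 + 2) + (`|Dt| + 2) <= B ->
  B * scale k i <= d -> scale k i * (B * (K + 1)) <= Lmin ->
  w p <= L ->
  (forall x, `|p.1 0 x - cube_center i c 0 x| <= (X2 + 1) * scale k i) ->
  scale k i ^+ 2 / 4 <= p.2 - cube_time i c ->
  p.2 - cube_time i c <= Dt * scale k i ^+ 2 -> r * scale k i + 1 <= rb ->
  ~~ crowded (@ancestor n k)
       (fun c : cells k => bad_cell w (3 * M * L) k (fun x => c.1 x) c.2) (1 - mu) i c.
Proof.
move=> [K0 d0 hK] ik Dp X0 r0 M1 Lm0 LL mu1 hB sB sL wp pxc ht1 ht2 hrb.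
have nb (c' : cells k) : ancestor i c' = ancestor i c ->
    bad_cell w (3 * M * L) k (fun x => c'.1 x) c'.2 = false.
  move=> ec; have [z [zin zx /andP[zt1 zt2]]] := cube_corner ec.
  apply/negbTE; rewrite negbK; apply/asboolP; exists z => //.
  have xcr x := @cube_center_range R n k _ c x ik; have /andP[t1 t2] := @cube_time_range R n k _ c ik.
  have s0 := @scale_gt0 R k i; have s1 := @scale_le1 R _ _ ik.
  move: (cube_center i c) (cube_time i c) (scale k i) xcr t1 t2 s0 s1 zx zt1 zt2
    sB sL pxc ht1 ht2 hrb => xc tc s xcr t1 t2 s0 s1 zx zt1 zt2 sB sL pxc ht1 ht2 hrb.
  have ss : 0 < s ^+ 2 by rewrite exprn_gt0.
  have sle : s ^+ 2 <= s by rewrite expr2 ler_piMl // ltW.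
  have Dz : boxT rb 0 4 z.
    split=> [x|]; last by move: t1 t2 zt1 zt2 ss; clear => *; apply/andP; split; lra.
    move: s0 hrb (zx x) (xcr x) (mulr_gt0 r0 s0); rewrite ler_norml; clear.
    by move=> ? ? /andP[? ?] /andP[? ?] *; apply/andP; split; lra.
  have v1 : vn (z.1 - p.1) <= n%:R * ((X2 + 2) * s).
    apply: vn_le => x; rewrite !mxE; move: (zx x) (pxc x); rewrite !ler_norml; clear.
    by move=> /andP[? ?] /andP[? ?]; apply/andP; split; lra.
  have t3 : `|z.2 - p.2| <= (`|Dt| + 2) * s.
    have : Dt * s ^+ 2 <= `|Dt| * s.
      apply: le_trans (_ : _ <= `|Dt| * s ^+ 2) _.
        by rewrite ler_wpM2r ?ler_norm // ltW.
      by rewrite ler_wpM2l.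
    have : 0 <= `|Dt| * s by rewrite mulr_ge0 // ltW.
    rewrite ler_norml; move: t1 t2 zt1 zt2 ss ht1 ht2 sle s0; clear => *.
    by apply/andP; split; lra.
  have Bs : vn (z.1 - p.1) + `|z.2 - p.2| <= B * s.
    by have := ler_wpM2r (ltW s0) hB; move: v1 t3; clear; lra.
  have := vn_ge0 (z.1 - p.1); have := normr_ge0 (z.2 - p.2) => q1 q2.
  have [||_ _ _] := hK p z Dp Dz; [move: Bs sB q1 q2; clear; lra..|].
  rewrite ler_norml => /andP[_ h1].
  have h2 : K * (vn (z.1 - p.1) + `|z.2 - p.2|) <= K * (B * s) by rewrite ler_wpM2l.
  have : 0 <= B * s by move: Bs q1 q2; clear; lra.
  move: h1 h2 sL wp LL Lm0 M1; clear; nra.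
rewrite /crowded -leNgt big1 => [|x /eqP e]; last by rewrite nb.
by rewrite mulr_ge0 ?sumr_ge0 // subr_ge0.
Qed.

(** Rescales the cube to unit size and uses the barrier backwards from [p]. The distance
    [scale k i / 8] from the centre leaves room for a contact box around the point found. *)
Lemma slice_point (lam Lam rb X2 Dt r M L : R) w g H tau k i (c : cells k) (p : pt) :
  barrier_reach (n := n) lam Lam X2 4^-1 Dt 8^-1 r M ->
  smooth (boxT rb 0 4) w g H tau ->
  (forall z, boxT rb 0 4 z -> 0 <= w z) ->
  (forall z, boxT rb 0 4 z -> pucci_super lam Lam (H z) (tau z)) ->
  (i <= k)%N -> 0 < r -> 0 < L -> boxT rb 0 4 p -> w p <= L ->
  dot (p.1 - cube_center i c) (p.1 - cube_center i c) <= X2 * scale k i ^+ 2 ->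
  scale k i ^+ 2 / 4 <= p.2 - cube_time i c ->
  p.2 - cube_time i c <= Dt * scale k i ^+ 2 ->
  r * scale k i + 1 <= rb ->
  exists2 y : 'rV[R]_n, (forall x, `|y 0 x - cube_center i c 0 x| <= scale k i / 8) &
    w (y, cube_time i c) <= M * L.
Proof.
move=> back sm w0 hS ik r0 L0 Dp wp.
have xcr x := @cube_center_range R n k _ c x ik; have /andP[t1 t2] := @cube_time_range R n k _ c ik.
have s0 := @scale_gt0 R k i.
have [Dpx /andP[Dpt0 Dpt1]] := Dp.
move: (cube_center i c) (cube_time i c) (scale k i) xcr t1 t2 s0
  => xc tc s xcr t1 t2 s0 hx ht1 ht2 hrb.
have ss : 0 < s ^+ 2 by rewrite exprn_gt0.
pose T := (p.2 - tc) / s ^+ 2.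
have sn0 : s != 0 by rewrite gt_eqF.
have T1 : 4^-1 <= T by rewrite ler_pdivlMr // mulrC.
have T2 : T <= Dt by rewrite ler_pdivrMr.
have eT : s ^+ 2 * T = p.2 - tc by rewrite mulrC divfK // gt_eqF.
have D1 z : boxT r 0 T z -> boxT rb 0 4 (xc + s *: z.1, tc + s ^+ 2 * z.2).
  move=> [zx /andP[zt1 zt2]]; split=> [x|] /=.
    have : `|s * z.1 0 x| <= r * s by rewrite normrM (gtr0_norm s0) mulrC ler_wpM2r // ltW.
    rewrite !mxE; move: (xcr x) s0 hrb; rewrite !ler_norml; clear.
    by move=> /andP[? ?] ? ? /andP[? ?]; apply/andP; split; lra.
  have := ler_wpM2l (ltW ss) zt2; rewrite eT; have := mulr_ge0 (ltW ss) zt1.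
  by move: t1 t2 Dpt1 ss; clear => *; apply/andP; split; lra.
have sm1 := smooth_affine D1 sm.
have [||||x0 hx0 wx0] := back T L _ _ _ _ (s^-1 *: (p.1 - xc)) T1 T2 L0 sm1.
- by move=> z Dz; apply: w0; apply: D1.
- by move=> z Dz; apply: pucci_superZ => //; apply: hS; apply: D1.
- by rewrite dotZl dotZr mulrA -expr2 exprVn mulrC ler_pdivrMr.
- rewrite /= scalerA mulfV // scale1r eT.
  by rewrite addrCA subrr addr0 addrCA subrr addr0 -surjective_pairing.
rewrite /= mulr0 addr0 in wx0; exists (xc + s *: x0) => // x.
rewrite !mxE addrAC subrr add0r normrM (gtr0_norm s0) ler_pM2l //.
rewrite -(ler_pXn2r (n := 2)) ?nnegrE // ?real_normK ?num_real //.
by rewrite (le_trans (sqr_coord_le _ _)).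
Qed.

(** Contact count for [w / L] in the box of half-width [scale k i / 4] that ends at
    [(y, cube_time i c)]; it lies in the cube because 1/8 + 1/4 < 1/2. Relative to it a mesh cell
    has size [4 / 2 ^+ i], which costs the factor [4 ^+ (n + 2)] when counts are compared with the
    number of cells of the cube. *)
Lemma slice_not_crowded (lam Lam rb mu mu1 K d l0 Lmin L : R) w g H tau k i (c : cells k)
    (y : 'rV[R]_n) :
  contact_counts lam Lam (n := n) mu1 (27 * K / Lmin) (d / 3) l0 ->
  smoothC K d (boxT rb 0 4) w g H tau ->
  (forall z, boxT rb 0 4 z -> 0 <= w z) ->
  (forall z, boxT rb 0 4 z -> pucci_super lam Lam (H z) (tau z)) ->
  (i <= k)%N -> 1 <= rb -> 0 < Lmin -> Lmin <= L -> 0 <= mu -> mu <= mu1 / 4 ^+ (n + 2) ->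
  4 / 2 ^+ i <= l0 ->
  (forall x, `|y 0 x - cube_center i c 0 x| <= scale k i / 8) ->
  w (y, cube_time i c) <= L ->
  ~~ crowded (@ancestor n k)
       (fun c : cells k => bad_cell w (3 * L) k (fun x => c.1 x) c.2) (1 - mu) i c.
Proof.
move=> count smC w0 hS ik rb1 Lm0 LL mu0 hmu ll0 hy wy.
have [K0 d0 _] := smC.
have xcr x := @cube_center_range R n k _ c x ik; have /andP[t1 t2] := @cube_time_range R n k _ c ik.
have s0 := @scale_gt0 R k i; have s1 := @scale_le1 R _ _ ik.
have es : scale k i = 2 ^+ i / 2 ^+ k :> R by [].
have incube := @cube_cell k i c _ ik.
set xc := cube_center i c in hy xcr incube; set tc := cube_time i c in wy t1 t2 incube.
set s := scale k i in hy s0 s1 xcr t1 t2 es incube.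
clearbody xc tc s.
have ss : 0 < s ^+ 2 by rewrite exprn_gt0.
have [s' es'] : exists s', s' = s / 4 by exists (s / 4).
have s'0 : 0 < s' by rewrite es' divr_gt0.
have s'1 : s' <= 1 by rewrite es' ler_pdivrMr // mul1r (le_trans s1) // ler1n.
have L0 : 0 < L by apply: lt_le_trans LL.
have in2 z : boxT 1 (-1) 0 z ->
    (forall x, `|(y + s' *: z.1) 0 x - xc 0 x| < s / 2) /\
    tc - s ^+ 2 / 4 <= tc + s' ^+ 2 * z.2 < tc + 3 / 4 * s ^+ 2.
  move=> [zx /andP[zt1 zt2]]; split=> [x|].
    have : `|s' * z.1 0 x| <= s / 4.
      by rewrite normrM (gtr0_norm s'0) -es' ler_piMr // ltW.
    have := hy x; rewrite !mxE; move: s0; rewrite ltr_norml !ler_norml; clear.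
    by move=> ? /andP[? ?] /andP[? ?]; apply/andP; split; lra.
  rewrite es' expr_div_n.
  have : 0 <= (1 + z.2) * s ^+ 2 by rewrite mulr_ge0 ?(ltW ss) // addrC -lerBlDr sub0r.
  have : 0 <= - z.2 * s ^+ 2 by rewrite mulr_ge0 ?(ltW ss) // oppr_ge0.
  by move: ss; clear => *; apply/andP; split; lra.
have D2 z : boxT 1 (-1) 0 z -> boxT rb 0 4 (y + s' *: z.1, tc + s' ^+ 2 * z.2).
  move=> /in2[zx /andP[zt1 zt2]]; split=> [x|] /=.
    move: (xcr x) (zx x) s0 rb1; rewrite ltr_norml ler_norml; clear.
    by move=> /andP[? ?] /andP[? ?] *; apply/andP; split; lra.
  by move: zt1 zt2 t1 t2 ss; clear => *; apply/andP; split; lra.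
have sm2 := smoothCZ L^-1 (smoothC_affine D2 smC).
have m3 : 1 + `|s'| + `|s' ^+ 2| <= 3.
  rewrite (gtr0_norm s'0) ger0_norm ?sqr_ge0 // expr2.
  have : s' * s' <= 1 * 1 by rewrite ler_pM // ltW.
  by move: s'1; clear; lra.
have m0 : 0 < 1 + `|s'| + `|s' ^+ 2|.
  by rewrite ltr_wpDr // ltr_wpDr.
(* [27 = 3 ^ 3] comes from the scaling factor of [smoothC_affine], which is at most 3 here. *)
have hA : `|L^-1| * ((1 + `|s'| + `|s' ^+ 2|) ^+ 3 * K) <= 27 * K / Lmin.
  rewrite gtr0_norm ?invr_gt0 // mulrC ler_pM //.
  - by rewrite mulr_ge0 // exprn_ge0 // ltW.
  - by rewrite invr_ge0 ltW.
  - apply: ler_wpM2r => //; have -> : 27 = 3 ^+ 3 :> R by rewrite -natrX.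
    by apply: lerXn2r; rewrite ?nnegrE // ltW.
  - by rewrite lef_pV2 ?posrE.
have hB : d / 3 <= d / (1 + `|s'| + `|s' ^+ 2|) by rewrite ler_pM2l // lef_pV2 ?posrE.
have sm3 := smoothC_weaken hA (divr_gt0 d0 (ltr0Sn R 2)) hB sm2.
have p2i : 0 < 2 ^+ i :> R by rewrite exprn_gt0.
have p2 : 0 < 2 ^+ k :> R by rewrite exprn_gt0.
pose l : R := 4 / 2 ^+ i.
have l0' : 0 < l by rewrite divr_gt0.
pose cell z := cellof k (y + s' *: z.1, tc + s' ^+ 2 * z.2).
have hcell z z' : boxT 1 (-1) 0 z -> boxT 1 (-1) 0 z' -> cell z = cell z' ->
    (forall x, `|z'.1 0 x - z.1 0 x| <= l) /\ `|z'.2 - z.2| <= l ^+ 2.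
  move=> Dz Dz' ec.
  have [zx zt] := in2 z Dz; have [zx' zt'] := in2 z' Dz'.
  have [i1 _] := incube (y + s' *: z.1, tc + s' ^+ 2 * z.2) zx zt.
  have [i2 _] := incube (y + s' *: z'.1, tc + s' ^+ 2 * z'.2) zx' zt'.
  rewrite -/(cell z) in i1; rewrite -/(cell z') -ec in i2.
  have [q1 q2] := incell_close i1 i2; split=> [x|].
    have := q1 x; rewrite /= !mxE (_ : _ - _ = s' * (z'.1 0 x - z.1 0 x)); last by ring.
    rewrite normrM (gtr0_norm s'0) mulrC -ler_pdivlMr // => /le_trans; apply.
    by rewrite /l es' es; apply: eq_imp_le; field; rewrite !gt_eqF.
  move: q2; rewrite /= (_ : _ - _ = s' ^+ 2 * (z'.2 - z.2)); last by ring.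
  rewrite normrM (gtr0_norm (exprn_gt0 2 s'0)) mulrC -ler_pdivlMr ?exprn_gt0 //.
  move=> /le_trans; apply.
  rewrite (_ : 4 ^+ k = (2 ^+ k) ^+ 2); last first.
    by rewrite -exprM mulnC exprM (_ : 2 ^+ 2 = 4) // -natrX.
  by rewrite /l es' es; apply: eq_imp_le; field; rewrite !gt_eqF.
have {count} := count _ _ _ _ sm3 _ _ _ l l0' ll0 _ cell hcell.
set G := [pred c' | _] => hG.
have {}hG : mu1 <= #|G|%:R * l ^+ (n + 2).
  apply: hG.
  - by move=> z Dz; rewrite mulr_ge0 ?invr_ge0 ?(ltW L0) //; apply: w0; apply: D2.
  - by rewrite /= scaler0 mulr0 !addr0 mulrC ler_pdivrMr // mul1r.
  - move=> z Dz; apply: pucci_superZ; first by rewrite invr_gt0.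
    by apply: pucci_superZ; [exact: exprn_gt0|apply: hS; apply: D2].
apply: (not_crowded_of_good (G := G)) mu0 _ => [c' /asboolP[z [Dz <- wz]]|].
  have [zx zt] := in2 z Dz.
  have [i1 i2] := incube (y + s' *: z.1, tc + s' ^+ 2 * z.2) zx zt.
  split=> //; rewrite negbK; apply/asboolP; eexists; first exact: i1.
  by move: wz; rewrite mulrC ler_pdivrMr.
have el : l ^+ (n + 2) = 4 ^+ (n + 2) / ((2 ^ i) ^ n * 4 ^ i)%:R.
  rewrite /l expr_div_n natrM !natrX -exprM exprD (_ : 4 = 2 ^+ 2 :> R); last by rewrite -natrX.
  by rewrite -!exprM -!exprD mulnDr (mulnC 2%N i).
move: hG; rewrite el mulrA ler_pdivlMr; last by rewrite ltr0n muln_gt0 !expn_gt0.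
rewrite -ler_pdivrMr ?exprn_gt0 // => /(le_trans _); apply.
by rewrite [leRHS]mulrAC ler_wpM2r.
Qed.

(** The fraction [mu] is fixed before the distances [X2], [Dt], [r], and only [M] depends on them.
    This allows the height of the stacks, and with it the distances, to be chosen from [mu]. *)
Lemma cube_step (lam Lam : R) : 0 < lam -> 0 <= Lam ->
  exists2 mu : R, 0 < mu <= 2^-1 & forall X2 Dt r : R, 0 <= X2 -> 0 < r ->
    8^-1 ^+ 2 + 2 * X2 < r ^+ 2 ->
  exists2 M : R, 1 <= M & forall (rb : R) w g H tau,
    smooth (boxT rb 0 4) w g H tau ->
    (forall z, boxT rb 0 4 z -> 0 <= w z) ->
    (forall z, boxT rb 0 4 z -> pucci_super lam Lam (H z) (tau z)) ->
    forall Lmin : R, 0 < Lmin ->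
  exists k1, forall k i (c : cells k) (p : pt) (L : R), (k1 <= k)%N -> (i <= k)%N ->
    Lmin <= L -> boxT rb 0 4 p -> w p <= L ->
    dot (p.1 - cube_center i c) (p.1 - cube_center i c) <= X2 * scale k i ^+ 2 ->
    scale k i ^+ 2 / 4 <= p.2 - cube_time i c ->
    p.2 - cube_time i c <= Dt * scale k i ^+ 2 ->
    r * scale k i + 1 <= rb ->
    ~~ crowded (@ancestor n k)
         (fun c : cells k => bad_cell w (3 * M * L) k (fun x => c.1 x) c.2) (1 - mu) i c.
Proof.
move=> lam0 Lam0; have [mu1 mu10 count] := @contact_count R n lam Lam lam0.
pose mu := Num.min (mu1 / 4 ^+ (n + 2)) 2^-1.
have mu0 : 0 < mu.
  by rewrite lt_min; apply/andP; split; [rewrite divr_gt0 // exprn_gt0|lra].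
have muh : mu <= 2^-1 by rewrite ge_min lexx orbT.
have mum : mu <= mu1 / 4 ^+ (n + 2) by rewrite ge_min lexx.
clearbody mu; exists mu; first by rewrite mu0.
move=> X2 Dt r X0 r0 hr.
have [M M1 back] := @barrier_back R n lam Lam lam0 Lam0 X2 4^-1 Dt 8^-1 r X0
  ltac:(lra) ltac:(lra) r0 hr.
exists M => // rb w g H tau sm w0 hS Lmin Lm0.
have [K [d smC]] := sm; have [K0 d0 hK] := smC.
have [l0 l00 hl0] := count (27 * K / Lmin) (d / 3) ltac:(by rewrite divr_ge0 ?mulr_ge0 // ltW)
   ltac:(by rewrite divr_gt0).
(* below the scale [r1] the function [w] is nearly constant on the cubes involved *)
pose B := n%:R * (X2 + 2) + (`|Dt| + 2).
have B0 : 0 < B.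
  have : 0 <= n%:R * (X2 + 2) by rewrite mulr_ge0 // addr_ge0.
  by have := normr_ge0 Dt; rewrite /B; clear; lra.
have BK : 0 < B * (K + 1) by rewrite mulr_gt0 // ltr_wpDl.
pose r1 := Num.min (d / B) (Lmin / (B * (K + 1))).
have r10 : 0 < r1 by rewrite lt_min !divr_gt0.
(* For [k >= k1] every cube of size above [r1] has [4 / 2 ^+ i <= l0], that is, a mesh fine enough
   for the contact count. *)
pose k1 := Num.truncn (4 / (l0 * r1)).
have hk1 k : (k1 <= k)%N -> 4 / (l0 * r1) <= 2 ^+ k.
  move=> kk; apply: le_trans (_ : k1.+1%:R <= _); first exact: ltW (truncnS_gt _).
  by rewrite -natrX ler_nat; apply: leq_ltn_trans kk (ltn_expl _ _).
exists k1 => k i c p L kk ik LL Dp wp hx ht1 ht2 hrb.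
have s0 := @scale_gt0 R k i.
have L0 : 0 < L by apply: lt_le_trans LL.
have ML : L <= M * L by rewrite ler_peMl // ltW.
have [sr|rs] := leP (scale k i) r1.
  have mu1' : mu <= 1 by apply: le_trans muh _; clear; lra.
  have sB : B * scale k i <= d by rewrite mulrC -ler_pdivlMr // (le_trans sr) // ge_min lexx.
  have sL : scale k i * (B * (K + 1)) <= Lmin.
    by rewrite -ler_pdivlMr // (le_trans sr) // ge_min lexx orbT.
  apply: (small_cube_not_crowded smC ik Dp X0 r0 M1 Lm0 LL mu1' (lexx B) sB sL wp _ ht1 ht2 hrb).
  move=> x; have h1 := sqr_coord_le (p.1 - cube_center i c) x.
  have -> : p.1 0 x - cube_center i c 0 x = (p.1 - cube_center i c) 0 x by rewrite !mxE.
  rewrite -(ler_pXn2r (n := 2)) ?nnegrE ?mulr_ge0 ?(ltW s0) ?addr_ge0 //.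
  rewrite real_normK ?num_real // exprMn (le_trans h1) // (le_trans hx) //.
  by rewrite ler_pM2r ?exprn_gt0 // expr2; move: X0; clear; nra.
have [y hy wy] := slice_point back sm w0 hS ik r0 L0 Dp wp hx ht1 ht2 hrb.
rewrite -mulrA; apply: (slice_not_crowded hl0 smC w0 hS) hy wy => //.
- by apply: le_trans hrb; rewrite lerDr mulr_ge0 // ltW.
- exact: le_trans ML.
- exact: ltW.
rewrite ler_pdivrMr ?exprn_gt0 //; have := hk1 k kk; rewrite ler_pdivrMr ?mulr_gt0 // => q1.
have q2 : r1 * 2 ^+ k <= 2 ^+ i by rewrite -ler_pdivlMr ?exprn_gt0 // ltW.
apply: le_trans q1 _; rewrite mulrCA ler_pM2l //.
by rewrite mulrC.
Qed.

End CubeStepMain.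

Lemma expr_small (R : realType) (q e : R) : 0 <= q -> q < 1 -> 0 < e ->
  exists J, q ^+ J < e.
Proof.
move=> q0 q1 e0.
have : (fun J => q ^+ J) @ \oo --> (0 : R) by apply: cvg_expr; rewrite ger0_norm.
move=> /cvgrPdist_lt /(_ e e0) [J _ hJ]; exists J.
have := hJ J (leqnn J); rewrite /= sub0r normrN ger0_norm //; exact: exprn_ge0.
Qed.

(** * The density estimate on a unit cube *)

Section DensityLemma.
Context {R : realType} {n : nat}.
Notation pt := ('rV[R]_n * R)%type.
Implicit Types (w tau : pt -> R) (g : pt -> 'rV[R]_n) (H : pt -> 'M[R]_n) (z : pt).
Local Notation cells k := ({ffun 'I_n -> 'I_(2 ^ k)} * 'I_(2 * 4 ^ k))%type.

Lemma stack_space k i (c : cells k) (a' : {ffun 'I_n -> 'I_(2 ^ k)}) (b' : nat) z :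
  (forall x, a' x %/ 2 ^ i.+1 = c.1 x %/ 2 ^ i.+1)%N ->
  incell k (fun x => a' x) b' z ->
  forall x, `|z.1 0 x - cube_center i c 0 x| <= 2 * scale k i.
Proof.
move=> ea [zx _] x; have /andP[z1 z2] := zx x.
have p2 : 0 < 2 ^+ k :> R by rewrite exprn_gt0.
have e2 := scale2E (R := R) k i; have s0 := @scale_gt0 R k i.
have q0' : (0 < 2 ^ i.+1)%N by rewrite expn_gt0.
have f1 : (a' x < (c.1 x %/ 2 ^ i.+1).+1 * 2 ^ i.+1)%N by rewrite -ea ltn_ceil.
have f2 : ((c.1 x %/ 2 ^ i.+1) * 2 ^ i.+1 <= a' x)%N by rewrite -ea leq_trunc_div.
have f3 : (c.1 x %/ 2 ^ i %/ 2 = c.1 x %/ 2 ^ i.+1)%N by rewrite -divnMA expnSr.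
rewrite mxE; move: f1 f2; rewrite -f3 !expnSr.
have := divn_eq (c.1 x %/ 2 ^ i) 2; have := ltn_mod (c.1 x %/ 2 ^ i) 2.
move: (c.1 x %/ 2 ^ i %/ 2)%N (c.1 x %/ 2 ^ i %% 2)%N => A B /= B2 -> f1 f2.
have {}f1 : (a' x + 1)%:R <= (2 * (A + 1))%:R * 2 ^+ i :> R.
  rewrite -[2 ^+ i]natrX -[_ * _]natrM ler_nat.
  by rewrite addn1 (leq_trans f1) //; lia.
have {}f2 : (2 * A)%:R * 2 ^+ i <= (a' x : nat)%:R :> R.
  by rewrite -[2 ^+ i]natrX -[_ * _]natrM ler_nat (leq_trans _ f2) //; lia.
have [B0 B1] : 0 <= B%:R :> R /\ B%:R <= 1 :> R.
  by rewrite ler0n lern1 -ltnS.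
rewrite e2 in f1 f2; rewrite natrD natrM.
move: f1 f2; rewrite !natrM !natrD.
move: (scale k i) (2 ^+ k : R) p2 s0 (B%:R) (A%:R) ((a' x)%:R) (z.1 0 x) z1 z2 B0 B1.
clear => s p p0 s0 B A a zz z1 z2 B0 B1 f1 f2.
have g1 : 2 * A * s <= zz by rewrite -(ler_pM2r p0); lra.
have g2 : zz <= (2 * A + 2) * s by rewrite -(ler_pM2r p0); lra.
have := mulr_ge0 B0 (ltW s0); have := ler_wpM2r (ltW s0) B1.
by rewrite ler_norml => *; apply/andP; split; lra.
Qed.

Lemma stack_time k i m (c : cells k) (a' : {ffun 'I_n -> 'I_(2 ^ k)}) (b' : nat) z :
  ((c.2 %/ 4 ^ i.+1).+1 * 4 ^ i.+1 <= b' < (c.2 %/ 4 ^ i.+1 + 1 + m) * 4 ^ i.+1)%N ->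
  incell k (fun x => a' x) b' z ->
  scale k i ^+ 2 / 4 <= z.2 - cube_time i c /\
  z.2 - cube_time i c <= 4 * (m%:R + 1) * scale k i ^+ 2.
Proof.
move=> /andP[b1 b2] [_ /andP[z1 z2]]; rewrite /cube_time.
have p4 : 0 < 4 ^+ k :> R by rewrite exprn_gt0.
have e4 := scale4E (R := R) k i; have ss := exprn_gt0 2 (@scale_gt0 R k i).
have f3 : (c.2 %/ 4 ^ i %/ 4 = c.2 %/ 4 ^ i.+1)%N by rewrite -divnMA expnSr.
move: b1 b2; rewrite -f3 !expnSr.
have := divn_eq (c.2 %/ 4 ^ i) 4; have := ltn_mod (c.2 %/ 4 ^ i) 4.
move: (c.2 %/ 4 ^ i %/ 4)%N (c.2 %/ 4 ^ i %% 4)%N => A B /= B4 -> f1 f2.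
have {}f1 : (4 * (A + 1))%:R * 4 ^+ i <= b'%:R :> R.
  by rewrite -[4 ^+ i]natrX -[_ * _]natrM ler_nat (leq_trans _ f1) //; lia.
have {}f2 : (b' + 1)%:R <= (4 * (A + 1 + m))%:R * 4 ^+ i :> R.
  by rewrite -[4 ^+ i]natrX -[_ * _]natrM ler_nat addn1 (leq_trans f2) //; lia.
have [B0 B1] : 0 <= B%:R :> R /\ B%:R <= 3 :> R.
  by rewrite ler0n ler_nat -ltnS.
rewrite e4 in f1 f2; rewrite natrD natrM.
move: f1 f2; rewrite !natrM !natrD.
move: (scale k i ^+ 2) (4 ^+ k : R) p4 ss (B%:R) (A%:R) (m%:R) (b'%:R) (z.2) z1 z2 B0 B1.
clear => s p p0 s0 B A m b zz z1 z2 B0 B1 f1 f2.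
have g1 : (4 * A + 4) * s <= zz by rewrite -(ler_pM2r p0); lra.
have g2 : zz <= (4 * (A + 1 + m)) * s by rewrite -(ler_pM2r p0); lra.
have := mulr_ge0 B0 (ltW s0); have := ler_wpM2r (ltW s0) B1.
by move=> *; split; lra.
Qed.

(** The value of [r * scale k i + 1] in [cube_step] for the root cubes, where
    [r * scale k i = 3 * (n + 1)]. *)
Definition dens_radius : R := 3 * n%:R + 4.

(** The levels [L j] grow by the factor [q] while the bad fraction decays geometrically. After [J]
    steps the fraction is small enough, and [delta] is chosen so that the level has then become
    1. *)
Lemma density_lemma (lam Lam : R) : 0 < lam -> 0 <= Lam ->
  exists2 delta : R, 0 < delta & forall w g H tau (p : pt),
    smooth (boxT dens_radius 0 4) w g H tau ->
    (forall z, boxT dens_radius 0 4 z -> 0 <= w z) ->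
    (forall z, boxT dens_radius 0 4 z -> pucci_super lam Lam (H z) (tau z)) ->
    (forall i, `|p.1 0 i| <= 1) -> 3 <= p.2 <= 4 -> w p <= delta ->
  exists k1, forall k, (k1 <= k)%N ->
    \sum_(c : cells k | (c.2 < 4 ^ k)%N) (bad_cell w 1 k (fun x => c.1 x) c.2)%:R
      <= 3^-1 * ((2 ^ k) ^ n * 4 ^ k)%:R :> R.
Proof.
move=> lam0 Lam0; have [mu /andP[mu0 mu1] step] := @cube_step R n lam Lam lam0 Lam0.
(* This height makes [(1 - mu) (m + 1) / m] at most [1 - mu / 2]. The region counted first has twice
   the volume of the final one, so the power must fall below 1/6 to leave a third. *)
pose m := (Num.truncn (2 / mu)).+1.
have m0 : (0 < m)%N by [].
have mR : 2 / mu < m%:R by apply: truncnS_gt.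
have mR0 : 0 < m%:R :> R by rewrite ltr0n.
clearbody m.
have [J hJ] := @expr_small R (1 - mu / 2) 6^-1 ltac:(lra) ltac:(lra) ltac:(lra).
have J0 : (0 < J)%N.
  by rewrite lt0n; apply/eqP => e; move: hJ; rewrite e expr0; lra.
pose k0 := (J * m)%N; have k0J : (J * m <= 4 ^ k0)%N by apply/ltnW/ltn_expl.
have mk0 : (m <= 4 ^ k0)%N by apply: leq_trans k0J; rewrite leq_pmull.
clearbody k0.
have gam : (1 - mu) * m.+1%:R / m%:R <= 1 - mu / 2.
  rewrite ler_pdivrMr // -(natr1 m); move: mR; rewrite ltr_pdivrMr //; nra.
have n0 : 0 <= n%:R :> R by [].
have p0 : 1 <= 4 ^+ k0 :> R by rewrite exprn_ege1 // ler1n.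
have p02 : 1 <= 2 ^+ k0 :> R by rewrite exprn_ege1 // ler1n.
have e42 : 4 ^+ k0 = (2 ^+ k0) ^+ 2 :> R by rewrite -exprM mulnC exprM (_ : 2 ^+ 2 = 4) // -natrX.
(* Root cubes have scale [2 ^- k0]; in this unit their distance to [p] is of order [2 ^+ k0] in
   space and [4 ^+ k0] in time. The second use of [step] below is for stacks, which stay within two
   cube sides in space and [4 (m + 1)] units in time. *)
have [|||M1 M11 step1] := step (4 * n%:R * 4 ^+ k0) (4 * 4 ^+ k0) (3 * (n%:R + 1) * 2 ^+ k0) _ _ _.
- by rewrite !mulr_ge0 // (le_trans _ p0).
- by rewrite !mulr_gt0 ?ltr_wpDl // (lt_le_trans _ p02).
- rewrite exprMn -e42; move: (4 ^+ k0) p0 => q q1; rewrite !expr2.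
  have h1 : 0 <= n%:R * q by rewrite mulr_ge0 //; lra.
  have h2 : 0 <= n%:R * n%:R * q by rewrite !mulr_ge0 //; lra.
  lra.
have [|||M2 M21 step2] := step (4 * n%:R) (4 * (m%:R + 1)) (3 * (n%:R + 1)) _ _ _.
- by rewrite mulr_ge0.
- by rewrite mulr_gt0 // ltr_wpDl.
- by rewrite !expr2; have := mulr_ge0 n0 n0; lra.
pose q := 3 * M2; have q1 : 1 <= q by move: M21; rewrite /q; clear; lra.
pose delta := (3 * M1 * q ^+ J)^-1.
have dlt0 : 0 < delta.
  rewrite invr_gt0 !mulr_gt0 ?exprn_gt0 //; first by apply: lt_le_trans M11.
  exact: lt_le_trans q1.
exists delta => // w g H tau p sm w0 hS px /andP[pt1 pt2] wp.
have [k1 hk1] := step1 dens_radius w g H tau sm w0 hS delta dlt0.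
have [k2 hk2] := step2 dens_radius w g H tau sm w0 hS delta dlt0.
exists (maxn k0 (maxn k1 k2)) => k; rewrite !geq_max => /and3P[kk0 kk1 kk2].
pose L j := 3 * M1 * (delta * q ^+ j).
have qj j : 1 <= q ^+ j by rewrite exprn_ege1.
have Lge j : delta <= L j.
  have : delta <= delta * q ^+ j by rewrite ler_peMr // ltW.
  by move: M11 (ltW dlt0); rewrite /L; clear; nra.
have LJ : L J = 1 by rewrite /L mulrCA mulVf // gt_eqF // -invr_gt0.
pose bad j (a : {ffun 'I_n -> 'I_(2 ^ k)}) (b : nat) := bad_cell w (L j) k (fun x => a x) b.
have pbox : boxT dens_radius 0 4 p.
  split=> [i|]; last by rewrite pt2 (le_trans _ pt1).
  by rewrite (le_trans (px i)) // /dens_radius; move: n0; clear; lra.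
pose h := (k - k0)%N.
have sc : scale k h = 2 ^- k0 :> R.
  rewrite /scale (_ : 2 ^+ k = 2 ^+ h * 2 ^+ k0); last by rewrite -exprD subnK.
  have p0h : 2 ^+ h != 0 :> R by rewrite expf_neq0 // pnatr_eq0.
  by rewrite invfM mulrA mulfV // mul1r.
have sc2 : scale k h ^+ 2 = 4 ^- k0 :> R.
  by rewrite sc exprVn -e42.
have roots j (c : cells k) : (j < J)%N ->
    ~~ crowded (@ancestor n k) (fun c : cells k => bad j.+1 c.1 c.2) (1 - mu) h c.
  move=> _; have hk : (h <= k)%N := leq_subr _ _.
  have xcr x := @cube_center_range R n k _ c x hk; have /andP[t1 t2] := @cube_time_range R n k _ c hk.
  have s0 := @scale_gt0 R k h; have s1 := @scale_le1 R _ _ hk.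
  have s2 : 0 < scale k h ^+ 2 :> R := exprn_gt0 _ s0.
  have s3 : scale k h ^+ 2 <= 1 :> R by rewrite expr_le1 // ltW.
  apply: (hk1 k h c p (delta * q ^+ j.+1)) => //.
  - by rewrite ler_peMr // ltW.
  - by apply: le_trans wp _; rewrite ler_peMr // ltW.
  - rewrite sc2 -mulrA mulfV ?mulr1; last by rewrite gt_eqF // exprn_gt0.
    rewrite dotE (le_trans (_ : _ <= \sum_(i < n) 4)) //; last first.
      by rewrite sumr_const card_ord mulr_natr.
    apply: ler_sum => x _.
    have -> : (p.1 - cube_center h c) 0 x = p.1 0 x - cube_center h c 0 x by rewrite !mxE.
    move: (xcr x) (px x) s0; rewrite ler_norml; clear.
    by move=> /andP[c1 c2] /andP[d1 d2] s0; nra.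
  - by move: t1 t2 s2 s3 pt1; clear; lra.
  - rewrite sc2 -mulrA mulfV ?mulr1; last by rewrite gt_eqF // exprn_gt0.
    by move: t1 t2 s2 s3 pt2; clear; lra.
  - rewrite sc -mulrA mulfV ?mulr1; last by rewrite gt_eqF // exprn_gt0.
    by rewrite /dens_radius; move: n0; clear; lra.
have stacks j i (c : cells k) (a' : {ffun 'I_n -> 'I_(2 ^ k)}) (b' : nat) :
    (j < J)%N -> (i < h)%N ->
    crowded (@ancestor n k) (fun c : cells k => bad j.+1 c.1 c.2) (1 - mu) i c ->
    (forall x, a' x %/ 2 ^ i.+1 = c.1 x %/ 2 ^ i.+1)%N ->
    ((c.2 %/ 4 ^ i.+1).+1 * 4 ^ i.+1 <= b' < (c.2 %/ 4 ^ i.+1 + 1 + m) * 4 ^ i.+1)%N ->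
    bad j a' b'.
  (* A point of the stack with [w <= L j] would make the earlier cube uncrowded at level [L j.+1],
     by the backward step. *)
  move=> jJ ih cr ea /andP[b1 b2]; apply/negP => /asboolP[z [zx zt] wz].
  have ik : (i <= k)%N by rewrite (leq_trans (ltnW ih)) // leq_subr.
  move: cr; apply/negP.
  have -> : (fun c : cells k => bad j.+1 c.1 c.2) =
      (fun c : cells k => bad_cell w (3 * M2 * L j) k (fun x => c.1 x) c.2).
    by apply/funext => c'; rewrite /bad; congr bad_cell; rewrite /L exprS -/q; ring.
  have p4 : 0 < 4 ^+ k :> R by rewrite exprn_gt0.
  have xcr x := @cube_center_range R n k _ c x ik; have /andP[t1 t2] := @cube_time_range R n k _ c ik.
  have s0 := @scale_gt0 R k i; have s1 := @scale_le1 R _ _ ik.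
  have zxc := stack_space ea (conj zx zt).
  have [z3 z4] := stack_time (introT andP (conj b1 b2)) (conj zx zt).
  have tB : (c.2 %/ 4 ^ i.+1 * 4 ^ i.+1 < 2 * 4 ^ k)%N.
    by apply: leq_ltn_trans (leq_trunc_div _ _) (ltn_ord _).
  have kk : (4 ^ k = 4 ^ k0 * 4 ^ h)%N by rewrite -expnD subnKC.
  have ih4 : (4 ^ i.+1 <= 4 ^ h)%N by rewrite leq_exp2l.
  have b4 : (b' < 4 * 4 ^ k)%N.
    apply: leq_trans b2 _; rewrite -addnA mulnDl.
    have h1 : ((1 + m) * 4 ^ i.+1 <= 2 * 4 ^ k)%N.
      rewrite kk mulnA; apply: leq_mul ih4.
      by rewrite mul2n -addnn; apply: leq_add mk0; rewrite expn_gt0.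
    apply: leq_trans (leq_add (ltnW tB) h1) _; by rewrite -mulnDl.
  have /andP[z1 z2] := zt.
  have zt4 : z.2 <= 4.
    rewrite -(ler_pM2l p4); apply: le_trans (ltW z2) _.
    by rewrite natr1 -natrX -natrM ler_nat mulnC.
  apply: (hk2 k i c z (L j)) => //.
  - split=> [x|].
      move: (xcr x) (zxc x) s1 s0 n0; rewrite !ler_norml /dens_radius; clear.
      by move=> /andP[? ?] /andP[? ?] *; apply/andP; split; lra.
    by move: t1 t2 z3 zt4 s0 (exprn_gt0 2 s0); clear => *; apply/andP; split; lra.
  - rewrite dotE (le_trans (_ : _ <= \sum_(j0 < n) (4 * scale k i ^+ 2))) //; last first.
      by rewrite sumr_const card_ord -[_ *+ n]mulr_natr mulrAC.
    apply: ler_sum => x _; have := zxc x.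
    have -> : (z.1 - cube_center i c) 0 x = z.1 0 x - cube_center i c 0 x by rewrite !mxE.
    move=> zz; rewrite -expr2 -real_normK ?num_real //.
    have -> : 4 * scale k i ^+ 2 = (2 * scale k i) ^+ 2 :> R by ring.
    by rewrite ler_pXn2r ?nnegrE // mulr_ge0 // ltW.
  - by rewrite /dens_radius; move: s0 s1 n0; clear; nra.
have thr0 : 0 <= 1 - mu by move: mu1; clear; lra.
have thr1 : 1 - mu < 1 by move: mu0; clear; lra.
have := density_iter kk0 m0 k0J thr0 thr1 roots stacks.
rewrite /bad LJ => /le_trans; apply.
rewrite mulrA ler_wpM2r //.
have : ((1 - mu) * m.+1%:R / m%:R) ^+ J <= (1 - mu / 2) ^+ J.
  apply: lerXn2r => //; rewrite nnegrE.
    by rewrite divr_ge0 ?mulr_ge0.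
  by move: mu1; clear; lra.
by move: hJ; clear; lra.
Qed.

End DensityLemma.

(** * Spectral decomposition and orthogonal projections *)

Section SpectralSplit.
Context {R : realType} {n : nat}.
Notation pt := ('rV[R]_n * R)%type.
Implicit Types (x y b : 'rV[R]_n) (N P B : 'M[R]_n).

Lemma bf_sym N x y : N^T = N -> bf N x y = bf N y x.
Proof.
move=> sN; rewrite !bfE exchange_big /=; apply: eq_bigr => i _; apply: eq_bigr => j _.
by rewrite -[in LHS]sN mxE; ring.
Qed.

Lemma qfD N x y : N^T = N -> qf N (x + y) = qf N x + 2 * bf N x y + qf N y.
Proof. by move=> sN; rewrite /qf bfDl !bfDr (bf_sym y x sN); ring. Qed.

Lemma qf_eq0 N : N^T = N -> (forall x, qf N x = 0) -> N = 0.
Proof.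
move=> sN h; apply/matrixP => i j; rewrite mxE -(bf_delta N i j).
by have := qfD (delta_mx 0 i) (delta_mx 0 j) sN; rewrite !h; lra.
Qed.

(** [b] minimizes the form, so the first variation [2 * bf P b y] vanishes in every direction
    [y]. *)
Lemma psd_qf_eq0 P b : psd P -> qf P b = 0 -> b *m P = 0.
Proof.
move=> [sP P0] hb; apply: dot_eq0 => y; rewrite -bf_dot.
have [//||+ _] := @second_order_test _ (2 * bf P b y) (qf P y) 0 1 ltr01.
  move=> s _; have := P0 (b + s *: y); rewrite qfD // hb bfZr qfZ; lra.
lra.
Qed.

Lemma continuous_qf (D : set pt) N : {within D, continuous (fun z : pt => qf N z.1)}.
Proof.
have c1 i : continuous (fun z : pt => z.1 0 i).
  move=> z; apply/cvgrPdist_lt => e e0; apply/near_pt_nbhs; exists e => // z' [h1 _].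
  exact: h1.
have -> : (fun z : pt => qf N z.1) =
    (fun z : pt => \sum_i \sum_j z.1 0 i * N i j * z.1 0 j).
  by apply/funext => z; rewrite /qf bfE.
apply: continuous_subspaceT => z.
apply: cvg_big => [|i _]; first exact: add_continuous.
apply: cvg_big => [|j _]; first exact: add_continuous.
apply: cvgM; last exact: c1.
by apply: cvgM; [exact: c1|exact: cvg_cst].
Qed.

(** A maximizer of the form on the unit ball lies on the sphere because the maximum [l] is positive;
    then [l - N] is positive semidefinite with a zero of its form at [b], and [psd_qf_eq0]
    applies. *)
Lemma max_eigenvector N x : N^T = N -> 0 < qf N x ->
  exists b, exists2 l : R, l != 0 & dot b b = 1 /\ b *m N = l *: b.
Proof.
move=> sN hx.
have normalize y : y != 0 -> dot ((enorm y)^-1 *: y) ((enorm y)^-1 *: y) = 1 /\ 0 < enorm y.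
  move=> y0; have e0 : enorm y != 0.
    apply: contra y0 => /eqP e; apply/eqP/rowP => i; rewrite mxE; apply/eqP.
    by rewrite -normr_le0 -e coord_enorm.
  have e1 : 0 < enorm y by rewrite lt_def e0 enorm_ge0.
  split => //; rewrite dotZl dotZr -enorm_sqr expr2; field; exact: e0.
have c2 : compact [set z : pt | boxT 1 0 0 z /\ qf 1%:M z.1 - 1 <= 0].
  apply: sublevel_compact; first exact: boxT_compact.
  move=> z; apply: cvgB; last exact: cvg_cst.
  exact: continuous_qf.
have inball y : dot y y <= 1 -> [set z : pt | boxT 1 0 0 z /\ qf 1%:M z.1 - 1 <= 0] (y, 0).
  move=> y1; split => /=; last by rewrite qf1 subr_le0.
  split=> [i|]; last by rewrite lexx.
  rewrite (le_trans (coord_enorm y i)) // -(ler_pXn2r (n := 2)) ?nnegrE ?enorm_ge0 //.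
  by rewrite enorm_sqr expr1n.
have x0 : x != 0 by apply: contraTneq hx => ->; rewrite /qf /bf !mul0mx mxE ltxx.
have [||[b tb]] := @compact_EVT_max _ R (fun z : pt => qf N z.1) _ _ c2.
- by exists (0, 0); apply: inball; rewrite dot0r.
- exact: continuous_qf.
rewrite inE => -[_]; rewrite /= qf1 subr_le0 => b1 hmax.
have up y : qf N y <= qf N b * dot y y.
  have [->|y0] := eqVneq y 0; first by rewrite dot0r mulr0 /qf /bf !mul0mx mxE.
  have [d1 e1] := normalize y y0.
  have := hmax ((enorm y)^-1 *: y, 0); rewrite inE => /(_ (inball _ (eq_imp_le d1))).
  rewrite /= qfZ exprVn -ler_pdivlMl ?invr_gt0 ?exprn_gt0 // invrK enorm_sqr.
  by rewrite [leRHS]mulrC.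
have l0 : 0 < qf N b.
  have := lt_le_trans hx (up x); rewrite pmulr_lgt0 // lt_def dot_ge0 andbT.
  apply: contra x0 => /eqP e; apply/eqP/rowP => i; rewrite mxE.
  by apply/eqP; rewrite -sqrf_eq0 eq_le sqr_ge0 andbT -e sqr_coord_le.
have bb : dot b b = 1.
  by apply/eqP; rewrite eq_le b1 -(ler_pM2l l0) mulr1 up.
exists b, (qf N b); first by rewrite gt_eqF.
split => //; apply/eqP; rewrite -subr_eq0 -oppr_eq0 opprB -mul_mx_scalar -mulmxBr.
apply/eqP/psd_qf_eq0.
  split=> [|y]; first by rewrite linearB /= tr_scalar_mx sN.
  by rewrite qfDm qfNm -[_%:M]scalemx1 qfZm qf1 subr_ge0 up.
by rewrite qfDm qfNm -[_%:M]scalemx1 qfZm qf1 bb; ring.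
Qed.

Lemma eigenvector N : N^T = N -> N != 0 ->
  exists b, exists2 l : R, l != 0 & dot b b = 1 /\ b *m N = l *: b.
Proof.
move=> sN N0; have [x hx] : exists x, qf N x != 0.
  apply: contrapT => h; move/eqP: N0; apply; apply: qf_eq0 => // x.
  by apply/eqP; apply: contrapT => /negP hx; apply: h; exists x.
have [lt|gt|/eqP] := ltgtP 0 (qf N x); last by rewrite eq_sym (negPf hx).
  exact: max_eigenvector lt.
have [||b [l l0 [bb e]]] := @max_eigenvector (- N) x; rewrite ?linearN /= ?sN ?qfNm ?oppr_gt0 //.
by exists b, (- l); rewrite ?oppr_eq0 // scaleNr -e mulmxN opprK.
Qed.

Lemma row_outer b x : x *m (b^T *m b) = dot x b *: b.
Proof. by rewrite mulmxA [x *m _]mx11_scalar mul_scalar_mx. Qed.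

(* Induction on the rank: subtracting [l b^T b] for an eigenvector [b] adds
   [b] to the kernel. *)
Lemma spectral_seq N : N^T = N -> exists s : seq (R * 'rV[R]_n),
  [/\ N = \sum_(p <- s) p.1 *: (p.2^T *m p.2),
      forall p, p \in s -> [/\ p.1 != 0, dot p.2 p.2 = 1 & p.2 *m N = p.1 *: p.2] &
      pairwise (fun p q => dot p.2 q.2 == 0) s].
Proof.
have [k] := ubnP (\rank N); elim: k N => // k IH N; rewrite ltnS => rk sN.
have [->|N0] := eqVneq N 0; first by exists [::]; rewrite big_nil.
have [b [l l0 [bb e]]] := eigenvector sN N0.
pose N1 := N - l *: (b^T *m b).
have sN1 : N1^T = N1 by rewrite linearB /= linearZ /= trmx_mul trmxK sN.
have bN1 : b *m N1 = 0 by rewrite mulmxBr -scalemxAr row_outer bb scale1r e subrr.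
have b0 : b != 0 by apply: contra_eq_neq bb => ->; rewrite dot0r eq_sym oner_eq0.
have kerS : (kermx N + b <= kermx N1)%MS.
  rewrite addsmx_sub; apply/andP; split; last by apply/sub_kermxP.
  apply/sub_kermxP; rewrite mulmxBr mulmx_ker sub0r.
  apply/eqP; rewrite oppr_eq0 -scalemxAr scaler_eq0 (negPf l0) /=; apply/eqP.
  have : kermx N *m (b *m N)^T = 0 by rewrite trmx_mul sN mulmxA mulmx_ker mul0mx.
  rewrite e linearZ /= -scalemxAr => /eqP; rewrite scaler_eq0 (negPf l0) /= => /eqP h.
  by rewrite mulmxA h mul0mx.
have rk1 : (\rank N1 < \rank N)%N.
  have r1 : (\rank (kermx N) < \rank (kermx N + b)%MS)%N.
    rewrite -[(_ < _)%N]/(_ < _)%N; have := mxrankS (addsmxSl (kermx N) b).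
    rewrite leq_eqVlt => /orP[/eqP er|//].
    have := mxrank_leqif_eq (addsmxSl (kermx N) b); rewrite er => -[_]; rewrite eqxx.
    move=> /esym /andP[_ h]; have : (b <= kermx N)%MS := submx_trans (addsmxSr _ _) h.
    move=> /sub_kermxP; rewrite e => /eqP; rewrite scaler_eq0 (negPf l0) (negPf b0) //.
  have := leq_trans r1 (mxrankS kerS); rewrite !mxrank_ker; lia.
have [s [es hs ps]] := IH N1 (leq_trans rk1 rk) sN1.

have ob p : p \in s -> dot p.2 b = 0.
  move=> /hs[p0 _ pe]; have : p.1 * dot p.2 b = 0.
    by rewrite -dotZl -pe -bf_dot bf_sym // bf_dot bN1 dotC dot0r.
  by move=> /eqP; rewrite mulf_eq0 (negPf p0) => /eqP.
exists ((l, b) :: s); split.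
- by rewrite big_cons /= -es addrC subrK.
- move=> p; rewrite inE => /predU1P[->//|ps']; have [p0 p1 pe] := hs p ps'; split => //.
  rewrite -[N](subrK (l *: (b^T *m b))) mulmxDr -/N1 pe -scalemxAr row_outer ob //.
  by rewrite scale0r scaler0 addr0.
- rewrite /= ps andbT; apply/allP => p ps'; by rewrite dotC ob.
Qed.

Lemma orthonormal_projection (t : seq 'rV[R]_n) :
  (forall b, b \in t -> dot b b = 1) -> pairwise (fun b c => dot b c == 0) t ->
  let B := \sum_(b <- t) b^T *m b in B^T = B /\ B *m B = B.
Proof.
move=> h1 h2; have sB (u : seq 'rV[R]_n) : (\sum_(b <- u) b^T *m b)^T = \sum_(b <- u) b^T *m b.
  by rewrite raddf_sum; apply: eq_bigr => b _; rewrite /= trmx_mul trmxK.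
split => //; elim: t h1 h2 => [|b t IH] h1 /=; first by rewrite big_nil mulmx0.
move=> /andP[/allP bt pt]; rewrite big_cons; set B := \sum_(_ <- _) _.
have IH' : B *m B = B by apply: IH => // c ct; apply: h1; rewrite inE ct orbT.
have bB : b *m B = 0.
  rewrite /B mulmx_sumr big1_seq // => c /andP[_ ct]; rewrite row_outer.
  by have /eqP -> := bt c ct; rewrite scale0r.
rewrite mulmxDl !mulmxDr IH' -!mulmxA bB mulmx0 addr0.
rewrite row_outer h1 ?inE ?eqxx // scale1r; congr (_ + _).
have -> : B *m (b^T *m b) = (b *m B)^T *m b by rewrite trmx_mul sB mulmxA.
by rewrite bB trmx0 mul0mx add0r.
Qed.

Lemma tr_outer_mul N b : \tr (b^T *m b *m N) = qf N b.
Proof. by rewrite -mulmxA mxtrace_mulC /qf /bf /mxtrace big_ord1. Qed.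

(** [P] and [P'] collect the positive and the negative eigenvalues, and [B] projects onto the span
    of the eigenvectors with positive eigenvalue; it maximizes [tr (B N)] among projections. *)
Lemma spectral_split N : N^T = N -> exists P P' B : 'M[R]_n,
  [/\ psd P /\ psd P', N = P - P', B^T = B, B *m B = B & \tr (B *m N) = \tr P].
Proof.
move=> sN; have [s [es hs ps]] := spectral_seq sN.
pose pos := [pred p : R * 'rV[R]_n | 0 < p.1].
exists (\sum_(p <- s | pos p) p.1 *: (p.2^T *m p.2)).
exists (\sum_(p <- s | ~~ pos p) (- p.1) *: (p.2^T *m p.2)).
exists (\sum_(b <- [seq p.2 | p <- s & pos p]) b^T *m b).
have [|| sB BB] := @orthonormal_projection [seq p.2 | p <- s & pos p].
- by move=> b /mapP[p]; rewrite mem_filter => /andP[_ /hs[_ ? _]] ->.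
- rewrite pairwise_map; apply: pairwise_filter; exact: ps.
split => //.
- split.
    elim/big_rec : _ => [|p P p0 hP]; first exact: psd0.
    by apply: psdD => //; apply: psdZ (psd_outer _); rewrite ltW.
  elim/big_rec : _ => [|p P p0 hP]; first exact: psd0.
  by apply: psdD => //; apply: psdZ (psd_outer _); rewrite oppr_ge0 leNgt.
- rewrite {1}es (bigID pos) /=; congr (_ + _).
  by rewrite -sumrN; apply: eq_bigr => p _; rewrite scaleNr opprK.
- rewrite big_map mulmx_suml !linear_sum big_filter /= big_seq_cond [RHS]big_seq_cond.
  apply: eq_bigr => p /andP[/hs[_ p1 pe] _]; rewrite mxtraceZ trace_outer p1 mulr1.
  by rewrite tr_outer_mul /qf bf_dot pe dotZl p1 mulr1.
Qed.

Lemma projection_sum B : B^T = B -> B *m B = B -> B = \sum_i (row i B)^T *m row i B.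
Proof.
move=> sB BB; rewrite -{1}BB -{1}sB; apply/matrixP => i j.
rewrite summxE mxE; apply: eq_bigr => k _.
by rewrite !mxE big_ord1 !mxE.
Qed.

Lemma tr_projection B N : B^T = B -> B *m B = B -> \tr (B *m N) = \sum_i qf N (row i B).
Proof.
move=> sB BB; rewrite {1}(projection_sum sB BB) mulmx_suml linear_sum.
by apply: eq_bigr => i _; rewrite /= tr_outer_mul.
Qed.

Lemma projectionC B : B^T = B -> B *m B = B ->
  (1%:M - B)^T = 1%:M - B /\ (1%:M - B) *m (1%:M - B) = 1%:M - B.
Proof.
move=> sB BB; split; first by rewrite linearB /= trmx1 sB.
by rewrite mulmxBl mul1mx mulmxBr mulmx1 BB subrr subr0.
Qed.

Lemma tr_projection_le B P : B^T = B -> B *m B = B -> psd P ->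
  0 <= \tr (B *m P) <= \tr P.
Proof.
move=> sB BB hP; have [sC CC] := projectionC sB BB.
have ge0 C : C^T = C -> C *m C = C -> 0 <= \tr (C *m P).
  by move=> sC' CC'; rewrite tr_projection // sumr_ge0 // => i _; apply: psd_ge0.
rewrite ge0 //=; have := ge0 _ sC CC.
by rewrite mulmxBl mul1mx linearB /= subr_ge0.
Qed.

Lemma projection_row_dot B i : B^T = B -> B *m B = B -> dot (row i B) (row i B) <= 1.
Proof.
move=> sB BB; have e : dot (row i B) (row i B) = B i i.
  rewrite dotE -{3}BB mxE; apply: eq_bigr => k _; rewrite !mxE.
  by congr (_ * _); rewrite -{1}sB mxE.
rewrite e; have := sqr_coord_le (row i B) i; rewrite e mxE expr2; clear.
move: (B i i) => c h1; have [//|lt] := leP c 1; nra.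
Qed.

Lemma psd_sum_outer P : psd P -> exists s : seq 'rV[R]_n, P = \sum_(b <- s) b^T *m b.
Proof.
move=> [sP P0]; have [s [es hs _]] := spectral_seq sP.
exists [seq Num.sqrt p.1 *: p.2 | p <- s]; rewrite big_map es big_seq [RHS]big_seq.
apply: eq_bigr => p /hs[_ p1 pe]; have := P0 p.2.
rewrite /qf bf_dot pe dotZl p1 mulr1 => l0.
have -> (c : R) (b : 'rV[R]_n) : (c *: b)^T = c *: b^T by apply/matrixP => i j; rewrite !mxE.
by rewrite -scalemxAl -scalemxAr scalerA -expr2 sqr_sqrtr.
Qed.

End SpectralSplit.

(** * Ellipticity and quasiconcavity in integrated form *)

Section Ellipticity.
Context {R : realType} {n : nat}.
Implicit Types (M P N : 'M[R]_n).
Variables (lam Lam : R) (F : 'M[R]_n -> R).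
Hypotheses (lam0 : 0 < lam) (ellF : unif_parabolic lam Lam F).

(* A positive derivative cannot be the junk value [0] of a divergent limit, so
   [F] is differentiable in the directions [b^T b]. *)
Lemma elliptic_line M (b : 'rV[R]_n) : M^T = M ->
  lam * dot b b <= F (M + b^T *m b) - F M <= Lam * dot b b.
Proof.
move=> sM; have [->|b0] := eqVneq b 0.
  by rewrite mulmx0 addr0 dot0r !mulr0 subrr lexx.
have bb : 0 < dot b b.
  rewrite lt_def dot_ge0 andbT; apply: contra b0 => /eqP e; apply/eqP/rowP => i.
  by rewrite mxE; apply/eqP; rewrite -sqrf_eq0 eq_le sqr_ge0 andbT -e sqr_coord_le.
pose f s := F (M + s *: (b^T *m b)).
have df s : lam * dot b b <= derive1 f s <= Lam * dot b b.
  have sMs : sym_mx (M + s *: (b^T *m b)).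
    by rewrite /sym_mx /= linearD /= linearZ /= trmx_mul trmxK sM.
  have := ellF sMs b; rewrite enorm_sqr.
  have <- : mdir (b^T *m b) F (M + s *: (b^T *m b)) = derive1 f s; last by [].
  rewrite /mdir /derive1; set u := (X in lim (X @ _) = _); set v := (X in _ = lim (X @ _)).
  suff -> : u = v by [].
  by apply/funext => h; rewrite /u /v /f addr0 scale0r addr0 -addrA -scalerDl (addrC s).
have dv s : derivable f s 1.
  apply: contrapT => nd; have /andP[h _] := df s.
  have : 0 < derive1 f s by apply: lt_le_trans h; exact: mulr_gt0.
  rewrite derive1E /derive dvgP // => /lt_eqF; by rewrite eqxx.
have [||c _] := @MVT _ f (derive1 f) 0 1 ltr01.
- by move=> x _; rewrite derive1E; apply/derivableP.
- by apply: derivable_within_continuous => x _.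
rewrite /f scale1r scale0r addr0 subr0 mulr1 => ->; exact: df.
Qed.

(** [elliptic_line] treats rank one increments; a positive semidefinite increment is reached by
    adding rank one matrices in turn. *)
Lemma elliptic_psd M P : M^T = M -> psd P ->
  lam * \tr P <= F (M + P) - F M <= Lam * \tr P.
Proof.
move=> sM /psd_sum_outer[s ->]; elim: s M sM => [|b s IH] M sM.
  by rewrite big_nil addr0 subrr mxtrace0 !mulr0 lexx.
rewrite big_cons mxtraceD trace_outer.
have sM1 : (M + b^T *m b)^T = M + b^T *m b by rewrite linearD /= trmx_mul trmxK sM.
have /andP[h1 h2] := elliptic_line b sM; have /andP[h3 h4] := IH _ sM1.
by rewrite addrA; apply/andP; split; lra.
Qed.

Lemma elliptic_diff M P N : M^T = M -> psd P -> psd N ->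
  lam * \tr P - Lam * \tr N <= F (M + (P - N)) - F M.
Proof.
move=> sM hP hN; have sMN : (M + (P - N))^T = M + (P - N).
  by rewrite !linearD /= linearN /= sM (psd_sym hP) (psd_sym hN).
have /andP[h1 _] := elliptic_psd sM hP; have /andP[_ h2] := elliptic_psd sMN hN.
by move: h2; rewrite addrA subrK; lra.
Qed.

(** Convexity of the superlevel sets of [F]: the average is built one matrix at a time, the new one
    with weight the inverse of the new length. *)
Lemma quasiconcave_sum (I : eqType) (s : seq I) (M : I -> 'M[R]_n) (c : R) :
  quasiconcave F -> s != [::] -> (forall i, (M i)^T = M i) ->
  (forall i, c <= F (M i)) -> c <= F ((size s)%:R^-1 *: \sum_(i <- s) M i).
Proof.
move=> qF + sM cM; elim: s => // i s IH _; have [->|s0] := eqVneq s [::].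
  by rewrite big_seq1 /= invr1 scale1r.
have {}IH := IH s0; have m0 : 0 < (size s)%:R :> R by rewrite ltr0n lt0n size_eq0.
have sS : ((size s)%:R^-1 *: \sum_(i <- s) M i)^T = (size s)%:R^-1 *: \sum_(i <- s) M i.
  apply/matrixP => a b; rewrite !mxE !summxE; congr (_ * _); apply: eq_bigr => j _.
  by rewrite -{1}sM mxE.
have := qF _ _ (sM i) sS ((size (i :: s))%:R^-1).
rewrite big_cons /= -natr1 => /(_ _)/wrap[].
  by rewrite invr_ge0 invf_le1; [apply/andP; split; lra|lra].
have -> : (((size s)%:R + 1)^-1 *: M i + (1 - ((size s)%:R + 1)^-1) *:
    ((size s)%:R^-1 *: \sum_(i0 <- s) M i0))
   = ((size s)%:R + 1)^-1 *: (M i + \sum_(j <- s) M j).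
  rewrite scalerDr scalerA; congr (_ + _ *: _); field.
  by apply/andP; split; rewrite gt_eqF //; lra.
by apply: le_trans; rewrite le_min cM.
Qed.

End Ellipticity.

(** * Two supersolutions small at a common point *)

Section TwoDensity.
Context {R : realType} {n : nat}.
Notation pt := ('rV[R]_n * R)%type.
Implicit Types (w tau : pt -> R) (g : pt -> 'rV[R]_n) (H : pt -> 'M[R]_n) (z p : pt).
Local Notation cells k := ({ffun 'I_n -> 'I_(2 ^ k)} * 'I_(2 * 4 ^ k))%type.
Let box : set pt := boxT (@dens_radius R n) 0 4.

Lemma count_lower_cells k :
  \sum_(c : cells k | (c.2 < 4 ^ k)%N) 1 = ((2 ^ k) ^ n * 4 ^ k)%:R :> R.
Proof.
rewrite -(pair_big xpredT (fun b : 'I_(2 * 4 ^ k) => (b < 4 ^ k)%N) (fun _ _ => 1)) /=.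
have le4 : (4 ^ k <= 2 * 4 ^ k)%N by rewrite leq_pmull.
rewrite (eq_bigr (fun=> (4 ^ k)%:R)) => [|a _]; last first.
  by rewrite (big_ord_narrow le4) sumr_const card_ord.
by rewrite sumr_const card_ffun !card_ord natrM mulr_natl.
Qed.

Lemma incell_box k (c : cells k) z : incell k (fun x => c.1 x) c.2 z -> box z.
Proof.
move=> [hx /andP[t0 t1]].
have p2 : 0 < 2 ^+ k :> R by rewrite exprn_gt0.
have p4 : 0 < 4 ^+ k :> R by rewrite exprn_gt0.
have n0 : 0 <= n%:R :> R by [].
split=> [i|].
  have /andP[x0 x1] := hx i.
  have a1 : (c.1 i)%:R + 1 <= 2 ^+ k :> R by rewrite natr1 -natrX ler_nat.
  have a0 : 0 <= (c.1 i)%:R :> R by [].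
  have z0 : 0 <= z.1 0 i by rewrite -(pmulr_rge0 _ p2); exact: le_trans x0.
  have z1 : z.1 0 i <= 1 by rewrite -(ler_pM2l p2) mulr1; lra.
  by rewrite ger0_norm // (le_trans z1) // /dens_radius; lra.
have a1 : (c.2 : nat)%:R + 1 <= 2 * 4 ^+ k :> R.
  by rewrite natr1 -natrX -natrM ler_nat.
have a0 : 0 <= (c.2 : nat)%:R :> R by [].
apply/andP; split; first by rewrite -(pmulr_rge0 _ p4); exact: le_trans t0.
by rewrite -(ler_pM2l p4); lra.
Qed.

(** Each function has at most a third of bad cells in the same lower half of the mesh, so some cell
    is good for both. Its two good points may differ, and on a fine mesh the Lipschitz bound turns 1
    into 2 for the second function. The error [delta] in the equations is absorbed by adding [delta]
    times the time. *)
Lemma two_density (lam Lam : R) : 0 < lam -> 0 <= Lam ->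
  exists2 delta : R, 0 < delta <= 1 &
  forall w1 g1 H1 tau1 w2 g2 H2 tau2 (p1 p2 : pt),
    smooth box w1 g1 H1 tau1 -> smooth box w2 g2 H2 tau2 ->
    (forall z, box z -> 0 <= w1 z) -> (forall z, box z -> 0 <= w2 z) ->
    (forall z, box z -> pucci_super lam Lam (H1 z) (tau1 z + delta)) ->
    (forall z, box z -> pucci_super lam Lam (H2 z) (tau2 z + delta)) ->
    (forall i, `|p1.1 0 i| <= 1) -> 3 <= p1.2 <= 4 ->
    (forall i, `|p2.1 0 i| <= 1) -> 3 <= p2.2 <= 4 ->
    w1 p1 <= delta -> w2 p2 <= delta ->
  exists z, [/\ box z, w1 z <= 1 & w2 z <= 2].
Proof.
move=> lam0 Lam0; have [d0 d00 dens] := @density_lemma R n lam Lam lam0 Lam0.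
(* With the added term [dl * t], [t <= 4], the value at the starting point is at most [5 * dl]. *)
pose dl := Num.min (d0 / 5) 1.
have dl0 : 0 < dl by rewrite lt_min ltr01 andbT divr_gt0.
have dl5 : dl * 5 <= d0 by rewrite -ler_pdivlMr // ge_min lexx.
exists dl; first by rewrite dl0 ge_min lexx orbT.
move=> w1 g1 H1 tau1 w2 g2 H2 tau2 p1 p2 sm1 sm2 pos1 pos2 hS1 hS2 px1 pt1 px2 pt2 wp1 wp2.
have one w g H tau p : smooth box w g H tau -> (forall z, box z -> 0 <= w z) ->
    (forall z, box z -> pucci_super lam Lam (H z) (tau z + dl)) ->
    (forall i, `|p.1 0 i| <= 1) -> 3 <= p.2 <= 4 -> w p <= dl ->
    exists k1, forall k, (k1 <= k)%N ->
    \sum_(c : cells k | (c.2 < 4 ^ k)%N)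
      (bad_cell (fun z => w z + (0 + dl * z.2)) 1 k (fun x => c.1 x) c.2)%:R
      <= 3^-1 * ((2 ^ k) ^ n * 4 ^ k)%:R :> R.
  move=> sm pos hS px ptt wp.
  apply: (dens _ _ _ _ _ (smoothD sm (smooth_time box 0 dl)) _ _ px ptt).
  - move=> z bz; rewrite add0r addr_ge0 ?pos // mulr_ge0 ?(ltW dl0) //.
    by have [_ /andP[]] := bz.
  - by move=> z bz; rewrite addr0; exact: hS.
  - move: ptt => /andP[_ t4]; rewrite add0r.
    have : dl * p.2 <= dl * 4 by rewrite ler_pM2l.
    move: wp dl5; clear; lra.
have [k1 hk1] := one _ _ _ _ _ sm1 pos1 hS1 px1 pt1 wp1.
have [k2 hk2] := one _ _ _ _ _ sm2 pos2 hS2 px2 pt2 wp2.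
have [K [d [K0 d00' hK]]] := sm2.
have n0 : 0 <= n%:R :> R by [].
have [k3 hk3] : exists k3, forall k, (k3 <= k)%N ->
    2 ^- k * (n%:R + 1) <= d /\ 2 ^- k * (K * (n%:R + 1)) <= 1.
  pose e : R := Num.min d 1 / ((K + 1) * (n%:R + 1)).
  have den : 0 < (K + 1) * (n%:R + 1) by rewrite mulr_gt0 // ltr_wpDl.
  have e0 : 0 < e by rewrite divr_gt0 // lt_min d00' ltr01.
  have [k3 h3] := @expr_small R 2^-1 e ltac:(clear -box; lra) ltac:(clear -box; lra) e0.
  exists k3 => k kk.
  have h4 : 2 ^- k <= e.
    apply: le_trans (ltW h3); rewrite -exprVn; by apply: ler_wiXn2l => //; clear -box; lra.
  have q0 : 0 <= 2 ^- k :> R by rewrite invr_ge0 exprn_ge0.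
  have h5 : 2 ^- k * ((K + 1) * (n%:R + 1)) <= Num.min d 1 by rewrite -ler_pdivlMr.
  have md : Num.min d 1 <= d by rewrite ge_min lexx.
  have m1 : Num.min d 1 <= 1 by rewrite ge_min lexx orbT.
  move: (2 ^- k) q0 h5 (mulr_ge0 K0 n0) => q q0 h5 Kn.
  have := mulr_ge0 q0 Kn; have := mulr_ge0 q0 n0; have := mulr_ge0 q0 K0.
  by move: q0 h5 md m1; rewrite !mulrDr !mulrDl !mulrDr; clear; split; lra.
pose k := maxn k1 (maxn k2 k3).
have /hk1 b1 : (k1 <= k)%N by rewrite leq_max leqnn.
have /hk2 b2 : (k2 <= k)%N by rewrite !leq_max leqnn !orbT.
have /hk3[c1 c2] : (k3 <= k)%N by rewrite !leq_max leqnn !orbT.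
clearbody k.
have [c [good1 good2]] : exists c : cells k,
    ~~ bad_cell (fun z => w1 z + (0 + dl * z.2)) 1 k (fun x => c.1 x) c.2 /\
    ~~ bad_cell (fun z => w2 z + (0 + dl * z.2)) 1 k (fun x => c.1 x) c.2.
  apply: contrapT => hn; have := lerD b1 b2; rewrite -big_split /=.
  have P0 : 0 < ((2 ^ k) ^ n * 4 ^ k)%:R :> R by rewrite ltr0n muln_gt0 !expn_gt0.
  apply/negP; rewrite -ltNge.
  apply: (@lt_le_trans _ _ ((2 ^ k) ^ n * 4 ^ k)%:R); first by move: P0; clear; lra.
  rewrite -count_lower_cells; apply: ler_sum => c _.
  have h : bad_cell (fun z => w1 z + (0 + dl * z.2)) 1 k (fun x => c.1 x) c.2 ||
    bad_cell (fun z => w2 z + (0 + dl * z.2)) 1 k (fun x => c.1 x) c.2.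
    by rewrite -[_ || _]negbK negb_or; apply/negP => /andP[? ?]; apply: hn; exists c.
  by move: h; clear -box; case: bad_cell; case: bad_cell => //= _; lra.
move: good1; rewrite negbK => /asboolP[z1 in1 w11].
move: good2; rewrite negbK => /asboolP[z2 in2 w21].
have bz1 := incell_box in1; have bz2 := incell_box in2.
have time0 z : box z -> 0 <= dl * z.2.
  by move=> [_ /andP[t0 _]]; rewrite mulr_ge0 // ltW.
exists z1; split => //; first by move: w11 (time0 z1 bz1); clear; lra.
have [cx ct] := incell_close in2 in1.
have q0 : 0 <= 2 ^- k :> R by rewrite invr_ge0 exprn_ge0.
have q42 : 4 ^- k <= 2 ^- k :> R.
  by rewrite lef_pV2 ?posrE ?exprn_gt0 // lerXn2r ?nnegrE // ler_nat.
have vx : vn (z1.1 - z2.1) <= n%:R * 2 ^- k.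
  by apply: vn_le => i; rewrite !mxE; exact: cx.
have {}ct := le_trans ct q42.
have [] := hK z2 z1 bz2 bz1.
- by move: vx c1 q0; clear; lra.
- by have := mulr_ge0 q0 n0; move: ct c1; clear; lra.
move=> _ _ _ hw.
have : K * (vn (z1.1 - z2.1) + `|z1.2 - z2.2|) <= K * ((n%:R + 1) * 2 ^- k).
  by rewrite ler_wpM2l // mulrDl mul1r lerD.
have := le_trans (ler_norm _) hw; have := time0 z2 bz2.
by move: w21 c2; clear; lra.
Qed.

End TwoDensity.

(** * Decay of oscillation for two-sided solutions *)

Section Oscillation.
Context {R : realType}.

(** Mean value inequality from a one-sided Taylor bound: a subdivision of mesh [e] leaves the error
    [C e (b - a)], which vanishes with [e]. *)
Lemma increment_le (f f' : R -> R) (a b C d m : R) : a <= b -> 0 < d -> 0 <= C ->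
  (forall s1 s2, a <= s1 -> s1 <= s2 -> s2 <= b -> s2 - s1 <= d ->
     f s2 - f s1 <= f' s1 * (s2 - s1) + C * (s2 - s1) ^+ 2) ->
  (forall s, a <= s <= b -> f' s <= m) -> f b - f a <= m * (b - a).
Proof.
move=> ab d0 C0 hf hm; rewrite -subr_ge0.
apply: (@ge0_of_small _ _ (C * (b - a)) d d0) => e e0 ed.
pose N := (Num.truncn ((b - a) / e)).+1.
have N0 : 0 < N%:R :> R by rewrite ltr0n.
have hN : (b - a) / N%:R <= e.
  by rewrite ler_pdivrMr // mulrC -ler_pdivrMr // ltW // truncnS_gt.
pose s i : R := a + i%:R * ((b - a) / N%:R).
have sS i : s i.+1 - s i = (b - a) / N%:R by rewrite /s -natr1; ring.
have st0 : 0 <= (b - a) / N%:R by rewrite divr_ge0 // ?subr_ge0 // ltW.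
have sb i : (i <= N)%N -> a <= s i <= b.
  move=> iN; rewrite /s lerDl mulr_ge0 //= -lerBrDl.
  rewrite mulrCA ler_piMr ?subr_ge0 // ler_pdivrMr // mul1r ler_nat //.
have step i : (i < N)%N -> f (s i.+1) - f (s i) <= (m + C * e) * ((b - a) / N%:R).
  move=> iN; have /andP[s1 s2] := sb _ (ltnW iN); have /andP[s3 s4] := sb _ iN.
  have s5 : s i <= s i.+1 by rewrite -subr_ge0 sS.
  have := hf _ _ s1 s5 s4; rewrite sS => /(_ (le_trans hN ed)) /le_trans; apply.
  have := ler_wpM2r st0 (hm (s i) (introT andP (conj s1 s2))).
  have := ler_wpM2l (mulr_ge0 C0 st0) hN; rewrite expr2.
  move: ((b - a) / N%:R) (f' (s i)) => q y; clear; lra.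
have := @telescope_sumr _ 0 N (fun i => f (s i)) isT.
have -> : s N = b by rewrite /s mulrC divfK ?gt_eqF //; ring.
have -> : s 0 = a by rewrite /s mul0r addr0.
rewrite big_mkord => e1.
have : \sum_(i < N) (f (s i.+1) - f (s i)) <= \sum_(i < N) (m + C * e) * ((b - a) / N%:R).
  by apply: ler_sum => i _; apply: step.
rewrite e1 sumr_const card_ord -[_ *+ N]mulr_natr -mulrA divfK ?gt_eqF //.
clear; lra.
Qed.

(** With [beta = - ln gam / ln L] a change of scale by [L] matches one factor [gam]; rounding [r] to
    a scale costs one more factor, whence [om / gam]. *)
Lemma decay_holder (gam L : R) : 0 < gam < 1 -> 1 < L ->
  exists2 beta : R, 0 < beta & forall (rho om x r : R), 0 < rho -> 0 <= om -> 0 < r ->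
    x <= om -> (forall j : nat, r <= rho * L ^- j -> x <= om * gam ^+ j) ->
    x <= om / gam * (r / rho) `^ beta.
Proof.
move=> /andP[g0 g1] L1; have L0 : 0 < L by lra.
have lnL : 0 < ln L by rewrite ln_gt0.
have lng : ln gam < 0 by rewrite ln_lt0 // g0.
pose beta := - ln gam / ln L.
have b0 : 0 < beta by rewrite divr_gt0 // oppr_gt0.
have gE : L^-1 `^ beta = gam.
  rewrite /powR gt_eqF ?invr_gt0 // lnV ?posrE // /beta mulrN divfK ?gt_eqF //.
  by rewrite opprK lnK.
exists beta => // rho om x r rho0 om0 r0 xom h.
have gi : 1 <= gam^-1 by rewrite invf_ge1 // ltW.
have omg : om <= om / gam by rewrite ler_peMr.
have [rr|rr] := ltP rho r.
  apply: le_trans xom _; apply: le_trans omg _; rewrite ler_peMr ?divr_ge0 ?(ltW g0) //.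
  have {1}<- : 1 `^ beta = 1 :> R by [rewrite powR1]; apply: ge0_ler_powR.
  - exact: ltW.
  - by rewrite nnegrE.
  - by rewrite nnegrE divr_ge0 // ltW.
  - by rewrite ler_pdivlMr // mul1r ltW.
have exj : exists j, rho * L ^- j < r.
  have [J hJ] := @expr_small R L^-1 (r / rho) ltac:(by rewrite invr_ge0 ltW)
    ltac:(by rewrite invf_lt1) ltac:(by rewrite divr_gt0).
  by exists J; rewrite mulrC -ltr_pdivlMr // -exprVn.
have := @ex_minnP (fun j => rho * L ^- j < r) exj; case => j hj jmin.
case: j hj jmin => [|j] hj jmin; first by move: hj; rewrite expr0 invr1 mulr1; lra.
have : r <= rho * L ^- j.
  by rewrite leNgt; apply/negP => /jmin; rewrite ltnn.
move=> /h /le_trans; apply; rewrite -mulrA ler_wpM2l //.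
have -> : gam ^+ j = gam^-1 * gam ^+ j.+1 by rewrite exprS mulKf // gt_eqF.
rewrite ler_wpM2l ?invr_ge0 ?(ltW g0) //.
rewrite -{1}gE -powR_mulrn ?powR_ge0 // -powRrM mulrC powRrM powR_mulrn ?invr_ge0 ?(ltW L0) //.
apply: ge0_ler_powR.
- exact: ltW.
- by rewrite nnegrE exprn_ge0 // invr_ge0 ltW.
- by rewrite nnegrE divr_ge0 // ltW.
- by rewrite ler_pdivlMr // mulrC exprVn ltW.
Qed.

Variables (n : nat) (lam Lam : R).
Notation pt := ('rV[R]_n * R)%type.
Hypotheses (lam0 : 0 < lam) (Lam0 : 0 <= Lam).
Let dr : R := @dens_radius R n.
Let box : set pt := boxT dr 0 4.

Lemma dens_radius_ge4 : 4 <= dr.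
Proof. by have : 0 <= n%:R :> R by []; rewrite /dr /dens_radius; lra. Qed.

(** Without decay [w] would come close to both of its extremes in the inner cylinder. After scaling
    to oscillation 4, [two_density] gives a point whose distances to the two extremes are at most 1
    and 2, although they add up to 4. *)
Lemma osc_decay : exists2 gam : R, 0 < gam < 1 & forall w g H tau,
  smooth box w g H tau ->
  (forall z, box z -> pucci_super lam Lam (H z) (tau z)) ->
  (forall z, box z -> pucci_super lam Lam (- H z) (- tau z)) ->
  forall m om : R, 0 <= om -> (forall z, box z -> m <= w z <= m + om) ->
  exists m', forall z : pt, (forall i, `|z.1 0 i| <= 1) -> 3 <= z.2 <= 4 ->
    m' <= w z <= m' + gam * om.
Proof.
have [dl /andP[dl0 dl1] dens] := @two_density R n lam Lam lam0 Lam0.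
exists (1 - dl / 4); first by apply/andP; split; lra.
move=> w g H tau sm h1 h2 m om om0 hw.
have n0 : 0 <= n%:R :> R by [].
have inner (z : pt) : (forall i, `|z.1 0 i| <= 1) -> 3 <= z.2 <= 4 -> box z.
  move=> hx /andP[t3 t4]; split=> [i|]; last by rewrite t4 andbT; lra.
  by rewrite (le_trans (hx i)) // /dr; have := dens_radius_ge4; rewrite /dr; lra.
have [e|omn] := eqVneq om 0.
  exists m => z hx ht; have := hw z (inner z hx ht).
  by rewrite e mulr0.
have omp : 0 < om by rewrite lt_def omn.
pose c := 4 / om; have c0 : 0 < c by rewrite divr_gt0.
have com : c * om = 4 by rewrite divfK ?gt_eqF.
apply: contrapT => hn.
have [z1 [x1 t1 w1]] : exists z : pt, [/\ forall i, `|z.1 0 i| <= 1, 3 <= z.2 <= 4 &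
    w z < m + dl / 4 * om].
  apply: contrapT => h; apply: hn; exists (m + dl / 4 * om) => z hx ht.
  have /andP[_ h4] := hw z (inner z hx ht); apply/andP; split; last by lra.
  by rewrite leNgt; apply/negP => lt; apply: h; exists z.
have [z2 [x2 t2 w2]] : exists z : pt, [/\ forall i, `|z.1 0 i| <= 1, 3 <= z.2 <= 4 &
    m + om - dl / 4 * om < w z].
  apply: contrapT => h; apply: hn; exists m => z hx ht.
  have /andP[h4 _] := hw z (inner z hx ht); apply/andP; split => //.
  by rewrite leNgt; apply/negP => lt; apply: h; exists z; split => //; lra.
have dlc : c * (dl / 4 * om) = dl by rewrite mulrCA com; field.
have smt (k b : R) := smoothD (smooth_time box k 0) (smoothZ b sm).
have [||||||z [bz]] := dens _ _ _ _ _ _ _ _ z1 z2 (smt (- (c * m)) c)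
   (smt (c * (m + om)) (- c)) _ _ _ _ x1 t1 x2 t2.
- move=> z bz; have /andP[h _] := hw z bz.
  have : 0 <= c * (w z - m) by rewrite mulr_ge0 ?subr_ge0 // ltW.
  by clear; lra.
- move=> z bz; have /andP[_ h] := hw z bz.
  have : 0 <= c * (m + om - w z) by rewrite mulr_ge0 ?subr_ge0 // ltW.
  by clear; lra.
- move=> z bz P N hP hN; rewrite !add0r => e.
  by have := pucci_superZ c0 (h1 z bz) hP hN e; lra.
- move=> z bz P N hP hN; rewrite !add0r scaleNr -scalerN => e.
  by have := pucci_superZ c0 (h2 z bz) hP hN e; lra.
- have := ltW w1; rewrite -(ler_pM2l c0) mulrDr dlc; lra.
- have := ltW w2; rewrite -(ler_pM2l c0) mulrBr dlc; lra.
have h4 : c * (om / 4) = 1 by rewrite mulrA com divff.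
move=> a1 a2; have : c * (om / 4) * 1 <= 0; last by rewrite h4; lra.
move: a1 a2 h4 com; clear; nra.
Qed.

End Oscillation.

Lemma close_pair (R : realType) (a b c e m o s : R) : m <= a <= m + o -> m <= b <= m + o ->
  `|a - c| <= s -> `|b - e| <= s -> `|c - e| <= o + 2 * s.
Proof.
rewrite !ler_norml => /andP[? ?] /andP[? ?] /andP[? ?] /andP[? ?].
by apply/andP; split; lra.
Qed.

(** * Hoelder continuity of the time derivative *)

Section TimeDerivativeHolder.
Context {R : realType} {n : nat}.
Variables (lam Lam : R).
Notation pt := ('rV[R]_n * R)%type.
Implicit Types (u w v tau : pt -> R) (g : pt -> 'rV[R]_n) (M H : pt -> 'M[R]_n) (z p q : pt) (x : 'rV[R]_n) (T rho : R).
Hypotheses (lam0 : 0 < lam) (Lam0 : 0 <= Lam).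
Let dr : R := @dens_radius R n.
Let box : set pt := boxT dr 0 4.

(** The image of [box] under the parabolic scaling [to_cyl], with its top at time [T]. *)
Definition cyl (x0 : 'rV[R]_n) (T rho : R) : set pt :=
  [set z : pt | (forall i, `|z.1 0 i - x0 0 i| <= dr * rho) /\ T - 4 * rho ^+ 2 <= z.2 <= T].

Definition to_cyl (x0 : 'rV[R]_n) (T rho : R) z : pt :=
  (x0 + rho *: z.1, T - 4 * rho ^+ 2 + rho ^+ 2 * z.2).

Lemma to_cylP (x0 : 'rV[R]_n) T rho z : 0 <= rho -> box z -> cyl x0 T rho (to_cyl x0 T rho z).
Proof.
move=> r0 [hx /andP[t0 t1]]; have rr := sqr_ge0 rho; split=> [i|] /=.
  rewrite !mxE addrAC subrr add0r normrM (ger0_norm r0) mulrC; apply: ler_wpM2r => //.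
have := ler_wpM2l rr t1; have := mulr_ge0 rr t0.
by move=> *; apply/andP; split; lra.
Qed.

Lemma cyl_pre (x0 : 'rV[R]_n) T rho (b : R) z : 0 < rho ->
  (forall i, `|z.1 0 i - x0 0 i| <= b * rho) -> T - b ^+ 2 * rho ^+ 2 <= z.2 <= T ->
  exists2 z', z = to_cyl x0 T rho z' &
    (forall i, `|z'.1 0 i| <= b) /\ 4 - b ^+ 2 <= z'.2 <= 4.
Proof.
move=> r0 hx /andP[t0 t1]; have r2 : 0 < rho ^+ 2 by rewrite exprn_gt0.
exists (rho^-1 *: (z.1 - x0), (z.2 - T) / rho ^+ 2 + 4).
  rewrite /to_cyl /= scalerA divff ?gt_eqF // scale1r addrC subrK.
  have -> : T - 4 * rho ^+ 2 + rho ^+ 2 * ((z.2 - T) / rho ^+ 2 + 4) = z.2.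
    by field; rewrite gt_eqF.
  by case: (z).
split=> [i|] /=.
  by rewrite !mxE normrM normfV (gtr0_norm r0) mulrC ler_pdivrMr.
have h1 : - b ^+ 2 <= (z.2 - T) / rho ^+ 2 by rewrite ler_pdivlMr //; lra.
have h2 : (z.2 - T) / rho ^+ 2 <= 0 by rewrite ler_pdivrMr // mul0r subr_le0.
by apply/andP; split; lra.
Qed.

Lemma smooth_cyl D w g H tau (x0 : 'rV[R]_n) T rho : 0 <= rho ->
  cyl x0 T rho `<=` D -> smooth D w g H tau ->
  smooth box (fun z => w (to_cyl x0 T rho z)) (fun z => rho *: g (to_cyl x0 T rho z))
    (fun z => rho ^+ 2 *: H (to_cyl x0 T rho z))
    (fun z => rho ^+ 2 * tau (to_cyl x0 T rho z)).
Proof.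
move=> r0 sub sm; apply: (smooth_affine _ sm) => z bz.
by apply: sub; apply: (to_cylP x0 T r0 bz).
Qed.

(** Shrinking by the factor [dr] puts the next cylinder into the image of the inner part
    [|x_i| <= 1], [3 <= t <= 4] of [box]; for the time interval this uses [4 <= dr ^+ 2]. *)
Lemma osc_iter : exists2 gam : R, 0 < gam < 1 & forall D w g H tau,
  smooth D w g H tau ->
  (forall z, D z -> pucci_super lam Lam (H z) (tau z)) ->
  (forall z, D z -> pucci_super lam Lam (- H z) (- tau z)) ->
  forall (x0 : 'rV[R]_n) T rho (m om : R), 0 < rho -> 0 <= om -> cyl x0 T rho `<=` D ->
  (forall z, cyl x0 T rho z -> m <= w z <= m + om) -> forall j,
  exists m', forall z, cyl x0 T (rho * dr ^- j) z -> m' <= w z <= m' + om * gam ^+ j.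
Proof.
have [gam /andP[g0 g1] dec] := @osc_decay R n lam Lam lam0 Lam0.
exists gam; first by rewrite g0.
move=> D w g H tau sm h1 h2 x0 T rho m om r0 om0 sub hw.
have d4 : 4 <= dr := @dens_radius_ge4 R n.
have d0 : 0 < dr by lra.
have rj j : 0 < rho * dr ^- j by rewrite divr_gt0 // exprn_gt0.
have sq (a : R) : 0 <= a ^+ 2 := sqr_ge0 a.
have subj j : cyl x0 T (rho * dr ^- j) `<=` D.
  move=> z [hx /andP[t0 t1]]; apply: sub.
  have le1 : rho * dr ^- j <= rho.
    rewrite ler_piMr ?(ltW r0) // invf_le1 ?exprn_gt0 // exprn_ege1 //; lra.
  have le2 : (rho * dr ^- j) ^+ 2 <= rho ^+ 2 by rewrite ler_pXn2r ?nnegrE ?(ltW r0) ?(ltW (rj j)).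
  split=> [i|]; first by rewrite (le_trans (hx i)) // ler_wpM2l // ltW.
  by rewrite t1 andbT; lra.
elim=> [|j [m' IH]].
  by exists m => z; rewrite expr0 invr1 !mulr1; exact: hw.
set r := rho * dr ^- j; have r0' : 0 < r := rj j.
have [|||m2 hm2] := dec _ _ _ _ (smooth_cyl (ltW r0') (subj j) sm) _ _ m' _
    (mulr_ge0 om0 (exprn_ge0 j (ltW g0))).
- move=> z bz; apply: pucci_superZ; rewrite ?exprn_gt0 //.
  by apply: h1; apply: (subj j); apply: to_cylP => //; exact: ltW.
- move=> z bz; rewrite -scalerN -mulrN; apply: pucci_superZ; rewrite ?exprn_gt0 //.
  by apply: h2; apply: (subj j); apply: to_cylP => //; exact: ltW.
- by move=> z bz; apply: IH; apply: to_cylP => //; exact: ltW.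
exists m2 => z [hx /andP[t0 t1]].
have er : dr * (rho * dr ^- j.+1) = r.
  by rewrite /r exprS; field; rewrite ?expf_neq0 ?gt_eqF //.
rewrite er in hx.
have [||z' -> [x1 t2]] := @cyl_pre x0 T r 1 z r0'.
- by move=> i; rewrite mul1r.
- rewrite t1 andbT expr1n mul1r; apply: le_trans t0; rewrite lerD2l lerN2.
  have -> : r ^+ 2 = dr ^+ 2 * (rho * dr ^- j.+1) ^+ 2 by rewrite -er exprMn.
  have h16 : 4 * 4 <= dr * dr by rewrite ler_pM.
  by apply: ler_wpM2r => //; rewrite expr2; lra.
rewrite exprS mulrCA; apply: hm2 => //.
by move: t2; rewrite expr1n => /andP[? ?]; apply/andP; split; lra.
Qed.

Lemma pucci_diff (F : 'M[R]_n -> R) (M1 M2 : 'M[R]_n) :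
  unif_parabolic lam Lam F -> M2^T = M2 -> pucci_super lam Lam (M1 - M2) (F M1 - F M2).
Proof.
move=> ell sM P N hP hN e; have -> : M1 = M2 + (P - N) by rewrite -e addrC subrK.
exact: elliptic_diff.
Qed.

Definition Qbar (a b : R) : set pt := [set z | enorm z.1 <= a /\ - b <= z.2 <= 0].

Lemma Qbar_sub (a b a' b' : R) : a <= a' -> b <= b' -> Qbar a b `<=` Qbar a' b'.
Proof.
move=> aa bb z [h1 /andP[h2 h3]]; split; first exact: le_trans aa.
by rewrite h3 andbT; apply: le_trans h2; rewrite lerN2.
Qed.

Ltac lran := clear -lam0 Lam0 dr box; intros; lra.

Lemma pdist_coord p q i : `|p.1 0 i - q.1 0 i| <= pdist p q.
Proof.
have := coord_enorm (p.1 - q.1) i; rewrite !mxE => /le_trans; apply.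
by rewrite /pdist lerDl sqrtr_ge0.
Qed.

Lemma pdist_time p q : `|p.2 - q.2| <= pdist p q ^+ 2.
Proof.
rewrite -{1}[`|_|]sqr_sqrtr // ler_pXn2r ?nnegrE ?addr_ge0 ?sqrtr_ge0 ?enorm_ge0 //.
by rewrite /pdist lerDr enorm_ge0.
Qed.

Lemma pdist_ge0 p q : 0 <= pdist p q.
Proof. by rewrite addr_ge0 ?enorm_ge0 ?sqrtr_ge0. Qed.

Lemma pdist_eq0 p q : pdist p q = 0 -> p = q.
Proof.
move=> e; case: p q e => [x t] [y s] e; congr pair.
  by apply/rowP => i; apply/eqP; rewrite -subr_eq0 -normr_le0 -e (pdist_coord (x, t) (y, s)).
by apply/eqP; have := pdist_time (x, t) (y, s); rewrite e expr0n /= normr_le0 subr_eq0.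
Qed.

Lemma pdist_cyl p q (rho : R) : 0 <= rho -> pdist p q <= rho ->
  cyl p.1 (Num.max p.2 q.2) rho p /\ cyl p.1 (Num.max p.2 q.2) rho q.
Proof.
move=> r0 pr; have d4 : 4 <= dr := @dens_radius_ge4 R n.
have rdr : rho <= dr * rho by rewrite ler_peMl //; lra.
have r2 : 0 <= rho ^+ 2 := sqr_ge0 rho.
have pt2 : `|p.2 - q.2| <= rho ^+ 2.
  by apply: le_trans (pdist_time p q) _; rewrite ler_pXn2r // nnegrE pdist_ge0.
move: pt2; rewrite ler_norml => /andP[h1 h2].
have [h3 h4] : p.2 <= Num.max p.2 q.2 /\ q.2 <= Num.max p.2 q.2.
  by rewrite !le_max !lexx orbT.
have h5 : Num.max p.2 q.2 <= p.2 + rho ^+ 2 by rewrite ge_max; apply/andP; split; lra.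
have h6 : Num.max p.2 q.2 <= q.2 + rho ^+ 2 by rewrite ge_max; apply/andP; split; lra.
split; (split=> [i|]; last by [apply/andP; split; lra]).
  by rewrite subrr normr0 (le_trans r0).
by rewrite distrC (le_trans (pdist_coord p q i)) // (le_trans pr).
Qed.

Lemma smoothC_time (K d : R) D u g M v z z' : smoothC K d D u g M v ->
  D z -> D z' -> z'.1 = z.1 -> `|z'.2 - z.2| <= d ->
  `|u z' - u z - v z * (z'.2 - z.2)| <= K * (z'.2 - z.2) ^+ 2.
Proof.
move=> [K0 d0 h] Dz Dz' e td; have := h z z' Dz Dz'; rewrite /= e subrr vn0 => /(_ (ltW d0) td).
move=> [_ + _ _]; rewrite dot0r /qf /bf trmx0 mulmx0 mxE expr0n /= !mul0r !add0r !subr0.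
by [].
Qed.

Lemma quotient_lim (K d : R) D u g M v z (s : R) : smoothC K d D u g M v ->
  D z -> D (z.1, z.2 - s) -> 0 < s -> s <= d ->
  `|s^-1 * u z + - s^-1 * u (z.1, z.2 - s) - v z| <= K * s.
Proof.
move=> sm Dz Ds s0 sd; have e : z.2 - s - z.2 = - s by ring.
have := smoothC_time sm Dz Ds erefl; rewrite /= e normrN gtr0_norm // => /(_ sd).
set a := u _ - u z - _ => ha.
have -> : s^-1 * u z + - s^-1 * u (z.1, z.2 - s) - v z = - a / s.
  by rewrite /a; field; rewrite gt_eqF.
by rewrite normrM normrN normfV (gtr0_norm s0) ler_pdivrMr // -mulrA -expr2 -sqrrN.
Qed.

Lemma quotient_bound D u g M v z (s K : R) : smooth D u g M v ->
  (forall r, z.2 - s <= r <= z.2 -> D (z.1, r)) -> 0 < s ->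
  (forall z, D z -> `|v z| <= K) ->
  `|s^-1 * u z + - s^-1 * u (z.1, z.2 - s)| <= K.
Proof.
case: z => x t /= [K1 [d sm]] Dr s0 vK; have [K10 d0 _] := sm.
have main (c : R) : `|c| = 1 -> c * (u (x, t) - u (x, t - s)) <= K * s.
  move=> c1; have ab : t - s <= t by rewrite gerBl ltW.
  have := @increment_le _ (fun r => c * u (x, r)) (fun r => c * v (x, r)) _ _ K1 d K ab d0 K10.
  rewrite (_ : t - (t - s) = s); last by ring.
  rewrite -mulrBr; apply.
    move=> s1 s2 h1 h12 h2 hd.
    have D1 : D (x, s1) by apply: Dr; rewrite h1 (le_trans h12).
    have D2 : D (x, s2) by apply: Dr; rewrite h2 (le_trans h1).
    have := smoothC_time sm D1 D2 erefl; rewrite /= ger0_norm ?subr_ge0 // => /(_ hd) h.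
    rewrite -lerBlDl -mulrA -!mulrBr; apply: le_trans h.
    by apply: le_trans (ler_norm _) _; rewrite normrM c1 mul1r.
  move=> r hr; apply: le_trans (vK _ (Dr r hr)).
  by apply: le_trans (ler_norm _) _; rewrite normrM c1 mul1r.
have -> : s^-1 * u (x, t) + - s^-1 * u (x, t - s) = (u (x, t) - u (x, t - s)) / s.
  by rewrite mulNr -mulrBr mulrC.
rewrite normrM normfV (gtr0_norm s0) ler_pdivrMr // ler_norml.
by apply/andP; split; [have := main (-1)|have := main 1]; rewrite ?normrN normr1 => /(_ erefl); lra.
Qed.

Lemma cyl_Qbar p q (rho s : R) z : 0 < rho -> 8 * n%:R * (dr * rho) <= 1 -> rho ^+ 2 <= 64^-1 ->
  0 <= s -> s <= 8^-1 -> Qbar (3 / 4) (9 / 16) p -> Qbar (3 / 4) (9 / 16) q ->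
  cyl p.1 (Num.max p.2 q.2) rho z ->
  forall r, z.2 - s <= r <= z.2 -> Qbar (7 / 8) (7 / 8) (z.1, r).
Proof.
move=> rho0 h1 h2 s0 s8 [px /andP[p0 p1]] [_ /andP[q0 q1]] [zx zt] r hr.
have hv : vn (z.1 - p.1) <= n%:R * (dr * rho) by apply: vn_le => i; rewrite !mxE.
have hz : enorm z.1 <= 7 / 8.
  have := enormD p.1 (z.1 - p.1); rewrite addrC subrK => /le_trans; apply.
  have := enorm_vn (z.1 - p.1); lra.
split=> //=; have T1 : Num.max p.2 q.2 <= 0 by rewrite ge_max p1.
have T0 : p.2 <= Num.max p.2 q.2 by rewrite le_max lexx.
by move: zt hr => /andP[? ?] /andP[? ?]; apply/andP; split; lra.
Qed.

(* The difference quotients of [u] in time solve a linear equation with bounded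
   coefficients, hence their oscillation decays geometrically. *)
Lemma time_derivative_holder : exists2 beta : R, 0 < beta & exists2 C : R, 0 <= C &
  forall F u g M v (K : R), unif_parabolic lam Lam F ->
  smooth (Qbar (7 / 8) (7 / 8)) u g M v ->
  (forall z, Qbar (7 / 8) (7 / 8) z -> F (M z) = v z) ->
  0 <= K -> (forall z, Qbar (7 / 8) (7 / 8) z -> `|v z| <= K) ->
  forall p q, Qbar (3 / 4) (9 / 16) p -> Qbar (3 / 4) (9 / 16) q ->
    `|v p - v q| <= K * C * pdist p q `^ beta.
Proof.
have d4 : 4 <= dr := @dens_radius_ge4 R n.
have [gam gam01 osc] := osc_iter; have /andP[g0 g1] := gam01.
have dr1 : 1 < dr by lra.
have [beta b0 dec] := decay_holder gam01 dr1.
exists beta => //; have n0 : 0 <= n%:R :> R by [].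
(* So small that cylinders of this size about points of [Qbar (3 / 4) (9 / 16)], moved back in time
   by at most 1/8, stay in [Qbar (7 / 8) (7 / 8)]. *)
pose rho := (8 * (n%:R + 1) * dr)^-1.
have den : 0 < 8 * (n%:R + 1) * dr by rewrite !mulr_gt0 //; lra.
have rho0 : 0 < rho by rewrite invr_gt0.
have drho : 8 * (n%:R + 1) * (dr * rho) = 1 by rewrite mulrA divff // gt_eqF.
exists (2 / gam * (rho^-1) `^ beta).
  by rewrite mulr_ge0 ?powR_ge0 // divr_ge0 // ltW.
move=> F u g M v K ell sm eqF K0 vK p q Dp Dq.
set D7 := Qbar (7 / 8) (7 / 8) in sm eqF vK.
have sub37 z : Qbar (3 / 4) (9 / 16) z -> D7 z.
  by apply: Qbar_sub; lran.
have [e|r0] := eqVneq (pdist p q) 0.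
  by rewrite (pdist_eq0 e) subrr normr0 mulr_ge0 ?powR_ge0 // !mulr_ge0 ?powR_ge0 ?invr_ge0 ?(ltW g0).
have {}r0 : 0 < pdist p q by rewrite lt_def r0 pdist_ge0.
have vpq : `|v p - v q| <= 2 * K.
  by have := vK p (sub37 p Dp); have := vK q (sub37 q Dq); have := ler_normB (v p) (v q); lran.
suff key j : pdist p q <= rho * dr ^- j -> `|v p - v q| <= 2 * K * gam ^+ j.
  have := dec rho (2 * K) _ _ rho0 (mulr_ge0 _ K0) r0 vpq key.
  move=> /(_ ltac:(by [])) /le_trans; apply.
  rewrite powRM ?invr_ge0 ?(ltW rho0) ?(ltW r0) ?(ltW den) //.
  move: (pdist p q `^ beta) (rho^-1 `^ beta) => A B.
  have e (G : R) : 2 * K * G * (A * B) = K * (2 * G * B) * A by ring.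
  by rewrite e.
move=> hj; set T := Num.max p.2 q.2.
have rj : 0 < rho * dr ^- j by rewrite divr_gt0 // exprn_gt0 //; lra.
have [cp cq] := pdist_cyl (ltW rj) hj; rewrite -/T in cp cq.
have [K1 [d smC]] := sm; have [K10 d0 _] := smC.
have h1 : 8 * n%:R * (dr * rho) <= 1.
  have dr0 : 0 <= dr * rho by rewrite mulr_ge0 ?(ltW rho0) //; lra.
  by move: drho; rewrite mulrDr mulr1 mulrDl => e; lra.
have h2 : rho ^+ 2 <= 64^-1.
  have h8 : rho <= 8^-1 by rewrite lef_pV2 ?posrE // -mulrA ler_peMr // mulr_ege1 //; move: d4 n0; lran.
  by have := ler_pM (ltW rho0) (ltW rho0) h8 h8; rewrite expr2; lran.
clearbody rho.
have hj1 : pdist p q <= rho.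
  by apply: le_trans hj _; rewrite ler_piMr ?(ltW rho0) // invf_le1 ?exprn_gt0 ?exprn_ege1 //; move: dr1; lran.
have [cp1 cq1] := pdist_cyl (ltW rho0) hj1; rewrite -/T in cp1 cq1.
(* The decay is applied to the difference quotient with step [s], which is within [K1 * s] of [v];
   the constant [K1], which depends on [u], disappears as [s] tends to 0. *)
rewrite -subr_ge0; apply: (@ge0_of_small _ _ (2 * K1) (Num.min d 8^-1)).
  by rewrite lt_min d0 /= invr_gt0 ltr0n.
move=> s s0; rewrite le_min => /andP[sd s8].
pose sh z : pt := (0 + 1 *: z.1, - s + 1 * z.2).
have shE z : sh z = (z.1, z.2 - s) by rewrite /sh add0r scale1r mul1r addrC.
pose Ds : set pt := [set z | D7 z /\ D7 (sh z)].
have seg z : cyl p.1 T rho z -> forall r, z.2 - s <= r <= z.2 -> D7 (z.1, r).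
  exact: (cyl_Qbar rho0 h1 h2 (ltW s0) s8 Dp Dq).
have sub : cyl p.1 T rho `<=` Ds.
  move=> z hz; split; last by rewrite shE; apply: (seg z hz); rewrite lexx gerBl ltW.
  by case: z hz => x t hz; apply: (seg _ hz); rewrite lexx gerBl ltW.
pose w z := s^-1 * u z + - s^-1 * u (sh z).
have smw := smoothD (smoothZ s^-1 (smooth_sub (fun z (h : Ds z) => proj1 h) sm))
    (smoothZ (- s^-1) (smooth_affine (fun z (h : Ds z) => proj2 h) sm)).
have scal (c : R) (A B : 'M[R]_n) : c *: A + (- c) *: (1 ^+ 2 *: B) = c *: (A - B).
  by rewrite expr1n scale1r scaleNr scalerBr.
have scal' (c a b : R) : c * a + - c * (1 * b) = c * (a - b) by ring.
have symM z : D7 z -> (M z)^T = M z := smooth_sym sm.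
have si0 : 0 < s^-1 by rewrite invr_gt0.
have [||z Dz|m' hm'] := osc _ _ _ _ _ smw _ _ p.1 T rho (- K) (2 * K) rho0 (mulr_ge0 (ler0n R 2) K0) sub _ j => //.
- move=> z [Dz Dsz]; rewrite scal scal'; apply: pucci_superZ => //.
  by rewrite -!eqF //; apply: pucci_diff => //; exact: symM.
- move=> z [Dz Dsz]; rewrite scal scal' -scalerN -mulrN !opprB; apply: pucci_superZ => //.
  by rewrite -!eqF //; apply: pucci_diff => //; exact: symM.
- have := quotient_bound sm (seg z Dz) s0 vK; rewrite -/(sh z) shE.
  by rewrite (_ : - K + 2 * K = K) ?ler_norml; last ring.
have lim z : cyl p.1 T rho z -> `|w z - v z| <= K1 * s.
  move=> cz; have [Dz Dsz] := sub z cz.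
  by rewrite /w; move: Dsz; rewrite shE => Dsz; apply: (quotient_lim smC).
have := close_pair (hm' p cp) (hm' q cq) (lim p cp1) (lim q cq1).
by rewrite (mulrC s) -(mulrA 2 K1) lerBrDr -lerBrDl opprK.
Qed.

End TimeDerivativeHolder.

(** * Second differences and their one-sided equation *)

Section SecondDifferences.
Context {R : realType} {n : nat}.
Notation pt := ('rV[R]_n * R)%type.
Implicit Types (D : set pt) (u w v tau : pt -> R) (g : pt -> 'rV[R]_n) (M H : pt -> 'M[R]_n)
  (z : pt) (b y : 'rV[R]_n).

Definition xshift z y : pt := (z.1 + y, z.2).

(** Two integrations along the line: the bound [Q] controls the difference of the directional
    derivatives at opposite points, which is the derivative in [h] of the symmetric second
    difference. *)
Lemma second_difference_le D u g M v z b (h Q : R) : smooth D u g M v -> 0 <= h ->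
  (forall r, `|r| <= h -> D (xshift z (r *: b)) /\ qf (M (xshift z (r *: b))) b <= Q) ->
  u (xshift z (h *: b)) + u (xshift z (- h *: b)) - 2 * u z <= Q * h ^+ 2.
Proof.
move=> [K [d [K0 d0 hK]]] h0 hr; set p := fun r : R => xshift z (r *: b).
have c0 := vn_ge0 b; pose c := vn b + 1; have c1 : 0 < c by rewrite ltr_wpDl.
have dp r1 r2 : (p r2).1 - (p r1).1 = (r2 - r1) *: b.
  by rewrite /p /xshift /= opprD addrACA subrr add0r scalerBl.
have vd r1 r2 : `|r2 - r1| <= d / c -> vn ((r2 - r1) *: b) <= d.
  move=> h1; rewrite vnZ; apply: le_trans (_ : d / c * vn b <= d); first exact: ler_wpM2r.
  by rewrite mulrAC ler_pdivrMr // ler_pM2l // lerDl.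
have near r1 r2 : `|r1| <= h -> `|r2| <= h -> `|r2 - r1| <= d / c ->
    `|u (p r2) - u (p r1) - (r2 - r1) * dot (g (p r1)) b - (r2 - r1) ^+ 2 * qf (M (p r1)) b / 2|
      <= K * (`|r2 - r1| * vn b) ^+ 3 /\
    `|dot (g (p r2)) b - dot (g (p r1)) b - (r2 - r1) * qf (M (p r1)) b|
      <= K * (`|r2 - r1| * vn b) ^+ 2 * vn b.
  move=> h1 h2 h3; have [D1 _] := hr _ h1; have [D2 _] := hr _ h2.
  have := hK (p r1) (p r2) D1 D2; rewrite dp /= subrr normr0.
  move=> /(_ (vd _ _ h3) (ltW d0))[_ + + _].
  rewrite !mulr0 expr0n /= !addr0 subr0 vnZ dotZr qfZ => e1 e2; split => //.
  apply: le_trans (ler_wpM2r c0 e2); apply: le_trans (dot_le _ _).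
  by rewrite !dotDl !dotNl -bf_dot bfZl.
have dc : 0 < d / c by rewrite divr_gt0.
have hrQ r : `|r| <= h -> qf (M (p r)) b <= Q by move=> /hr[].
have grad r : 0 <= r -> r <= h -> dot (g (p r)) b - dot (g (p (- r))) b <= Q * (2 * r).
  move=> r0 rh; have -> : 2 * r = r - - r by ring.
  have C0 : 0 <= K * vn b ^+ 3 by rewrite mulr_ge0 // exprn_ge0.
  apply: (@increment_le _ (fun s => dot (g (p s)) b) (fun s => qf (M (p s)) b) _ _ _ _ _ _ dc C0).
  - lra.
  - move=> s1 s2 a1 a12 a2 ds.
    have h1 : `|s1| <= h.
      by rewrite ler_norml; apply/andP; split; move: a1 a12 a2 rh; clear; lra.
    have h2 : `|s2| <= h.
      by rewrite ler_norml; apply/andP; split; move: a1 a12 a2 rh; clear; lra.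
    have q0 : 0 <= s2 - s1 by rewrite subr_ge0.
    have [] := near s1 s2 h1 h2; first by rewrite ger0_norm.
    rewrite (ger0_norm q0) => _; rewrite ler_norml => /andP[_].
    rewrite (_ : K * _ ^+ 2 * _ = K * vn b ^+ 3 * (s2 - s1) ^+ 2); last by ring.
    by rewrite (mulrC (s2 - s1)) => h3; move: (qf _ _ * _) (K * _ * _) h3; clear; intros; lra.
  - move=> s /andP[s1 s2]; apply: hrQ; rewrite ler_norml; apply/andP.
    by split; move: s1 s2 rh; clear; lra.
pose f r := u (p r) + u (p (- r)) - Q * r ^+ 2.
pose f' r := dot (g (p r)) b - dot (g (p (- r))) b - Q * (2 * r).
have [C C0 hC] : exists2 C : R, 0 <= C & forall r s : R, 0 <= r -> r <= s -> s <= h -> s - r <= d / c ->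
   f s - f r <= f' r * (s - r) + C * (s - r) ^+ 2.
  exists (2 * (K * vn b ^+ 3) * (d / c)).
    by rewrite mulr_ge0 ?(ltW dc) // mulr_ge0 // mulr_ge0 // exprn_ge0.
  move=> r s r0 rs sh ds; have q0 : 0 <= s - r by rewrite subr_ge0.
  have h1 : `|r| <= h by rewrite ger0_norm // (le_trans rs).
  have h2 : `|s| <= h by rewrite ger0_norm // (le_trans r0).
  have [] := near r s h1 h2; first by rewrite ger0_norm.
  have eN : - s - - r = - (s - r) by ring.
  have [] := near (- r) (- s); rewrite ?normrN // eN ?normrN ?(ger0_norm q0) //.
  rewrite sqrrN => e1 _ e2 _.
  move: e1 e2; rewrite !ler_norml => /andP[_ e1] /andP[_ e2].
  have Q1 := hrQ r h1; have Q2 := hrQ (- r) ltac:(by rewrite normrN).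
  have Q3 : (s - r) ^+ 2 * (qf (M (p r)) b + qf (M (p (- r))) b) <= (s - r) ^+ 2 * (2 * Q).
    by apply: ler_wpM2l; [exact: sqr_ge0|move: Q1 Q2; clear; lra].
  have Q4 : K * ((s - r) * vn b) ^+ 3 <= (K * vn b ^+ 3) * (d / c) * (s - r) ^+ 2.
    have -> : K * ((s - r) * vn b) ^+ 3 = K * vn b ^+ 3 * (s - r) * (s - r) ^+ 2 by ring.
    by apply: ler_wpM2r; [exact: sqr_ge0|apply: ler_wpM2l => //; rewrite mulr_ge0 // exprn_ge0].
  have e3 : s ^+ 2 = r ^+ 2 + 2 * r * (s - r) + (s - r) ^+ 2 by ring.
  rewrite /f /f' e3; move: e1 e2 Q3 Q4; rewrite mulrDr.
  move: (u (p s)) (u (p r)) (u (p (- s))) (u (p (- r))) (K * (_ * _) ^+ 3) => a1 a2 a3 a4 T.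
  move: (qf _ _) (qf _ _) (dot _ _) (dot _ _) (K * vn b ^+ 3) (d / c); clear; intros; lra.
have := @increment_le _ f f' 0 h C (d / c) 0 h0 dc C0 hC _.
rewrite mul0r subr_le0; have -> : f 0 = 2 * u z.
  rewrite /f /p /xshift oppr0 scale0r addr0 expr0n mulr0 subr0 /=; case: (z) => x t /=; ring.
have -> : u (xshift z (h *: b)) + u (xshift z (- h *: b)) = f h + Q * h ^+ 2.
  by rewrite /f subrK.
move=> hh; have : f h <= 2 * u z; last by lra.
by apply: hh => r /andP[r0 rh]; rewrite /f' subr_le0 grad.
Qed.

Lemma second_difference D u g M v z b (h e : R) : smooth D u g M v -> 0 < h ->
  (forall r, `|r| <= h -> D (xshift z (r *: b)) /\
     `|qf (M (xshift z (r *: b))) b - qf (M z) b| <= e) ->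
  `|h ^- 2 * (u (xshift z (h *: b)) + u (xshift z (- h *: b)) - 2 * u z) - qf (M z) b| <= e.
Proof.
move=> sm h0 hr; have h2 : 0 < h ^+ 2 by rewrite exprn_gt0.
have [r hrr|r hrr|] := (@second_difference_le _ _ _ _ _ z b h (qf (M z) b + e) sm (ltW h0) _,
  @second_difference_le _ _ _ _ _ z b h (- qf (M z) b + e) (smoothZ (-1) sm) (ltW h0) _).
- by have [Dr] := hr r hrr; rewrite ler_norml => /andP[_]; split => //; lra.
- by have [Dr] := hr r hrr; rewrite qfZm ler_norml => /andP[]; split => //; lra.
set a := u _ + u _; rewrite -!mulrDr -/a => e2 e1.
have e3 : h ^- 2 * (a - 2 * u z) <= qf (M z) b + e.
  by rewrite mulrC ler_pdivrMr.
have e4 : - (h ^- 2 * (a - 2 * u z)) <= - qf (M z) b + e.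
  rewrite -mulrN mulrC ler_pdivrMr //.
  by apply: le_trans e1; apply: eq_imp_le; ring.
by rewrite ler_norml; apply/andP; split; lra.
Qed.

Definition diff_sum (J : finType) (y : J -> 'rV[R]_n) (c : R) (f : pt -> R) z : R :=
  c * \sum_j (f (xshift z (y j)) - f z).

Lemma smooth_diff_sum D u g M v (J : finType) (y : J -> 'rV[R]_n) (c : R) : smooth D u g M v ->
  smooth [set z | D z /\ forall j, D (xshift z (y j))] (diff_sum y c u)
    (fun z => c *: \sum_j (g (xshift z (y j)) - g z))
    (fun z => c *: \sum_j (M (xshift z (y j)) - M z)) (diff_sum y c v).
Proof.
move=> sm; set D' := [set z | _].
apply: smoothZ; apply: (smooth_sum _ (w := fun j z => u (xshift z (y j)) - u z)) => j.
have shE z : (y j + 1 *: z.1, 0 + 1 * z.2) = xshift z (y j).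
  by rewrite /xshift scale1r mul1r add0r addrC.
have sub z : D' z -> D (y j + 1 *: z.1, 0 + 1 * z.2) by rewrite shE => -[_ ]; apply.
have sub' : D' `<=` D by move=> z [].
have := smoothD (smooth_affine sub sm) (smoothZ (-1) (smooth_sub sub' sm)).
congr smooth; apply/funext => z; rewrite shE.
- by rewrite mulN1r.
- by rewrite scale1r scaleN1r.
- by rewrite expr1n scale1r scaleN1r.
- by rewrite mul1r mulN1r.
Qed.

(** The matrices [M j] may lie below the level [F M0] by [E]; adding [E / lam] times the identity
    lifts them all to it. Quasiconcavity then puts their average at this level too, and comparing
    the average with [M0] by ellipticity gives the inequality. The lift costs the term with
    [Lam / lam], the sum of the differences [F (M j) - F M0] the term with 1. *)
Lemma diff_sum_super (lam Lam E c : R) (F : 'M[R]_n -> R) (J : finType) (M0 : 'M[R]_n)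
    (M : J -> 'M[R]_n) :
  0 < lam -> lam <= Lam -> (0 < n)%N -> 0 < c -> (0 < #|J|)%N -> 0 <= E ->
  unif_parabolic lam Lam F -> quasiconcave F ->
  M0^T = M0 -> (forall j, (M j)^T = M j) -> (forall j, `|F (M j) - F M0| <= E) ->
  pucci_super lam Lam (- (c *: \sum_j (M j - M0)))
    (- (c * \sum_j (F (M j) - F M0)) + c * #|J|%:R * E * (1 + n%:R * (Lam / lam))).
Proof.
move=> lam0 lamL n0 c0 J0 E0 ell qc s0 sM hE P N hP hN eq1.
have nR : 1 <= n%:R :> R by rewrite ler1n.
have mR : 0 < #|J|%:R :> R by rewrite ltr0n.
have Lam0 : 0 < Lam by lra.
pose s := E / lam; have s_ge0 : 0 <= s by rewrite divr_ge0 // ltW.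
have sI : psd (s *: 1%:M : 'M[R]_n) := psdZ s_ge0 psd1.
pose M' j := M j + s *: 1%:M.
have sM' j : (M' j)^T = M' j by rewrite linearD /= linearZ /= trmx1 sM.
have FM' j : F M0 <= F (M' j).
  have /andP[h1 _] := elliptic_psd lam0 ell (sM j) sI.
  have := hE j; rewrite ler_norml => /andP[h2 _].
  move: h1; rewrite mxtraceZ mxtrace1 mulrA (_ : lam * s = E); last by rewrite mulrC divfK ?gt_eqF.
  have : E * 1 <= E * n%:R by rewrite ler_wpM2l.
  by rewrite /M' mulr1; lra.
have szJ : size (index_enum J) = #|J| by rewrite -sum1_size sum1_card.
have enJ : index_enum J != [::] by rewrite -size_eq0 szJ -lt0n.
have := quasiconcave_sum qc enJ sM' FM'; rewrite szJ.
set m : R := #|J|%:R in mR *; set X := _^-1 *: _ => FX.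
pose P2 := (c * m)^-1 *: P; pose N2 := (c * m)^-1 *: N + s *: 1%:M.
have cm0 : 0 < c * m by rewrite mulr_gt0.
have cmi : 0 <= (c * m)^-1 by rewrite invr_ge0 ltW.
have hP2 : psd P2 := psdZ cmi hP; have hN2 : psd N2 := psdD (psdZ cmi hN) sI.
have eX : X = M0 - (P2 - N2).
  have -> : P2 - N2 = - (s *: 1%:M) - (c * m)^-1 *: (c *: \sum_j (M j - M0)).
    by rewrite /P2 /N2 opprD addrA -scalerBr -eq1 scalerN addrC.
  rewrite /X /M' big_split /= sumrB !sumr_const -[_ *+ #|J|]scaler_nat -/m.
  rewrite -[_ *+ #|J|]scaler_nat -/m (scalerA (c * m)^-1 c) (_ : (c * m)^-1 * c = m^-1); last first.
    by field; rewrite !gt_eqF.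
  move: (\sum_i M i) => S; apply/matrixP => i j; rewrite !mxE.
  by field; rewrite gt_eqF.
have sX : X^T = X by rewrite eX !linearB /= s0 (psd_sym hP2) (psd_sym hN2).
have := elliptic_diff lam0 ell sX hP2 hN2; rewrite {1}eX subrK.
rewrite mxtraceD !mxtraceZ mxtrace1 => h.
have h1 : lam * ((c * m)^-1 * \tr P) - Lam * ((c * m)^-1 * \tr N + s * n%:R) <= 0 by lra.
have h2 : (c * m) * (lam * ((c * m)^-1 * \tr P) - Lam * ((c * m)^-1 * \tr N + s * n%:R)) <= 0.
  by rewrite pmulr_rle0.
have e2 : (c * m) * (lam * ((c * m)^-1 * \tr P) - Lam * ((c * m)^-1 * \tr N + s * n%:R)) =
    lam * \tr P - Lam * \tr N - c * m * E * (n%:R * (Lam / lam)).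
  by rewrite /s; field; rewrite !gt_eqF.
have h3 : c * (\sum_j (F (M j) - F M0)) <= c * (m * E).
  rewrite ler_pM2l //; apply: le_trans (_ : \sum_(j : J) E <= _).
    by apply: ler_sum => j _; apply: le_trans (ler_norm _) (hE j).
  by rewrite sumr_const mulr_natl.
by move: h2; rewrite e2; lra.
Qed.

End SecondDifferences.

(** * Traces against projections control the Hessian *)

Section HessianDecay.
Context {R : realType} {n : nat}.
Notation pt := ('rV[R]_n * R)%type.
Implicit Types (D : set pt) (u w v tau : pt -> R) (g : pt -> 'rV[R]_n) (M H : pt -> 'M[R]_n)
  (z p q : pt) (b y : 'rV[R]_n) (B N P : 'M[R]_n).
Let dr : R := @dens_radius R n.

Definition projection B : Prop := B^T = B /\ B *m B = B.

Lemma psd_qf_le P b : psd P -> qf P b <= \tr P * dot b b.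
Proof.
move=> /psd_sum_outer[s ->]; elim: s => [|c s IH].
  by rewrite big_nil mxtrace0 mul0r /qf /bf mulmx0 mul0mx mxE.
rewrite big_cons qfDm mxtraceD mulrDl lerD // qf_outer trace_outer -!enorm_sqr -exprMn.
rewrite -real_normK ?num_real // ler_pXn2r ?nnegrE ?mulr_ge0 ?enorm_ge0 //.
rewrite mulrC ler_norml; apply/andP; split; last exact: cauchy_schwarz.
by rewrite lerNl -dotNl -(enormN b) cauchy_schwarz.
Qed.

(** One projection attains the trace of the positive part and its complement that of the negative
    part, so bounds tested on projections control the whole matrix. *)
Lemma projection_split N (e : R) : N^T = N ->
  (forall B, projection B -> \tr (B *m N) <= e) ->
  (forall B, projection B -> \tr (B *m (- N)) <= e) ->
  exists P P', [/\ psd P, psd P', N = P - P', \tr P <= e & \tr P' <= e].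
Proof.
move=> sN h1 h2; have [P [P' [B [[hP hP'] eN sB BB tB]]]] := spectral_split sN.
exists P, P'; split => //; first by rewrite -tB; apply: h1.
have := h2 _ (projectionC sB BB).
rewrite mulmxN mulmxBl mul1mx opprB linearB /= tB eN linearB /= opprB addrC subrK.
by [].
Qed.

Lemma projection_qf N b (e : R) : N^T = N -> dot b b <= 1 ->
  (forall B, projection B -> \tr (B *m N) <= e) ->
  (forall B, projection B -> \tr (B *m (- N)) <= e) -> `|qf N b| <= e.
Proof.
move=> sN b1 h1 h2; have [P [P' [hP hP' -> t1 t2]]] := projection_split sN h1 h2.
have le1 Q : psd Q -> \tr Q <= e -> 0 <= qf Q b <= e.
  move=> hQ tQ; rewrite psd_ge0 //=; apply: le_trans (psd_qf_le b hQ) _.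
  by apply: le_trans tQ; rewrite ler_piMr // psd_tr.
have /andP[a1 a2] := le1 _ hP t1; have /andP[b2 b3] := le1 _ hP' t2.
by rewrite qfDm qfNm ler_norml; apply/andP; split; lra.
Qed.

Lemma projection_entry N i j (e : R) : N^T = N ->
  (forall B, projection B -> \tr (B *m N) <= e) ->
  (forall B, projection B -> \tr (B *m (- N)) <= e) -> `|N i j| <= 2 * e.
Proof.
move=> sN h1 h2; have [P [P' [hP hP' -> t1 t2]]] := projection_split sN h1 h2.
have := psd_entry i j hP; have := psd_entry i j hP'; rewrite !mxE.
by have := ler_normB (P i j) (P' i j); lra.
Qed.

Lemma pucci_super_mono (lam Lam : R) (H : 'M[R]_n) (a b : R) : a <= b ->
  pucci_super lam Lam H a -> pucci_super lam Lam H b.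
Proof. by move=> ab h P N hP hN e; apply: le_trans ab; apply: h. Qed.

(* The projection [B = \sum_i (row i B)^T *m row i B] gives [tr (B D^2 u)] as a
   sum of pure second derivatives. *)
Definition proj_diff B (h : R) u z : R :=
  diff_sum (fun k : 'I_n * bool => (if k.2 then h else - h) *: row k.1 B) (h ^- 2) u z.

(** The rows of a projection have length at most 1, so every second difference sees only points
    within [h] of [z], where [projection_qf] turns the trace bounds into bounds for directional
    second derivatives. *)
Lemma proj_diff_approx D u g M v B (h e : R) z : projection B -> smooth D u g M v -> 0 < h ->
  (forall y, enorm y <= h -> D (xshift z y)) ->
  (forall y B', enorm y <= h -> projection B' ->
     \tr (B' *m (M (xshift z y) - M z)) <= e /\ \tr (B' *m (M z - M (xshift z y))) <= e) ->
  `|proj_diff B h u z - \tr (B *m M z)| <= n%:R * e.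
Proof.
move=> [sB BB] sm h0 hD hM.
have e0 : enorm (0 : 'rV[R]_n) = 0 by rewrite -(scale0r 0) enormZ normr0 mul0r.
have Dz : D z by have := hD 0; rewrite e0 /xshift addr0 -surjective_pairing; apply; exact: ltW.
rewrite tr_projection // /proj_diff /diff_sum.
rewrite -(pair_big xpredT xpredT (fun i (k : bool) => u (xshift z ((if k then h else - h) *: row i B)) - u z)) /=.
rewrite mulr_sumr -sumrB; apply: le_trans (ler_norm_sum _ _ _) _.
rewrite mulr_natl -[n in _ *+ n]card_ord -sumr_const; apply: ler_sum => i _.
rewrite big_bool /=.
rewrite (_ : _ - _ + (_ - _) = u (xshift z (h *: row i B)) + u (xshift z (- h *: row i B)) - 2 * u z); last by ring.
apply: (second_difference sm h0) => r hr.
have b1 := projection_row_dot i sB BB.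
have er : enorm (r *: row i B) <= h.
  rewrite enormZ; apply: le_trans hr; rewrite ler_piMr //.
  by rewrite -(ler_pXn2r (n := 2)) ?nnegrE ?enorm_ge0 // enorm_sqr expr1n.
have Dy := hD _ er; split => //; rewrite -qfNm -qfDm; apply: projection_qf => //.
- by rewrite linearB /= (smooth_sym sm Dz) (smooth_sym sm Dy).
- by move=> B' hB'; have [] := hM _ _ er hB'.
- by move=> B' hB'; have [_] := hM _ _ er hB'; rewrite opprB.
Qed.

End HessianDecay.

(** [P] and [P'] are the traces of the positive and negative parts, [t] that of the [B] component.
    With [c = lam / Lam] the bounds give [P >= 7/8 th] and [P' <= 15/32 c th], so that
    [lam P - Lam P'] is at least [13/32 lam th], more than [lam th / 4 >= e1 th]. *)
Lemma oscillation_arith (R : realType) (lam Lam th e1 eta P P' t : R) :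
  0 < lam -> lam <= Lam -> 0 < th -> 4 * e1 <= lam -> 0 <= eta -> 32 * eta <= lam / Lam ->
  P <= (1 + eta) * th -> t <= P -> (1 - lam / Lam / 8) * th <= t ->
  lam * P - Lam * P' <= e1 * th ->
  - (2 * (lam / Lam / 8) + 2 * eta) * th <= P - P' - t -> False.
Proof.
move=> l0 lL th0 he eta0 hc h1 h2 h3 h4 h5; have L0 : 0 < Lam by lra.
set c := lam / Lam in hc h3 h5; have cL : lam = c * Lam by rewrite /c divfK ?gt_eqF.
have c0 : 0 < c by rewrite divr_gt0.
have c1 : c <= 1 by rewrite /c ler_pdivrMr // mul1r.
have P'le : P' <= (3 * (c / 8) + 3 * eta) * th by lra.
have Pge : (1 - c / 8) * th <= P by lra.
have P'le2 : P' <= 15 / 32 * (c * th).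
  by apply: le_trans P'le _; have := ler_wpM2r (ltW th0) hc; lra.
have cth : c * th <= th by rewrite ler_piMl // ltW.
have Pge2 : 7 / 8 * th <= P by lra.
have k1 := ler_wpM2l (ltW l0) Pge2; have k2 := ler_wpM2l (ltW L0) P'le2.
have k3 := ler_wpM2r (ltW th0) he; have k4 := mulr_gt0 l0 th0.
have k5 : Lam * (15 / 32 * (c * th)) = 15 / 32 * (lam * th) by rewrite cL; ring.
rewrite k5 in k2; lra.
Qed.

Lemma pigeonhole_increment (R : realType) (S : nat -> R) (J : nat) (e : R) :
  S J - S 0 < J%:R * e -> exists2 j, (j < J)%N & S j.+1 - S j < e.
Proof.
move=> h; apply: contrapT => hn; move: h; apply/negP; rewrite -leNgt.
rewrite -(telescope_sumr _ (leq0n J)) big_mkord -[J in J%:R]card_ord -sumr_const mulr_suml.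
by apply: ler_sum => j _; rewrite mul1r leNgt; apply/negP => lt; apply: hn; exists j.
Qed.

(** * Regions and the supersolution property of projected differences *)

Section HessianCore.
Context {R : realType} {n : nat}.
Notation pt := ('rV[R]_n * R)%type.
Implicit Types (D : set pt) (u w v tau : pt -> R) (g : pt -> 'rV[R]_n) (M H : pt -> 'M[R]_n)
  (z p q : pt) (b y : 'rV[R]_n) (B N P : 'M[R]_n).
Let dr : R := @dens_radius R n.
Variables (lam Lam : R).
Hypotheses (lam0 : 0 < lam) (lamL : lam <= Lam) (n0 : (0 < n)%N).

Lemma proj_diff_super F D u g M v B (h E : R) z : projection B -> smooth D u g M v -> 0 < h ->
  0 <= E -> unif_parabolic lam Lam F -> quasiconcave F -> (forall z, D z -> F (M z) = v z) ->
  (forall y, enorm y <= h -> D (xshift z y) /\ `|v (xshift z y) - v z| <= E) ->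
  pucci_super lam Lam
    (- (h ^- 2 *: \sum_(k : 'I_n * bool)
         (M (xshift z ((if k.2 then h else - h) *: row k.1 B)) - M z)))
    (- proj_diff B h v z + h ^- 2 * (n * 2)%:R * E * (1 + n%:R * (Lam / lam))).
Proof.
move=> [sB BB] sm h0 E0 ell qc eqF hD.
have e0 : enorm (0 : 'rV[R]_n) = 0 by rewrite -(scale0r 0) enormZ normr0 mul0r.
have [Dz _] : D z /\ `|v z - v z| <= E.
  by have := hD 0; rewrite e0 /xshift addr0 -surjective_pairing; apply; exact: ltW.
have hk (k : 'I_n * bool) : enorm ((if k.2 then h else - h) *: row k.1 B) <= h.
  rewrite enormZ (_ : `|_| = h); last by case: k.2; rewrite ?normrN gtr0_norm.
  rewrite ler_piMr ?(ltW h0) // -(ler_pXn2r (n := 2)) ?nnegrE ?enorm_ge0 // enorm_sqr expr1n.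
  exact: projection_row_dot.
have cardJ : #|{: 'I_n * bool}| = (n * 2)%N by rewrite card_prod card_ord card_bool.
have := @diff_sum_super R n lam Lam E (h ^- 2) F _ (M z)
  (fun k : 'I_n * bool => M (xshift z ((if k.2 then h else - h) *: row k.1 B))).
rewrite cardJ; have -> : \sum_(k : 'I_n * bool)
    (F (M (xshift z ((if k.2 then h else - h) *: row k.1 B))) - F (M z)) =
  \sum_(k : 'I_n * bool) (v (xshift z ((if k.2 then h else - h) *: row k.1 B)) - v z).
  by apply: eq_bigr => k _; have [Dk _] := hD _ (hk k); rewrite !eqF.
apply => //.
- by rewrite invr_gt0 exprn_gt0.
- by rewrite muln_gt0 n0.
- exact: (smooth_sym sm).
- by move=> k; apply: (smooth_sym sm); have [] := hD _ (hk k).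
- by move=> k; have [Dk hv] := hD _ (hk k); rewrite !eqF.
Qed.

Definition Reg p (L : R) : set pt := [set z | z.2 <= 0 /\ pdist z p <= L].

Lemma cyl_Reg p q (rho : R) z : p.2 <= 0 -> q.2 <= 0 -> pdist p q <= rho ->
  cyl p.1 (Num.max p.2 q.2) rho z -> Reg p ((n%:R * dr + 2) * rho) z.
Proof.
move=> p0 q0 pr [zx /andP[t0 t1]]; set T := Num.max _ _ in t0 t1.
have T0 : T <= 0 by rewrite ge_max p0.
split; first exact: le_trans T0.
have r0 : 0 <= rho := le_trans (pdist_ge0 p q) pr.
have [_ /andP[p1 p2]] := (pdist_cyl r0 pr).1.
rewrite /pdist mulrDl; apply: lerD.
  by apply: le_trans (enorm_vn _) _; rewrite -mulrA; apply: vn_le => i; rewrite !mxE.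
rewrite -(ler_pXn2r (n := 2)) ?nnegrE ?sqrtr_ge0 ?mulr_ge0 // sqr_sqrtr // exprMn.
by rewrite ler_norml -/T in p1 p2 *; apply/andP; split; lra.
Qed.

Lemma xshift_pdist z y : pdist (xshift z y) z = enorm y.
Proof. by rewrite /pdist /xshift /= addrAC subrr add0r subrr normr0 sqrtr0 addr0. Qed.

Lemma pdist_triangle p q z : pdist p z <= pdist p q + pdist q z.
Proof.
rewrite /pdist addrACA; apply: lerD.
  by have := enormD (p.1 - q.1) (q.1 - z.1); rewrite addrA subrK.
have tri (a b : R) : 0 <= a -> 0 <= b -> Num.sqrt (a + b) <= Num.sqrt a + Num.sqrt b.
  move=> a0 b0; rewrite -(ler_pXn2r (n := 2)) ?nnegrE ?addr_ge0 ?sqrtr_ge0 //.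
  rewrite sqr_sqrtr ?addr_ge0 // sqrrD !sqr_sqrtr // addrAC lerDl.
  by rewrite mulrn_wge0 // mulr_ge0 ?sqrtr_ge0.
apply: le_trans (tri _ _ (normr_ge0 _) (normr_ge0 _)).
by rewrite ler_wsqrtr // -{1}(subrK q.2 p.2) -addrA ler_normD.
Qed.

Lemma pdistC p q : pdist p q = pdist q p.
Proof. by rewrite /pdist -opprB enormN distrC. Qed.

End HessianCore.

Section HessianCoreMain.
Context {R : realType} {n : nat}.
Notation pt := ('rV[R]_n * R)%type.
Implicit Types (D : set pt) (u w v tau : pt -> R) (g : pt -> 'rV[R]_n) (M H : pt -> 'M[R]_n)
  (z p q : pt) (b y : 'rV[R]_n) (B N P : 'M[R]_n).
Let dr : R := @dens_radius R n.
Let box : set pt := boxT dr 0 4.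
Variables (lam Lam : R).
Hypotheses (lam0 : 0 < lam) (lamL : lam <= Lam) (n0 : (0 < n)%N).

(* [th] is almost the maximum of [tr (B' (M z - M z'))] over all projections [B']
   and all points [z], [z'] of the region. *)
Definition near_max F D u g M v (p q : pt) (m0 eta eps e1 th : R) : Prop :=
  let r := pdist p q in
  [/\ forall z, D z -> F (M z) = v z, Reg p (m0 * r) `<=` D,
    forall z z' B, Reg p (m0 * r) z -> Reg p (m0 * r) z' -> projection B ->
      \tr (B *m (M z - M z')) <= (1 + eta) * th,
    forall z z' B, Reg p (m0 * r) z -> Reg p (m0 * r) z' -> projection B ->
      pdist z z' <= eps * r -> n%:R * \tr (B *m (M z - M z')) <= eta * th &
    forall z z', Reg p (m0 * r) z -> Reg p (m0 * r) z' -> `|v z - v z'| <= e1 * th].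

(* One step at scale [rho]: [tr (B M)] is close to its maximum at [p], and
   [tr ((1 - B) M)] nearly reaches at [p'] its maximum over the larger cylinder. *)
Lemma two_projections (dl k S ks : R) F D u g M v B (h E rho : R) (x0 : 'rV[R]_n) (T : R)
    (p p' : pt) :
  0 < dl -> dl <= 1 ->
  (forall w1 g1 H1 tau1 w2 g2 H2 tau2 (p1 p2 : pt),
    smooth box w1 g1 H1 tau1 -> smooth box w2 g2 H2 tau2 ->
    (forall z, box z -> 0 <= w1 z) -> (forall z, box z -> 0 <= w2 z) ->
    (forall z, box z -> pucci_super lam Lam (H1 z) (tau1 z + dl)) ->
    (forall z, box z -> pucci_super lam Lam (H2 z) (tau2 z + dl)) ->
    (forall i, `|p1.1 0 i| <= 1) -> 3 <= p1.2 <= 4 ->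
    (forall i, `|p2.1 0 i| <= 1) -> 3 <= p2.2 <= 4 ->
    w1 p1 <= dl -> w2 p2 <= dl -> exists z, [/\ box z, w1 z <= 1 & w2 z <= 2]) ->
  projection B -> smooth D u g M v -> 0 < h -> 0 <= E -> 0 < rho -> 0 < k ->
  unif_parabolic lam Lam F -> quasiconcave F -> (forall z, D z -> F (M z) = v z) ->
  (forall z, cyl x0 T rho z -> D z /\ forall y, enorm y <= h -> D (xshift z y) /\ `|v (xshift z y) - v z| <= E) ->
  k * rho ^+ 2 * (h ^- 2 * (n * 2)%:R * E * (1 + n%:R * (Lam / lam))) <= dl ->
  (forall z, cyl x0 T rho z -> proj_diff B h u z <= S) ->
  (forall z, cyl x0 T rho z -> proj_diff (1%:M - B) h u z <= ks) ->
  (forall i, `|p.1 0 i - x0 0 i| <= rho) -> T - rho ^+ 2 <= p.2 <= T ->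
  (forall i, `|p'.1 0 i - x0 0 i| <= rho) -> T - rho ^+ 2 <= p'.2 <= T ->
  k * (S - proj_diff B h u p) <= dl -> k * (ks - proj_diff (1%:M - B) h u p') <= dl ->
  exists y : pt, [/\ cyl x0 T rho y, k * (S - proj_diff B h u y) <= 1 &
    k * (ks - proj_diff (1%:M - B) h u y) <= 2].
Proof.
move=> dl0 dl1 dens hB sm h0 E0 rho0 k0 ell qc eqF hcyl herr hS hks px pt1 p'x p't hp hp'.
have hC : projection (1%:M - B) := projectionC hB.1 hB.2.
have inner (x : pt) : (forall i, `|x.1 0 i - x0 0 i| <= rho) -> T - rho ^+ 2 <= x.2 <= T ->
    exists2 z', x = to_cyl x0 T rho z' & (forall i, `|z'.1 0 i| <= 1) /\ 3 <= z'.2 <= 4.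
  move=> xx xt; have [||z' e [h1 h2]] := @cyl_pre R n x0 T rho 1 x rho0.
  - by move=> i; rewrite mul1r.
  - by rewrite expr1n mul1r.
  by exists z' => //; split => //; move: h2; rewrite expr1n => /andP[? ?]; apply/andP; split; lra.
have [z1 e1 [z1x z1t]] := inner p px pt1; have [z2 e2 [z2x z2t]] := inner p' p'x p't.
have incyl z : box z -> cyl x0 T rho (to_cyl x0 T rho z) := to_cylP x0 T (ltW rho0).
set D' := [set z | D z /\ forall (j : 'I_n * bool), D (xshift z ((if j.2 then h else - h) *: row j.1 B))].
have hk (C : 'M[R]_n) (j : 'I_n * bool) : projection C -> enorm ((if j.2 then h else - h) *: row j.1 C) <= h.
  move=> [sC CC]; rewrite enormZ (_ : `|_| = h); last by case: j.2; rewrite ?normrN gtr0_norm.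
  rewrite ler_piMr ?(ltW h0) // -(ler_pXn2r (n := 2)) ?nnegrE ?enorm_ge0 // enorm_sqr expr1n.
  exact: projection_row_dot.
have smC C : projection C -> smooth (cyl x0 T rho) (proj_diff C h u)
    (fun z => h ^- 2 *: \sum_(j : 'I_n * bool) (g (xshift z ((if j.2 then h else - h) *: row j.1 C)) - g z))
    (fun z => h ^- 2 *: \sum_(j : 'I_n * bool) (M (xshift z ((if j.2 then h else - h) *: row j.1 C)) - M z))
    (proj_diff C h v).
  move=> pC; have := smooth_diff_sum (fun k : 'I_n * bool => (if k.2 then h else - h) *: row k.1 C) (h ^- 2) sm.
  apply: smooth_sub => z cz; have [Dz hD] := hcyl z cz; split => // j.
  by have [] := hD _ (hk C j pC).
(* With [c] equal to [k * S] or [k * ks] this is the scaled distance of a projected second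
   difference to its upper bound, a nonnegative supersolution up to the error [dl]. *)
have smbox (c : R) C (pC : projection C) := smoothD (smooth_time box c 0)
   (smoothZ (- k) (smooth_cyl (ltW rho0) (fun z h => h) (smC C pC))).
have kr0 : 0 < k * rho ^+ 2 by rewrite mulr_gt0 // exprn_gt0.
have super C z : projection C -> box z -> pucci_super lam Lam
    (0 + (- k) *: (rho ^+ 2 *: (h ^- 2 *: \sum_(j : 'I_n * bool) (M (xshift (to_cyl x0 T rho z) ((if j.2 then h else - h) *: row j.1 C)) - M (to_cyl x0 T rho z)))))
    (0 + - k * (rho ^+ 2 * proj_diff C h v (to_cyl x0 T rho z)) + dl).
  move=> pC bz; have [Dz hD] := hcyl _ (incyl z bz).
  have := pucci_superZ kr0 (proj_diff_super lam0 lamL n0 pC sm h0 E0 ell qc eqF hD).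
  move=> hS'; rewrite !add0r scaleNr scalerA -scalerN; apply: pucci_super_mono hS'.
  rewrite mulrDr mulrN mulNr [k * (_ * proj_diff _ _ _ _)]mulrA lerD2l; exact: herr.
have pos (c : R) C z : projection C -> (forall z, cyl x0 T rho z -> proj_diff C h u z <= c) -> box z ->
    0 <= k * c + 0 * z.2 + - k * proj_diff C h u (to_cyl x0 T rho z).
  move=> pC hc bz; rewrite mul0r addr0 mulNr -mulrBr mulr_ge0 ?(ltW k0) // subr_ge0.
  exact: hc (incyl z bz).
have [||||||z [bz w1 w2]] := dens _ _ _ _ _ _ _ _ z1 z2 (smbox (k * S) B hB) (smbox (k * ks) _ hC)
  _ _ _ _ z1x z1t z2x z2t.
- by move=> z; apply: pos.
- by move=> z; apply: pos.
- by move=> z; apply: super.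
- by move=> z; apply: super.
- by rewrite mul0r addr0 mulNr -mulrBr -e1.
- by rewrite mul0r addr0 mulNr -mulrBr -e2.
exists (to_cyl x0 T rho z); split; first exact: incyl.
- by move: w1; rewrite mul0r addr0 mulNr -mulrBr.
- by move: w2; rewrite mul0r addr0 mulNr -mulrBr.
Qed.

End HessianCoreMain.

Lemma sup_near (R : realType) (A : set R) (b e : R) : A !=set0 -> (forall x, A x -> x <= b) -> 0 < e ->
  [/\ forall x, A x -> x <= sup A, sup A <= b & exists2 x, A x & sup A - e < x].
Proof.
move=> A0 Ab e0; have hs : has_sup A by split => //; exists b.
split; first by move=> x Ax; apply: sup_upper_bound.
  exact: ge_sup.
by have [x Ax hx] := sup_adherent e0 hs; exists x.
Qed.

(** * The contradiction at a nearly maximal oscillation *)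

Section HessianContradiction.
Context {R : realType} {n : nat}.
Notation pt := ('rV[R]_n * R)%type.
Implicit Types (D : set pt) (u v : pt -> R) (g : pt -> 'rV[R]_n) (M : pt -> 'M[R]_n)
  (z p q : pt) (B N P : 'M[R]_n).
Let dr : R := @dens_radius R n.
Variables (lam Lam : R).
Hypotheses (lam0 : 0 < lam) (lamL : lam <= Lam) (n0 : (0 < n)%N).

(** The bounds on both components leave little room for the negative part of [M1 - M2], while its
    positive part has trace near [th]; ellipticity then makes [F M1 - F M2] exceed [e1 * th]. *)
Lemma no_two_projections F (M1 M2 : 'M[R]_n) B (th e1 eta : R) :
  unif_parabolic lam Lam F -> M1^T = M1 -> M2^T = M2 -> projection B ->
  0 < th -> 4 * e1 <= lam -> 0 <= eta -> 32 * eta <= lam / Lam ->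
  (forall B', projection B' -> \tr (B' *m (M1 - M2)) <= (1 + eta) * th) ->
  F M1 - F M2 <= e1 * th ->
  (1 - lam / Lam / 8) * th <= \tr (B *m (M1 - M2)) ->
  - (2 * (lam / Lam / 8) + 2 * eta) * th <= \tr ((1%:M - B) *m (M1 - M2)) -> False.
Proof.
move=> ell s1 s2 [sB BB] th0 he eta0 hc hmax hF hB hC.
have sN : (M1 - M2)^T = M1 - M2 by rewrite linearB /= s1 s2.
have [P [P' [B' [[hP hP'] eN sB' BB' tB]]]] := spectral_split sN.
have lower := elliptic_diff lam0 ell s2 hP hP'.
rewrite -eN [M2 + _]addrC subrK in lower.
have tP : \tr P <= (1 + eta) * th by rewrite -tB; apply: hmax.
have /andP[_ b1] := tr_projection_le sB BB hP; have /andP[b2 _] := tr_projection_le sB BB hP'.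
have tBN : \tr (B *m (M1 - M2)) <= \tr P.
  by rewrite eN mulmxBr linearB /= lerBlDr (le_trans b1) // lerDl.
move: hC; rewrite mulmxBl mul1mx linearB /= {1}eN linearB /= => hC.
exact: (oscillation_arith lam0 lamL th0 he eta0 hc tP tBN hB (le_trans lower hF) hC).
Qed.

(** Bookkeeping of scales: the error of [proj_diff_super] carries [h ^- 2] with [h = eps * r], the
    rescaling contributes [rho ^+ 2] of order [r ^+ 2], and a small [e1] compensates [eps ^- 2]. *)
Lemma error_small (a dl eps e1 th r rho X G : R) (m : nat) :
  0 < a -> 0 < dl -> 0 < eps -> 0 <= e1 -> 0 < th -> 0 < r -> 0 <= G -> rho ^+ 2 <= X * r ^+ 2 ->
  e1 * (X * m%:R * G) <= a * dl * eps ^+ 2 ->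
  (a * th)^-1 * rho ^+ 2 * ((eps * r) ^- 2 * m%:R * (e1 * th) * G) <= dl.
Proof.
move=> a0 dl0 eps0 e10 th0 r0 G0 hr he.
have r2 : 0 < r ^+ 2 by rewrite exprn_gt0.
have eps2 : 0 < eps ^+ 2 by rewrite exprn_gt0.
have -> : (a * th)^-1 * rho ^+ 2 * ((eps * r) ^- 2 * m%:R * (e1 * th) * G) =
    (e1 * m%:R * G) * rho ^+ 2 / (a * eps ^+ 2 * r ^+ 2).
  by field; rewrite !gt_eqF.
rewrite ler_pdivrMr ?mulr_gt0 //.
apply: le_trans (ler_wpM2l _ hr) _; first by rewrite !mulr_ge0.
have := ler_wpM2r (ltW r2) he; move: (r ^+ 2) (eps ^+ 2) => y x; clear; lra.
Qed.

End HessianContradiction.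

Section HessianCoreFinal.
Context {R : realType} {n : nat}.
Notation pt := ('rV[R]_n * R)%type.
Implicit Types (D : set pt) (u v : pt -> R) (g : pt -> 'rV[R]_n) (M : pt -> 'M[R]_n)
  (z p q : pt) (B N P : 'M[R]_n).
Local Notation dr := (@dens_radius R n).
Variables (lam Lam : R).
Hypotheses (lam0 : 0 < lam) (lamL : lam <= Lam) (n0 : (0 < n)%N).

Lemma reg_xshift p (L h : R) z (y : 'rV[R]_n) : Reg p L z -> enorm y <= h -> Reg p (L + h) (xshift z y).
Proof.
move=> [z0 zL] yh; split => //; apply: le_trans (pdist_triangle _ z _) _.
by rewrite xshift_pdist addrC lerD.
Qed.

(** The factor [n] in the clause of [near_max] about close points pays for the [n] rows of the
    projection. Passing from [m0 + 1] to [m0] makes room for the step of the differences. *)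
Lemma near_max_approx F D u g M v p q C (m0 eta eps e1 th : R) z :
  near_max F D u g M v p q (m0 + 1) eta eps e1 th -> smooth D u g M v ->
  0 < pdist p q -> 0 < eps -> eps <= 1 -> projection C -> Reg p (m0 * pdist p q) z ->
  `|proj_diff C (eps * pdist p q) u z - \tr (C *m M z)| <= eta * th.
Proof.
move=> [eqF sub h1 h2 h3] sm r0 eps0 eps1 hC hz; set r := pdist p q in sub h1 h2 h3 r0 hz *.
have nR : 0 < n%:R :> R by rewrite ltr0n.
have hh : 0 < eps * r by rewrite mulr_gt0.
have hle : eps * r <= r by rewrite ler_piMl // ltW.
have reg (y : 'rV[R]_n) : enorm y <= eps * r -> Reg p ((m0 + 1) * r) (xshift z y).
  by move=> hy; rewrite mulrDl mul1r; apply: reg_xshift => //; exact: le_trans hle.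
have e0 : enorm (0 : 'rV[R]_n) = 0 by rewrite -(scale0r 0) enormZ normr0 mul0r.
have regz : Reg p ((m0 + 1) * r) z.
  by have := reg 0; rewrite e0 /xshift addr0 -surjective_pairing; apply; exact: ltW.
have e : n%:R * (eta * th / n%:R) = eta * th by rewrite mulrC divfK // gt_eqF.
rewrite -e; apply: (proj_diff_approx hC sm hh).
  by move=> y hy; apply: sub; exact: reg.
move=> y B' hy hB'; have hd : pdist (xshift z y) z <= eps * r by rewrite xshift_pdist.
rewrite !ler_pdivlMr // ![_ * n%:R]mulrC; split; apply: h2 => //.
- exact: reg.
- exact: reg.
- by rewrite pdistC.
Qed.

Ltac lran := clear -lam0 lamL n0; intros; lra.

(* The maximum of [tr ((1 - B) M)] over the cylinders of radius [r dr^j] cannot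
   increase much at every scale [j]; at a good scale [two_projections] applies. *)
Lemma hessian_core : exists2 m0 : R, 1 <= m0 & exists2 eta : R, 0 < eta <= 1 &
  forall eps : R, 0 < eps -> eps <= 1 -> exists2 e1 : R, 0 < e1 &
  forall F D u g M v p q B (th : R), unif_parabolic lam Lam F -> quasiconcave F ->
    smooth D u g M v -> p.2 <= 0 -> q.2 <= 0 -> 0 < pdist p q -> 0 < th ->
    projection B -> th <= \tr (B *m (M p - M q)) ->
    near_max F D u g M v p q m0 eta eps e1 th -> False.
Proof.
have Lam0 : 0 < Lam := lt_le_trans lam0 lamL.
have d4 : 4 <= dr := @dens_radius_ge4 R n.
have [dl /andP[dl0 dl1] dens] := @two_density R n lam Lam lam0 (ltW Lam0).
pose a := lam / Lam / 8.
have a0 : 0 < a by rewrite !divr_gt0.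
have a1 : a <= 8^-1 by rewrite /a -[leRHS]mul1r ler_wpM2r // ler_pdivrMr // mul1r.
(* From the first to the last of the [J] scales the supremum below increases by less than [2 * th],
   whereas [J] increments of [dl * a * th / 2] would exceed this. *)
pose J := (Num.truncn (4 / (dl * a))).+1.
have da : 0 < dl * a by rewrite mulr_gt0.
have hJ : 4 < J%:R * (dl * a) by rewrite -ltr_pdivrMr // truncnS_gt.
pose eta := a * dl / 4.
have ad : a * dl <= a by rewrite ler_piMr // ltW.
have eta0 : 0 < eta by rewrite divr_gt0 // mulr_gt0.
have etaa : 4 * eta = a * dl by rewrite /eta mulrC divfK.
have eta32 : 32 * eta <= lam / Lam by rewrite (_ : lam / Lam = 8 * a); [lra|rewrite /a; field; rewrite gt_eqF].
clearbody J eta.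
pose L := (n%:R * dr + 2) * dr ^+ J.
have L0 : 0 <= L by rewrite mulr_ge0 ?exprn_ge0 ?addr_ge0 ?mulr_ge0 //; lra.
exists (L + 1); first by rewrite lerDr.
exists eta; first by rewrite eta0; lra.
move=> eps eps0 eps1.
pose G := 1 + n%:R * (Lam / lam).
have G0 : 0 <= G by rewrite addr_ge0 // mulr_ge0 // divr_ge0 // ltW.
pose X := dr ^+ J ^+ 2 * (n * 2)%:R * G.
have X0 : 0 <= X by rewrite mulr_ge0 // mulr_ge0 // sqr_ge0.
(* The first bound serves the final ellipticity argument, the second makes the error in the equation
   at most [dl] at all [J] scales. *)
pose e1 := Num.min (lam / 4) (a * dl * eps ^+ 2 / (X + 1)).
have ade : 0 < a * dl * eps ^+ 2 by rewrite mulr_gt0 ?exprn_gt0 // mulr_gt0.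
have e10 : 0 < e1 by rewrite lt_min divr_gt0 //= divr_gt0 // ltr_wpDl.
have he1 : 4 * e1 <= lam.
  by rewrite mulrC -ler_pdivlMr // ge_min lexx.
have he2 : e1 * X <= a * dl * eps ^+ 2.
  apply: le_trans (_ : e1 * (X + 1) <= _); first by rewrite ler_pM2l // lerDl.
  by rewrite -ler_pdivlMr ?ltr_wpDl // ge_min lexx orbT.
exists e1 => // F D u g M v p q B th ell qc sm p0 q0 r0 th0 hB hth nm.
have approx C z := @near_max_approx F D u g M v p q C L eta eps e1 th z nm sm r0 eps0 eps1.
move: (nm) => [eqF sub hmax _ hv].
set r := pdist p q in r0 sub hmax hv approx nm *; pose h := eps * r.
have h0 : 0 < h by rewrite mulr_gt0.
have hler : h <= r by rewrite ler_piMl // ltW.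
pose T := Num.max p.2 q.2; pose rho j := r * dr ^+ j.
have hC : projection (1%:M - B) := projectionC hB.1 hB.2.
have dr1 : 1 <= dr by apply: le_trans d4; rewrite ler1n.
have rho0 j : 0 < rho j by rewrite mulr_gt0 // exprn_gt0 // (lt_le_trans _ dr1).
have rhor j : r <= rho j by rewrite ler_peMr ?exprn_ege1 // ltW.
have rhoS j : rho j.+1 = dr * rho j by rewrite /rho exprSr mulrA mulrC.
have rhoS2 j : 4 * rho j ^+ 2 <= rho j.+1 ^+ 2.
  rewrite rhoS [leRHS]exprMn; apply: ler_wpM2r; first exact: sqr_ge0.
  apply: le_trans (d4) _; exact: ler_eXnr dr1.
have rhoJ j : (j <= J)%N -> rho j <= rho J.
  by move=> jJ; rewrite ler_wpM2l ?(ltW r0) // ler_weXn2l.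
have reg j z : (j <= J)%N -> cyl p.1 T (rho j) z -> Reg p (L * r) z.
  move=> jJ cz; have [z0 zd] := cyl_Reg p0 q0 (rhor j) cz; split => //.
  apply: le_trans zd _; rewrite /L mulrAC -mulrA; apply: ler_wpM2l.
    by rewrite addr_ge0 // mulr_ge0 // (le_trans _ dr1).
  exact: rhoJ.
have regS z : Reg p (L * r) z -> Reg p ((L + 1) * r) z.
  by move=> [z0 zd]; split => //; apply: le_trans zd _; rewrite ler_pM2r // lerDl.
have cp j : cyl p.1 T (rho j) p := (pdist_cyl (ltW (rho0 j)) (rhor j)).1.
have cq j : cyl p.1 T (rho j) q := (pdist_cyl (ltW (rho0 j)) (rhor j)).2.
have regq : Reg p (L * r) q := reg 0%N q (leq0n J) (cq 0%N).
have regp : Reg p (L * r) p := reg 0%N p (leq0n J) (cp 0%N).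
have upper C z : projection C -> Reg p (L * r) z ->
    proj_diff C h u z <= \tr (C *m M q) + (1 + 2 * eta) * th.
  move=> pC hz; have := hmax z q C (regS z hz) (regS q regq) pC; rewrite mulmxBr linearB /=.
  have := approx C z pC hz; rewrite ler_norml => /andP[_]; rewrite -/h.
  by move: (proj_diff _ _ _ _) (\tr _) (\tr _); lran.
have lower C z : projection C -> Reg p (L * r) z ->
    \tr (C *m M z) - eta * th <= proj_diff C h u z.
  move=> pC hz; have := approx C z pC hz; rewrite ler_norml => /andP[+ _]; rewrite -/h.
  by rewrite lerBrDr addrC.
(* Only the complement of [B] needs a good scale: for [B] itself the maximality of [th] gives an
   upper bound valid at every scale, which [p] nearly attains. *)
pose S j := sup [set proj_diff (1%:M - B) h u z | z in cyl p.1 T (rho j)].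
pose e := dl * a * th / 2.
have e0 : 0 < e by rewrite divr_gt0 // mulr_gt0.
have hS j : (j <= J)%N -> _ := fun jJ => @sup_near R
  [set proj_diff (1%:M - B) h u z | z in cyl p.1 T (rho j)] _ e
  (ex_intro _ _ (ex_intro2 _ _ p (cp j) erefl)) (fun x hx => let: ex_intro2 z cz ez := hx in
     eq_ind _ (fun x => x <= \tr ((1%:M - B) *m M q) + (1 + 2 * eta) * th)
        (upper _ z hC (reg j z jJ cz)) _ ez) e0.
have [j jJ hj] : exists2 j, (j < J)%N & S j.+1 - S j < e.
  apply: pigeonhole_increment.
  have [_ h1 _] := hS J (leqnn J); have [h2 _ _] := hS 0%N (leq0n J).
  have h3 := h2 _ (ex_intro2 _ _ q (cq 0%N) erefl); have h4 := lower _ q hC regq.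
  rewrite -/(S 0%N) in h3; rewrite -/(S J) in h1.
  have h5 : 4 * (th / 2) < J%:R * (dl * a) * (th / 2) by rewrite ltr_pM2r // divr_gt0.
  have h6 : eta * th <= 8^-1 * th by rewrite ler_pM2r //; move: etaa ad a1; lran.
  have h7 : J%:R * e = J%:R * (dl * a) * (th / 2) by rewrite /e; ring.
  by rewrite h7; move: h1 h2 h3 h4 h5 h6 th0; move: (S _) (S _) (proj_diff _ _ _ _) (\tr _); lran.
have [Sup _ _] := hS j.+1 jJ; have [_ _ [_ [p' cp' <-] hp']] := hS j (ltnW jJ).
rewrite -/(S j.+1) in Sup; rewrite -/(S j) in hp'.
have kpos : 0 < (a * th)^-1 by rewrite invr_gt0 mulr_gt0.
have cylle (b : R) x : x <= b * (a * th) -> (a * th)^-1 * x <= b.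
  by move=> hx; rewrite mulrC ler_pdivrMr // mulr_gt0.
have [||||||||||y [cy w1 w2]] := @two_projections R n lam Lam lam0 lamL n0 dl (a * th)^-1
  (\tr (B *m M q) + (1 + 2 * eta) * th) (S j.+1) F D u g M v B h (e1 * th) (rho j.+1) p.1 T p p'
  dl0 dl1 dens hB sm h0 (mulr_ge0 (ltW e10) (ltW th0)) (rho0 _) kpos ell qc eqF.
- move=> z cz; have hz := reg j.+1 z jJ cz; split; first by apply: sub; exact: regS.
  move=> y hy; have hy' : Reg p ((L + 1) * r) (xshift z y).
    by rewrite mulrDl mul1r; apply: reg_xshift => //; exact: le_trans hler.
  by split; [exact: sub|apply: hv => //; exact: regS].
- apply: (error_small (X := dr ^+ J ^+ 2)) => //; first exact: ltW.
  by rewrite -exprMn mulrC ler_pXn2r ?nnegrE ?(ltW (rho0 _)) //; exact: rhoJ.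
- by move=> z cz; apply: upper => //; exact: reg cz.
- by move=> z cz; apply: Sup; exists z.
- by move=> i; rewrite subrr normr0 ltW.
- have [_ /andP[t0 t1]] := cp j; rewrite t1 andbT (le_trans _ t0) // lerD2l lerN2.
  exact: rhoS2.
- by have [hx _] := cp' => i; rewrite rhoS; exact: hx.
- have [_ /andP[t0 t1]] := cp'; rewrite t1 andbT (le_trans _ t0) // lerD2l lerN2.
  exact: rhoS2.
- apply: cylle; have h1 := lower B p hB regp; move: hth; rewrite mulmxBr linearB /= => h2.
  have -> : dl * (a * th) = 4 * eta * th by rewrite etaa; ring.
  have := mulr_gt0 eta0 th0.
  by move: h1 h2; move: (proj_diff _ _ _ _) (\tr _) (\tr _); lran.
- apply: cylle; have -> : dl * (a * th) = 2 * e by rewrite /e; field.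
  by move: hj hp'; move: (S _) (S _) (proj_diff _ _ _ _); lran.
have regy := reg _ y jJ cy.
have ath (b x : R) : (a * th)^-1 * x <= b -> x <= b * (a * th).
  by rewrite mulrC ler_pdivrMr // mulr_gt0.
have := ath _ _ w1; have := ath _ _ w2 => {w1 w2} w2 w1.
have sy : (M y)^T = M y := smooth_sym sm (sub _ (regS _ regy)).
have sq : (M q)^T = M q := smooth_sym sm (sub _ (regS _ regq)).
apply: (no_two_projections lam0 lamL ell sy sq hB th0 he1 (ltW eta0) eta32).
- by move=> B' hB'; apply: hmax => //; exact: regS.
- rewrite !eqF; try by apply: sub; exact: regS.
  by apply: le_trans (ler_norm _) _; apply: hv; exact: regS.
- rewrite mulmxBr linearB /=; have := approx B y hB regy.
  rewrite ler_norml -/h => /andP[_ h1]; rewrite -/a.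
  have := mulr_gt0 eta0 th0.
  by move: w1 h1; move: (proj_diff _ _ _ _) (\tr _) (\tr _); lran.
- rewrite mulmxBr linearB /=; have := approx _ y hC regy; rewrite ler_norml -/h => /andP[_ h1].
  have h2 := lower _ q hC regq; have h3 : proj_diff (1%:M - B) h u q <= S j.+1.
    by apply: Sup; exists q.
  rewrite -/a; move: w2 h1 h2 h3.
  by move: (proj_diff _ _ _ _) (proj_diff _ _ _ _) (\tr _) (\tr _) (S _); lran.
Qed.

End HessianCoreFinal.

Lemma scale_bound (R : realType) (kap A Y Y' m c th t : R) : 0 < Y -> 0 < th -> 0 <= c -> 0 <= m ->
  kap < 1 -> Y <= m * Y' -> Y' * t <= A -> (1 - kap) * A <= Y * th -> m <= c * (1 - kap) ->
  t <= c * th.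
Proof.
move=> Y0 th0 c0 m0 k1 hY ht hA hm; have [t0|t0] := leP t 0.
  by apply: le_trans t0 _; rewrite mulr_ge0 // ltW.
have k0 : 0 < 1 - kap by rewrite subr_gt0.
have h1 : Y * t <= m * A.
  by apply: le_trans (ler_wpM2r (ltW t0) hY) _; rewrite -mulrA ler_wpM2l.
have A0 : 0 <= m * A by apply: le_trans h1; rewrite mulr_ge0 // ltW.
rewrite -(ler_pM2l (mulr_gt0 k0 Y0)).
have h2 : (1 - kap) * (Y * t) <= m * ((1 - kap) * A) by rewrite [leRHS]mulrCA ler_pM2l.
have h3 : m * ((1 - kap) * A) <= m * (Y * th) by rewrite ler_wpM2l.
have h4 : m * (Y * th) <= c * (1 - kap) * (Y * th) by rewrite ler_wpM2r // mulr_ge0 // ltW.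
by lra.
Qed.

Lemma powR_le1D (R : realType) (x a : R) : 0 <= x -> 0 <= a -> a <= 1 -> x `^ a <= 1 + x.
Proof.
move=> x0 a0 a1; have [h|h] := leP x 1.
  have : x `^ a <= 1 `^ a by apply: ge0_ler_powR; rewrite ?nnegrE.
  by rewrite powR1 => /le_trans; apply; rewrite lerDl.
apply: le_trans (_ : x `^ 1 <= _); first by apply: ler_powR => //; exact: ltW.
by rewrite powRr1 // lerDr.
Qed.

(** * Weighted Hoelder quotients of the Hessian *)

Section HessianHolder.
Context {R : realType} {n : nat}.
Notation pt := ('rV[R]_n * R)%type.
Implicit Types (D : set pt) (u v : pt -> R) (g : pt -> 'rV[R]_n) (M : pt -> 'M[R]_n)
  (z p q : pt) (B N P : 'M[R]_n).
Variables (lam Lam : R).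
Hypotheses (lam0 : 0 < lam) (lamL : lam <= Lam) (n0 : (0 < n)%N).
Ltac lran := clear -lam0 lamL n0; lra.

Lemma tr_projection_mn B N : projection B -> \tr (B *m N) <= mn N.
Proof.
move=> [sB BB]; rewrite /mn exchange_big /mxtrace; apply: ler_sum => i _.
rewrite mxE; apply: ler_sum => j _; apply: le_trans (ler_norm _) _.
rewrite normrM ler_piMl //.
have h1 := projection_row_dot i sB BB; have h2 := sqr_coord_le (row i B) j; rewrite mxE in h2.
by rewrite -(ler_pXn2r (n := 2)) ?nnegrE // expr1n real_normK ?num_real // (le_trans h2).
Qed.

(* The distance from [p] to the parabolic boundary of the cylinder of radius 3/4. *)
Definition wdist p : R := 3 / 4 - Num.max (enorm p.1) (Num.sqrt (- p.2)).

Lemma wdist_lip p q : p.2 <= 0 -> q.2 <= 0 -> wdist p <= wdist q + pdist p q.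
Proof.
move=> p0 q0; rewrite /wdist -addrA lerD2l lerNl opprD opprK lerBlDr ge_max.
have s0 := sqrtr_ge0 `|p.2 - q.2|; have e0 := enorm_ge0 (p.1 - q.1).
have h1 : enorm q.1 <= enorm p.1 + enorm (p.1 - q.1).
  by have := enormD p.1 (- (p.1 - q.1)); rewrite enormN opprB addrC subrK.
have h2 : Num.sqrt (- q.2) <= Num.sqrt (- p.2) + Num.sqrt `|p.2 - q.2|.
  have P0 : 0 <= - p.2 by rewrite oppr_ge0.
  rewrite -(ler_pXn2r (n := 2)) ?nnegrE ?addr_ge0 ?sqrtr_ge0 // sqrrD !sqr_sqrtr ?oppr_ge0 //.
  have := mulr_ge0 (sqrtr_ge0 (- p.2)) s0; have := ler_norm (p.2 - q.2); lra.
have [h3 h4] : enorm p.1 <= Num.max (enorm p.1) (Num.sqrt (- p.2)) /\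
    Num.sqrt (- p.2) <= Num.max (enorm p.1) (Num.sqrt (- p.2)) by rewrite !le_max !lexx orbT.
by rewrite /pdist; apply/andP; split; lra.
Qed.

Definition Om : set pt := [set p | p.2 <= 0 /\ 0 < wdist p].

Lemma Om_Qbar p : Om p -> Qbar (3 / 4) (9 / 16) p.
Proof.
move=> [p0]; rewrite subr_gt0 gt_max => /andP[h1 h2].
split; first exact: ltW.
rewrite p0 andbT lerNl.
have P0 : 0 <= - p.2 by rewrite oppr_ge0.
rewrite -(sqr_sqrtr P0) (_ : 9 / 16 = (3 / 4) ^+ 2); last by field.
by rewrite ler_pXn2r ?nnegrE ?sqrtr_ge0 ?ltW //; lra.
Qed.

Lemma wdist_half p : Qbar 2^-1 4^-1 p -> 4^-1 <= wdist p.
Proof.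
move=> [h1 /andP[h2 h3]]; rewrite /wdist lerBrDr -lerBrDl ge_max; apply/andP; split; first lra.
have P0 : 0 <= - p.2 by rewrite oppr_ge0.
rewrite -(ler_pXn2r (n := 2)) ?nnegrE ?sqrtr_ge0 // ?sqr_sqrtr //; last lra.
by rewrite expr2; lra.
Qed.

(** The quotients of an interior Hoelder seminorm of the Hessian, tested on projections; the weight
    vanishes at the parabolic boundary. *)
Definition weighted_values M (alpha : R) : set R := [set x : R | exists p q B,
  [/\ Om p, Om q, 0 < pdist p q, projection B &
  x = (Num.min (wdist p) (wdist q) / pdist p q) `^ alpha * \tr (B *m (M p - M q))]].

Lemma wdist_le1 p : wdist p <= 1.
Proof.
rewrite /wdist lerBlDr; have : enorm p.1 <= Num.max (enorm p.1) (Num.sqrt (- p.2)).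
  by rewrite le_max lexx.
have := enorm_ge0 p.1; lra.
Qed.

Lemma ratio_powR (alpha c d r d' r' : R) : 0 <= alpha -> 0 < d -> 0 < r -> 0 < r' -> 0 <= c ->
  d <= 2 * d' -> r' <= c * r -> (d / r) `^ alpha <= (2 * c) `^ alpha * (d' / r') `^ alpha.
Proof.
move=> a0 d0 r0 r'0 c0 hd hr; have d'0 : 0 <= d' by lra.
rewrite -powRM; [|by rewrite mulr_ge0|by rewrite divr_ge0 // ltW].
apply: ge0_ler_powR => //.
- by rewrite nnegrE divr_ge0 // ltW.
- by rewrite nnegrE !mulr_ge0 ?invr_ge0 // ltW.
rewrite ler_pdivrMr // mulrA mulrAC ler_pdivlMr //.
apply: le_trans (ler_wpM2l (ltW d0) hr) _.
have := ler_wpM2r (mulr_ge0 c0 (ltW r0)) hd; lra.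
Qed.

(** Takes a triple nearly attaining the supremum. Its large value makes the two points much closer
    to each other than to the boundary, so weights are comparable in the region of size [m0 * r],
    and maximality bounds the other oscillations there: by [1 + eta] times the given one because
    [(4 m0)^alpha] is close to 1, and by a small fraction at distances up to [eps * r] because
    [(2 eps)^alpha] is small. For [v] it is [alpha <= beta] and the size of [A0] that count. *)
Lemma weighted_near_max (alpha beta m0 eta eps e1 K CV A0 : R) F u g M v (Lp x0 : R) :
  0 < alpha -> alpha <= 1 -> alpha <= beta -> 1 <= m0 -> 0 < eta -> eta <= 1 ->
  (4 * m0) `^ alpha <= 1 + eta / 2 -> 0 < eps -> (2 * eps) `^ alpha <= eta / (2 * n%:R) ->
  0 < e1 -> 0 <= K -> 0 <= CV -> 8 * K <= A0 -> 4 * CV <= e1 * A0 -> 1 <= A0 ->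
  (forall z, Qbar (7 / 8) (7 / 8) z -> F (M z) = v z) ->
  (forall z, Qbar (3 / 4) (9 / 16) z -> mn (M z) <= K) ->
  (forall p q, Qbar (3 / 4) (9 / 16) p -> Qbar (3 / 4) (9 / 16) q ->
     mn (M p - M q) <= Lp * pdist p q) ->
  (forall p q, Qbar (3 / 4) (9 / 16) p -> Qbar (3 / 4) (9 / 16) q ->
     `|v p - v q| <= CV * pdist p q `^ beta) ->
  weighted_values M alpha x0 -> A0 < x0 ->
  exists p q B, [/\ Om p, Om q, 0 < pdist p q, projection B &
    0 < \tr (B *m (M p - M q)) /\
    near_max F (Qbar (7 / 8) (7 / 8)) u g M v p q m0 eta eps e1 (\tr (B *m (M p - M q)))].
Proof.
move=> al0 al1 alb m01 eta0 eta1 hm eps0 heps e10 K0 CV0 hA1 hA2 A0p eqF MK hLp hv Vx0 x0A.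
have nR : 0 < n%:R :> R by rewrite ltr0n.
have mnN p q : Om p -> Om q -> mn (M p - M q) <= 2 * K.
  move=> hp hq; have := mnD (M p) (- M q); rewrite -scaleN1r mnZ normrN1 mul1r.
  by have := MK p (Om_Qbar hp); have := MK q (Om_Qbar hq); move: (mn _) (mn _) (mn _) => *; lra.
(* Finiteness of the supremum is qualitative: [Lp] enters only here. *)
have Vb x : weighted_values M alpha x -> x <= 2 * K + `|Lp|.
  move=> [p [q [B [Op Oq r0 hB ->]]]]; set t := \tr _; set d := Num.min _ _.
  have b0 : 0 <= 2 * K + `|Lp| by rewrite addr_ge0 ?mulr_ge0.
  have [t0|t0] := leP t 0.
    by apply: le_trans b0; rewrite mulr_ge0_le0 // powR_ge0.
  have d0 : 0 < d by rewrite lt_min; case: Op => _ ->; case: Oq.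
  have d1 : d <= 1 by rewrite ge_min wdist_le1.
  have dr : 0 <= d / pdist p q by rewrite divr_ge0 // ltW.
  apply: le_trans (ler_wpM2r (ltW t0) (powR_le1D dr (ltW al0) al1)) _.
  have tm : t <= mn (M p - M q) := tr_projection_mn _ hB.
  rewrite mulrDl mul1r; apply: lerD; first exact: le_trans tm (mnN p q Op Oq).
  have tL : t <= `|Lp| * pdist p q.
    apply: le_trans tm _; apply: le_trans (hLp p q (Om_Qbar Op) (Om_Qbar Oq)) _.
    by rewrite ler_wpM2r ?pdist_ge0 // ler_norm.
  apply: le_trans (ler_wpM2l dr tL) _.
  rewrite (_ : d / pdist p q * (`|Lp| * pdist p q) = `|Lp| * d); first by rewrite ler_piMr.
  by field; rewrite gt_eqF.
have As0 : 0 < sup (weighted_values M alpha).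
  by have [h _ _] := @sup_near R _ _ 1 (ex_intro _ x0 Vx0) Vb ltr01; have := h x0 Vx0; lra.
have k0 : 0 < eta / 4 * sup (weighted_values M alpha) by rewrite mulr_gt0 // divr_gt0.
have [hsup _ [x [p [q [B [Op Oq r0 hB ->]]]] hx]] := sup_near (ex_intro _ x0 Vx0) Vb k0.
move: hsup (hsup x0 Vx0) hx; set A := sup _ => hsup x0A'; set t := \tr _; set d := Num.min _ _.
set r := pdist p q in r0 *; set Y := (d / r) `^ alpha => hx.
have AA : A0 < A := lt_le_trans x0A x0A'.
have d0 : 0 < d by rewrite lt_min; case: Op => _ ->; case: Oq.
have d1 : d <= 1 by rewrite ge_min wdist_le1.
have dp : d <= wdist p by rewrite ge_min lexx.
have YE : Y = (d / r) `^ alpha by [].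
have tE : t = \tr (B *m (M p - M q)) by [].
have rE : r = pdist p q by [].
have tK : t <= 2 * K := le_trans (tr_projection_mn _ hB) (mnN p q Op Oq).
clear k0 As0; clearbody A Y d t r.
have Y0 : 0 < Y by rewrite YE powR_gt0 // divr_gt0.
have hx' : (1 - eta / 4) * A <= Y * t by rewrite mulrBl mul1r ltW.
have hx2 : 3 / 4 * A0 <= Y * t.
  apply: le_trans hx'; apply: le_trans (_ : 3 / 4 * A <= _); first by move: AA; lran.
  by rewrite ler_pM2r; [move: eta1; lran|move: A0p AA; lran].
have t0 : 0 < t by rewrite -(pmulr_rgt0 _ Y0); move: hx2 A0p; lran.
(* The trace is at most [2 * K] and the weighted value at least [3/4 A0 >= 6 K]. A weight of 3
   exceeds [(4 m0)^alpha], which makes [r] small against [d] in [dm]. *)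
have Y3 : 3 <= Y.
  by rewrite -(ler_pM2r t0); move: hx2 hA1 tK; lran.
have m0p : 0 < m0 := lt_le_trans ltr01 m01.
have dm : 2 * m0 * r <= d.
  rewrite -ler_pdivlMr // leNgt; apply/negP => lt; move: Y3; apply/negP; rewrite -ltNge YE.
  apply: le_lt_trans (_ : (4 * m0) `^ alpha < _).
    apply: ge0_ler_powR; [exact: ltW|by rewrite nnegrE divr_ge0 ?ltW|by rewrite nnegrE; move: m0p; lran|move: lt m0p; lran].
  by apply: le_lt_trans hm _; move: eta1; lran.
exists p, q, B; rewrite -rE -tE; split => //; split => //.
have regOm z : Reg p (m0 * r) z -> Om z /\ d <= 2 * wdist z.
  move=> [z0 zr]; have := wdist_lip Op.1 z0; rewrite (pdistC p z) => h.
  by split; [split => //|]; move: h dp dm zr d0; lran.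
have regd z z' : Reg p (m0 * r) z -> Reg p (m0 * r) z' -> pdist z z' <= 2 * m0 * r.
  move=> [_ h1] [_ h2]; apply: le_trans (pdist_triangle z p z') _.
  by rewrite (pdistC p z'); move: h1 h2; lran.
have key (c c' : R) z z' B' : 0 <= c -> 0 <= c' -> (2 * c) `^ alpha <= c' * (1 - eta / 4) ->
    Reg p (m0 * r) z -> Reg p (m0 * r) z' -> projection B' -> pdist z z' <= c * r ->
    \tr (B' *m (M z - M z')) <= c' * t.
  move=> c0 c'0 hc hz hz' hB' hr.
  have [e|r'0] := eqVneq (pdist z z') 0.
    by rewrite (pdist_eq0 e) subrr mulmx0 mxtrace0 mulr_ge0 // ltW.
  have {}r'0 : 0 < pdist z z' by rewrite lt_def r'0 pdist_ge0.
  have [Oz dz] := regOm z hz; have [Oz' dz'] := regOm z' hz'.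
  have dd : d <= 2 * Num.min (wdist z) (wdist z') by rewrite /Num.min; case: ifP.
  have hY := ratio_powR (ltW al0) d0 r0 r'0 c0 dd hr; rewrite -YE in hY.
  apply: (scale_bound Y0 t0 c'0 (powR_ge0 (2 * c) alpha) _ hY _ hx' hc); first by move: eta1; lran.
  by apply: hsup; exists z, z', B'.
rewrite /near_max -rE; split.
- exact: eqF.
- by move=> z hz; have [Oz _] := regOm z hz; have [h1 /andP[h2 h3]] := Om_Qbar Oz; split; [move: h1; lran|apply/andP; split; [move: h2; lran|exact: h3]].
- move=> z z' B' hz hz' hB'; apply: (key (2 * m0)) => //; [by move: m0p; lran|by move: eta0; lran| |exact: regd].
  rewrite mulrA (_ : 2 * 2 = 4); last by ring.
  apply: le_trans hm _; have := mulr_ge0 (ltW eta0) (_ : 0 <= 1 - eta); rewrite subr_ge0 => /(_ eta1) h; move: h eta0; lran.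
- move=> z z' B' hz hz' hB' hr; rewrite mulrC -ler_pdivlMr // mulrAC.
  apply: (key eps) => //; [exact: ltW|by rewrite divr_ge0 ?ltW|].
  apply: le_trans heps _; rewrite invfM mulrA mulrAC ler_wpM2l ?divr_ge0 ?(ltW eta0) ?(ltW nR) //; move: eta1; lran.
- move=> z z' hz hz'; have [Oz _] := regOm z hz; have [Oz' _] := regOm z' hz'.
  apply: le_trans (hv z z' (Om_Qbar Oz) (Om_Qbar Oz')) _.
  have rr := regd z z' hz hz'; have r1 : 2 * m0 * r <= 1 := le_trans dm d1.
  have rp : 0 < 2 * m0 * r by rewrite !mulr_gt0.
  have h1 : pdist z z' `^ beta <= (2 * m0 * r) `^ alpha.
    apply: le_trans (_ : (2 * m0 * r) `^ beta <= _).
      apply: ge0_ler_powR; rewrite ?nnegrE ?pdist_ge0 ?(ltW rp) //.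
      exact: ltW (lt_le_trans al0 alb).
    by apply: ger_powR => //; rewrite rp.
  have h2 : Y * (2 * m0 * r) `^ alpha <= 2.
    rewrite YE -powRM ?divr_ge0 ?(ltW rp) ?(ltW d0) ?(ltW r0) // (_ : d / r * _ = 2 * m0 * d); last first.
      by field; rewrite gt_eqF.
    apply: le_trans (_ : (4 * m0) `^ alpha <= _); last by move: hm eta1; lran.
    apply: ge0_ler_powR; rewrite ?nnegrE ?mulr_ge0 ?(ltW al0) ?(ltW d0) ?(ltW m0p) //.
    have := mulr_ge0 (ltW m0p) (_ : 0 <= 1 - d); rewrite subr_ge0 => /(_ d1) h; move: h m0p; lran.
  apply: le_trans (ler_wpM2l CV0 h1) _; rewrite -(ler_pM2l Y0).
  have h3 := ler_wpM2l CV0 h2; have h4 := ler_wpM2l (ltW e10) hx2.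
  have h5 : 0 <= e1 * A0 := mulr_ge0 (ltW e10) (le_trans ler01 A0p).
  by move: (_ `^ alpha) h3 h4 h5 hA2 => y; clear; lra.
Qed.

(** [alpha] is chosen from [m0] and [eta] of [hessian_core], then [eps], then [e1]; the threshold
    [A0] comes last, as it involves [K], [CV] and [e1]. A quotient above it would contradict
    [hessian_core]. On the half cylinder the weight is at least 1/4, whence the factor
    [4 ^ alpha]. *)
Lemma hessian_holder (beta : R) : 0 < beta -> exists2 alpha : R, 0 < alpha < 1 /\ alpha <= beta &
  forall K CV : R, 0 <= K -> 0 <= CV -> exists2 C : R, 0 <= C &
  forall F u g M v, unif_parabolic lam Lam F -> quasiconcave F ->
  smooth (Qbar (7 / 8) (7 / 8)) u g M v ->
  (forall z, Qbar (7 / 8) (7 / 8) z -> F (M z) = v z) ->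
  (forall z, Qbar (3 / 4) (9 / 16) z -> mn (M z) <= K) ->
  (exists Lp : R, forall p q, Qbar (3 / 4) (9 / 16) p -> Qbar (3 / 4) (9 / 16) q ->
     mn (M p - M q) <= Lp * pdist p q) ->
  (forall p q, Qbar (3 / 4) (9 / 16) p -> Qbar (3 / 4) (9 / 16) q ->
     `|v p - v q| <= CV * pdist p q `^ beta) ->
  forall p q B, Qbar 2^-1 4^-1 p -> Qbar 2^-1 4^-1 q -> projection B ->
    \tr (B *m (M p - M q)) <= C * pdist p q `^ alpha.
Proof.
move=> beta0; have [m0 m01 [eta /andP[eta0 eta1] core]] := @hessian_core R n lam Lam lam0 lamL n0.
have nR : 1 <= n%:R :> R by rewrite ler1n.
have m04 : 1 < 4 * m0 by lra.
have lm : 0 < ln (4 * m0) by rewrite ln_gt0.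
have le : 0 < ln (1 + eta / 2) by rewrite ln_gt0 //; lra.
pose alpha := Num.min beta (Num.min 2^-1 (ln (1 + eta / 2) / ln (4 * m0))).
have al0 : 0 < alpha by rewrite !lt_min beta0 /= divr_gt0 // andbT; lra.
have al1 : alpha <= 2^-1 by rewrite !ge_min lexx orbT.
have alb : alpha <= beta by rewrite ge_min lexx.
have hm : (4 * m0) `^ alpha <= 1 + eta / 2.
  rewrite /powR ifF; last by apply/eqP; lra.
  rewrite -[leRHS]lnK ?posrE; last by lra.
  by rewrite ler_expR -ler_pdivlMr // !ge_min lexx !orbT.
have al1' : alpha <= 1 by apply: le_trans al1 _; lra.
clearbody alpha.
exists alpha; first by rewrite al0 alb; split => //=; lra.
pose eps := Num.min 1 ((eta / (2 * n%:R)) `^ alpha^-1 / 2).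
have en : 0 < eta / (2 * n%:R) by rewrite divr_gt0 //; lra.
have eps0 : 0 < eps by rewrite lt_min ltr01 divr_gt0 // powR_gt0.
have eps1 : eps <= 1 by rewrite ge_min lexx.
have aln : alpha != 0 by rewrite gt_eqF.
have heps : (2 * eps) `^ alpha <= eta / (2 * n%:R).
  have e : eta / (2 * n%:R) = (eta / (2 * n%:R)) `^ alpha^-1 `^ alpha.
    by rewrite -powRrM mulVf // powRr1 // ltW.
  rewrite [leRHS]e; apply: ge0_ler_powR.
  - exact: ltW.
  - by rewrite nnegrE mulr_ge0 // ltW.
  - by rewrite nnegrE powR_ge0.
  - by rewrite mulrC -ler_pdivlMr // ge_min lexx orbT.
have [e1 e10 contra] := core eps eps0 eps1.
move=> K CV K0 CV0; pose A0 := 8 * K + 4 * CV / e1 + 1.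
have hA1 : 8 * K <= A0 by rewrite /A0 -addrA lerDl addr_ge0 // divr_ge0 ?mulr_ge0 // ltW.
have hA2 : 4 * CV <= e1 * A0.
  by rewrite [leRHS]mulrC -ler_pdivrMr // /A0 [leRHS]addrAC lerDr; lra.
have A0p : 1 <= A0 by rewrite /A0 lerDr addr_ge0 ?mulr_ge0 ?invr_ge0 ?(ltW e10) //.
have A00 : 0 <= A0 := le_trans ler01 A0p.
clearbody A0.
exists (A0 * 4 `^ alpha); first by rewrite mulr_ge0 ?powR_ge0.
move=> F u g M v ell qc sm eqF MK [Lp hLp] hv.
suff VA : forall x, weighted_values M alpha x -> x <= A0.
  move=> p q B hp hq hB; have wp := wdist_half hp; have wq := wdist_half hq.
  have [e|r0] := eqVneq (pdist p q) 0.
    by rewrite (pdist_eq0 e) subrr mulmx0 mxtrace0 mulr_ge0 ?powR_ge0 // mulr_ge0 ?powR_ge0.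
  have {}r0 : 0 < pdist p q by rewrite lt_def r0 pdist_ge0.
  have := VA _ (ex_intro _ p (ex_intro _ q (ex_intro _ B (And5 _ _ r0 hB erefl)))).
  have [Op Oq] : Om p /\ Om q by case: hp => _ /andP[_ ?]; case: hq => _ /andP[_ ?]; split; split=> //; [move: wp|move: wq]; lran.
  move=> /(_ Op Oq); set d := Num.min _ _; set t := \tr _ => h.
  have d4 : 1 <= 4 * d by rewrite /d; case: (leP (wdist p)) => _; [move: wp|move: wq]; lran.
  have [t0|t0] := leP t 0.
    by apply: le_trans t0 _; rewrite mulr_ge0 ?powR_ge0 // mulr_ge0 ?powR_ge0.
  rewrite -mulrA -powRM ?(ltW r0) // mulrC.
  apply: le_trans (ler_wpM2l (powR_ge0 _ _) h); rewrite mulrA -powRM.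
  - rewrite mulrACA mulfV ?gt_eqF // mulr1.
    have : 1 `^ alpha <= (4 * d) `^ alpha by apply: ge0_ler_powR; rewrite ?nnegrE ?(ltW al0) ?ler01 ?(le_trans ler01 d4).
    by rewrite powR1 => h1; rewrite ler_peMl // ltW.
  - by rewrite mulr_ge0 // ltW.
  - by rewrite divr_ge0 ?(ltW r0) //; move: d4; lran.
move=> x0 Vx0; rewrite leNgt; apply/negP => x0A.
have [p [q [B [[p0 _] [q0 _] r0 hB [th0 nm]]]]] :=
  weighted_near_max u g al0 al1' alb m01 eta0 eta1 hm eps0 heps e10 K0 CV0 hA1 hA2 A0p eqF MK hLp hv Vx0 x0A.
exact: (contra F _ u g M v p q B _ ell qc sm p0 q0 r0 th0 hB (lexx _) nm).
Qed.

End HessianHolder.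

(** * Mean value and Taylor estimates from left derivatives *)

Section LeftDerivative.
Context {R : realType}.

Definition left_quotient (f : R -> R) (s : R) : R -> R := fun h => h^-1 * (f (s + h) - f s).

(* At a minimum of [(m + e) s - f s] other than [a] the left derivative would be
   nonpositive. *)
Lemma left_derivative_le (f f' : R -> R) (a b m : R) : a <= b ->
  {within `[a, b], continuous f} ->
  (forall s, a < s <= b -> left_quotient f s @ 0^'- --> f' s) ->
  (forall s, a < s <= b -> f' s <= m) -> f b - f a <= m * (b - a).
Proof.
move=> ab cf df hm; rewrite -subr_ge0; apply: (@ge0_of_small _ _ (b - a) 1 ltr01) => e e0 _.
pose g s := (m + e) * s - f s.
have cg : {within `[a, b], continuous g}.
  move=> s; apply: cvgB; last exact: cf.
  by apply: cvgMr; apply: continuous_subspaceT => x; exact: cvg_id.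
have [c cab gmin] := EVT_min ab cg.
move: cab; rewrite in_itv /= => /andP[]; rewrite le_eqVlt => /predU1P[ac cb|ac cb].
  by have := gmin b; rewrite in_itv /= ab lexx => /(_ isT); rewrite -ac /g; lra.
have acb : a < c <= b by rewrite ac.
have /cvgrPdist_lt /(_ e e0) := df c acb; rewrite near_withinE => /nbhs_ballP[d /= d0 hd].
pose h := - Num.min (d / 2) (c - a).
have h0 : h < 0 by rewrite oppr_lt0 lt_min subr_gt0 ac divr_gt0.
have hd2 : - h <= d / 2 by rewrite opprK ge_min lexx.
have hca : - h <= c - a by rewrite opprK ge_min lexx orbT.
have := hd h; rewrite /ball /= sub0r normrN ltr0_norm // => /(_ ltac:(lra) h0).
have ch : c + h \in `[a, b]%R by rewrite in_itv /=; apply/andP; split; lra.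
have := gmin _ ch; have := hm c acb; rewrite /g /left_quotient => h1 h2.
rewrite ltr_norml => /andP[+ _].
have -> : h^-1 * (f (c + h) - f c) = (f c - f (c + h)) / - h by field; rewrite lt_eqF.
move=> h3; have h4 : (f c - f (c + h)) / - h < m + e by lra.
by move: h4; rewrite ltr_pdivrMr ?oppr_gt0 //; move: h2; rewrite mulrDr; lra.
Qed.

Lemma left_derivative_abs (f f' : R -> R) (a b l e : R) : a <= b ->
  {within `[a, b], continuous f} ->
  (forall s, a < s <= b -> left_quotient f s @ 0^'- --> f' s) ->
  (forall s, a < s <= b -> `|f' s - l| <= e) -> `|f b - f a - l * (b - a)| <= e * (b - a).
Proof.
move=> ab cf df hl; rewrite ler_norml.
have h1 := left_derivative_le ab cf df (m := l + e).
have cNf : {within `[a, b], continuous (fun s => - f s)} by move=> s; apply: cvgN; exact: cf.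
have dNf s : a < s <= b -> left_quotient (fun s => - f s) s @ 0^'- --> - f' s.
  move=> hs; have -> : left_quotient (fun s => - f s) s = (fun h => - left_quotient f s h).
    by apply/funext => h; rewrite /left_quotient opprK -mulrN opprB addrC.
  by apply: cvgN; exact: df.
have h2 := left_derivative_le ab cNf dNf (m := - l + e).
apply/andP; split.
  have := h2 _; rewrite mulrDl mulNr => h; suff : - f b - - f a <= - (l * (b - a)) + e * (b - a) by lra.
  by apply: h => s hs; have := hl s hs; rewrite ler_norml => /andP[]; lra.
have := h1 _; rewrite mulrDl => h; suff : f b - f a <= l * (b - a) + e * (b - a) by lra.
by apply: h => s hs; have := hl s hs; rewrite ler_norml => /andP[]; lra.
Qed.

(** The pair [|s1| <= |s|], [0 <= s1 * s] says that [s1] lies between 0 and [s]. [increment_le] is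
    applied to [f] minus its linear and quadratic terms, and negative [s] is reduced to positive by
    reflection. *)
Lemma taylor2 (f f' : R -> R) (l K s : R) : 0 <= K ->
  (forall s1 s2, `|s1| <= `|s| -> `|s2| <= `|s| -> 0 <= s1 * s -> 0 <= s2 * s ->
     `|f s2 - f s1 - f' s1 * (s2 - s1)| <= K * (s2 - s1) ^+ 2) ->
  (forall s1, `|s1| <= `|s| -> 0 <= s1 * s -> `|f' s1 - f' 0 - l * s1| <= K * s1 ^+ 2) ->
  `|f s - f 0 - f' 0 * s - l / 2 * s ^+ 2| <= K * `|s| ^+ 3.
Proof.
move=> K0.
have main (c r : R) (F F' : R -> R) (m : R) : `|c| = 1 -> 0 <= r ->
    (forall s1 s2, 0 <= s1 -> s1 <= s2 -> s2 <= r ->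
       `|F s2 - F s1 - F' s1 * (s2 - s1)| <= K * (s2 - s1) ^+ 2) ->
    (forall s1, 0 <= s1 -> s1 <= r -> `|F' s1 - F' 0 - m * s1| <= K * s1 ^+ 2) ->
    c * (F r - F 0 - F' 0 * r - m / 2 * r ^+ 2) <= K * r ^+ 3.
  move=> c1 r0 h1 h2.
  have cc (x y : R) : `|x| <= y -> c * x <= y.
    by move=> h; apply: le_trans (ler_norm _) _; rewrite normrM c1 mul1r.
  have Km : 0 <= K + `|m| by rewrite addr_ge0.
  have := @increment_le _ (fun x => c * (F x - F' 0 * x - m / 2 * x ^+ 2))
    (fun x => c * (F' x - F' 0 - m * x)) 0 r (K + `|m|) 1 (K * r ^+ 2) r0 ltr01 Km.
  move=> h; apply: le_trans (_ : K * r ^+ 2 * (r - 0) <= _); last by apply: eq_imp_le; ring.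
  apply: le_trans (h _ _); first by apply: eq_imp_le; ring.
    move=> s1 s2 s10 s12 s2r _; have := cc _ _ (h1 s1 s2 s10 s12 s2r).
    have hm : - (c * m) <= `|m| by rewrite -mulrN; apply: cc; rewrite normrN.
    have := ler_wpM2r (sqr_ge0 (s2 - s1)) hm; have := normr_ge0 m.
    have := mulr_ge0 (normr_ge0 m) (sqr_ge0 (s2 - s1)).
    by move: (F s2) (F s1) (F' s1) (F' 0) => *; lra.
  move=> x /andP[x0 xr]; apply: cc; apply: le_trans (h2 x x0 xr) _.
  by rewrite ler_wpM2l // ler_pXn2r.
have [s0|s0] := leP 0 s => h1 h2.
  have g1 s1 s2 : 0 <= s1 -> s1 <= s2 -> s2 <= s -> `|f s2 - f s1 - f' s1 * (s2 - s1)| <= K * (s2 - s1) ^+ 2.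
    by move=> a b c; apply: h1; rewrite ?ger0_norm ?mulr_ge0 //; lra.
  have g2 s1 : 0 <= s1 -> s1 <= s -> `|f' s1 - f' 0 - l * s1| <= K * s1 ^+ 2.
    by move=> a b; apply: h2; rewrite ?ger0_norm ?mulr_ge0 //; lra.
  rewrite (ger0_norm s0) ler_norml.
  have := main 1 s f f' l (normr1 _) s0 g1 g2; have := main (-1) s f f' l (normrN1 _) s0 g1 g2.
  by move=> *; apply/andP; split; lra.
have r0 : 0 <= - s by lra.
have g1 s1 s2 : 0 <= s1 -> s1 <= s2 -> s2 <= - s ->
    `|f (- s2) - f (- s1) - - f' (- s1) * (s2 - s1)| <= K * (s2 - s1) ^+ 2.
  move=> a b c; have := h1 (- s1) (- s2).
  have b0 : 0 <= s2 := le_trans a b.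
  rewrite !normrN (ger0_norm a) (ger0_norm b0) (ltr0_norm s0) !mulNr -!mulrN !mulr_ge0 //.
  rewrite (_ : - s2 - - s1 = - (s2 - s1)); last by ring.
  by rewrite sqrrN mulrN; apply => //; exact: le_trans b c.
have g2 s1 : 0 <= s1 -> s1 <= - s -> `|- f' (- s1) - - f' (- 0) - l * s1| <= K * s1 ^+ 2.
  move=> a b; have := h2 (- s1); rewrite normrN (ger0_norm a) (ltr0_norm s0) mulNr -mulrN mulr_ge0 //.
  move=> /(_ b isT); rewrite sqrrN oppr0 -normrN; congr (`|_| <= _); ring.
rewrite (ltr0_norm s0) ler_norml.
have := main 1 (- s) (fun x => f (- x)) (fun x => - f' (- x)) l (normr1 _) r0 g1 g2.
have := main (-1) (- s) (fun x => f (- x)) (fun x => - f' (- x)) l (normrN1 _) r0 g1 g2.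
rewrite opprK oppr0 sqrrN => *; apply/andP; split; lra.
Qed.

End LeftDerivative.

(** * Mean value estimates and bounds for the derivatives of [u] *)

Section RegularityC42.
Context {R : realType} {n : nat}.
Notation pt := ('rV[R]_n * R)%type.
Implicit Types (u : pt -> R) (z p : pt) (d : option 'I_n) (ds : seq (option 'I_n)).

Definition step d z (s : R) : pt :=
  if d is Some i then (z.1 + s *: delta_mx 0 i, z.2) else (z.1, z.2 + s).

Lemma stepD d z (s r : R) : step d (step d z s) r = step d z (s + r).
Proof. by case: d => [i|] /=; rewrite -addrA // -scalerDl. Qed.

Lemma step0 d z : step d z 0 = z.
Proof. by case: d z => [i|] [x t] /=; rewrite ?scale0r addr0. Qed.

Lemma stepC d d' z (s r : R) : step d (step d' z s) r = step d' (step d z r) s.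
Proof. by case: d d' => [i|] [j|] //=; rewrite addrAC. Qed.

Lemma near_pt_step d z (s s' e : R) : `|s - s'| < e -> near_pt e (step d z s) (step d z s').
Proof.
move=> h; have e0 : 0 < e := le_lt_trans (normr_ge0 _) h.
case: d => [i|] /=; split=> [j|] /=; rewrite ?subrr ?normr0 //.
  rewrite !mxE opprD addrACA subrr add0r -mulrBl normrM; apply: le_lt_trans h.
  by rewrite ler_piMr // eqxx /=; case: (j == i); rewrite ?normr1 ?normr0 ?ler01.
by rewrite opprD addrACA subrr add0r.
Qed.

Lemma continuous_step u d z (a b : R) : {within @Q1 R n, continuous u} ->
  (forall s, a <= s <= b -> Q1 (step d z s)) -> {within `[a, b], continuous (fun s => u (step d z s))}.
Proof.
move=> /within_contP cu hQ; apply/subspace_continuousP => s; rewrite /= in_itv /= => hs.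
apply/cvgrPdist_lt => e e0; have [d0 d00 hd] := cu _ (hQ s hs) e e0.
rewrite near_withinE; apply/nbhs_ballP; exists d0 => // s' /= ss'; rewrite in_itv /= => hs'.
by apply: hd; [exact: hQ|exact: near_pt_step].
Qed.

(** Time derivatives are left limits; restricting the two-sided space derivatives to negative
    increments lets one argument serve both. *)
Lemma pd_left u d ds p : C42_on (@Q1 R n) u -> (pweight (d :: ds) <= 4)%N -> Q1 p ->
  (fun h => h^-1 * (pder ds u (step d p h) - pder ds u p)) @ 0^'- --> pder (d :: ds) u p.
Proof.
move=> [hpd _] hw Qp; have := hpd d ds hw p Qp; case: d hw => [i|] hw /=; last by [].
move=> h; rewrite /dx derive1E.
have := h; rewrite /derivable => /cvg_ex[l hl].
have el : 'D_1 (fun s : R => pder ds u (p.1 + s *: delta_mx 0 i, p.2)) 0 = l.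
  by apply: cvg_lim => //.
rewrite el; apply: cvg_dnbhs_at_left.
move: hl; apply: cvg_trans; apply: near_eq_cvg; near=> h0.
by rewrite /= scale0r !addr0 [h0 *: 1]mulr1 -surjective_pairing.
Unshelve. all: by end_near.
Qed.

Lemma pder_step u d ds z (s l e : R) : C42_on (@Q1 R n) u -> (pweight (d :: ds) <= 4)%N ->
  (forall r, `|r| <= `|s| -> 0 <= r * s ->
     Q1 (step d z r) /\ `|pder (d :: ds) u (step d z r) - l| <= e) ->
  `|pder ds u (step d z s) - pder ds u z - l * s| <= e * `|s|.
Proof.
move=> hu hw hr.
have cu : {within @Q1 R n, continuous (pder ds u)}.
  by apply: hu.2; apply: leq_trans hw; rewrite /= leq_addl.
have main (z' : pt) (a b : R) : a <= b ->
   (forall r, a <= r <= b -> Q1 (step d z' r) /\ `|pder (d :: ds) u (step d z' r) - l| <= e) ->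
   `|pder ds u (step d z' b) - pder ds u (step d z' a) - l * (b - a)| <= e * (b - a).
  move=> ab h; apply: (left_derivative_abs (f := fun s => pder ds u (step d z' s))
    (f' := fun s => pder (d :: ds) u (step d z' s))) => //.
  - by apply: continuous_step => // r /h[].
  - move=> r /andP[r1 r2]; have [|Qr _] := h r; first by rewrite (ltW r1).
    have := pd_left hu hw Qr; apply: cvg_trans; apply: near_eq_cvg; near=> x.
    by rewrite /left_quotient stepD.
  - by move=> r /andP[r1 r2]; have [|] := h r; first by rewrite (ltW r1).
have [s0|s0] := leP 0 s.
  have := main z 0 s s0; rewrite step0 subr0 (ger0_norm s0); apply=> r /andP[r0 rs].
  by apply: hr; rewrite ?mulr_ge0 // !ger0_norm.
have := main z s 0 (ltW s0); rewrite step0 sub0r (ltr0_norm s0) mulrN -normrN !opprD !opprK.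
rewrite [- _ + _]addrC; apply=> r /andP[r0 rs].
apply: hr; last by rewrite -mulrNN mulr_ge0 //; lra.
by rewrite !ler0_norm // ?(ltW s0) // lerN2.
Unshelve. all: by end_near.
Qed.

Lemma Qbar_compact (a b : R) : a <= 1 -> compact (@Qbar R n a b).
Proof.
move=> a1; have [a0|a0] := ltP a 0.
  rewrite (_ : @Qbar R n a b = set0); first exact: compact0.
  by apply/seteqP; split => // z [h _]; have := enorm_ge0 z.1; lra.
have -> : @Qbar R n a b = [set z | boxT 1 (- b) 0 z /\ qf 1%:M z.1 - a ^+ 2 <= 0].
  apply/seteqP; split => z /=.
    move=> [h1 h2]; split; last by rewrite qf1 -enorm_sqr subr_le0 ler_pXn2r ?nnegrE ?enorm_ge0.
    by split => // i; rewrite (le_trans (coord_enorm _ _)) // (le_trans h1).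
  by move=> [[_ h2] +]; rewrite qf1 -enorm_sqr subr_le0 ler_pXn2r ?nnegrE ?enorm_ge0.
apply: sublevel_compact; first exact: boxT_compact.
by move=> z; apply: cvgB; [exact: continuous_qf|exact: cvg_cst].
Qed.

Lemma Qbar_Q1 (a b : R) : a < 1 -> b < 1 -> @Qbar R n a b `<=` @Q1 R n.
Proof. by move=> a1 b1 z [h1 /andP[h2 h3]]; split; [lra|apply/andP; split; lra]. Qed.

(** Compactness bounds each derivative; the constant sums these bounds over the finitely many index
    sequences of length one to three. *)
Lemma pder_bounded u (a b : R) : a < 1 -> b < 1 -> C42_on (@Q1 R n) u ->
  exists2 K : R, 0 <= K & forall ds, (0 < size ds <= 3)%N -> (pweight ds <= 4)%N ->
    forall z, Qbar a b z -> `|pder ds u z| <= K.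
Proof.
move=> a1 b1 hu.
have each ds : exists K : R, (pweight ds <= 4)%N -> forall z, Qbar a b z -> `|pder ds u z| <= K.
  have [w|w] := leqP (pweight ds) 4; last by exists 0.
  have [ne|ne] := pselect (@Qbar R n a b !=set0); last first.
    by exists 0 => _ z hz; exfalso; apply: ne; exists z.
  have c : {within @Qbar R n a b, continuous (fun z => `|pder ds u z|)}.
    apply/within_contP => z hz e e0.
    have /within_contP/(_ z (Qbar_Q1 a1 b1 hz) e e0)[d d0 hd] := hu.2 ds w.
    exists d => // z' hz' nz; apply: le_lt_trans (hd z' (Qbar_Q1 a1 b1 hz') nz).
    exact: ler_dist_dist.
  have [c0 _ hc] := compact_EVT_max ne (@Qbar_compact a b (ltW a1)) c.
  by exists (`|pder ds u c0|) => _ z hz; apply: hc; rewrite inE.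
have [k hk] := choice each.
pose O := option 'I_n.
pose K := \sum_(d1 : O) (`|k [:: d1]| + \sum_(d2 : O) (`|k [:: d1; d2]| + \sum_(d3 : O) `|k [:: d1; d2; d3]|)).
have le1 (f : O -> R) d : (forall d, 0 <= f d) -> f d <= \sum_(x : O) f x.
  by move=> f0; rewrite (bigD1 d) //= lerDl sumr_ge0.
have s3 d1 d2 : 0 <= \sum_(d3 : O) `|k [:: d1; d2; d3]| by rewrite sumr_ge0.
have s2 d1 : 0 <= \sum_(d2 : O) (`|k [:: d1; d2]| + \sum_(d3 : O) `|k [:: d1; d2; d3]|).
  by apply: sumr_ge0 => d2 _; rewrite addr_ge0.
have l1 d1 : `|k [:: d1]| + \sum_(d2 : O) (`|k [:: d1; d2]| + \sum_(d3 : O) `|k [:: d1; d2; d3]|) <= K.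
  by apply: (le1 (fun d1 => _)) => d; rewrite addr_ge0.
have l2 d1 d2 : `|k [:: d1; d2]| + \sum_(d3 : O) `|k [:: d1; d2; d3]| <= K.
  apply: le_trans (l1 d1); apply: le_trans (le1 (fun d2 => _) d2 _) _ => [d|]; first by rewrite addr_ge0.
  by rewrite lerDr.
have l3 d1 d2 d3 : `|k [:: d1; d2; d3]| <= K.
  by apply: le_trans (l2 d1 d2); apply: le_trans (le1 (fun d3 => _) d3 _) _ => //; rewrite lerDr.
exists K; first by apply: sumr_ge0 => d1 _; rewrite addr_ge0.
move=> ds sds w z hz; apply: le_trans (hk ds w z hz) _; apply: le_trans (ler_norm _) _.
case: ds sds w => [|d1 [|d2 [|d3 [|]]]] // _ _.
- by apply: le_trans (l1 d1); rewrite lerDl.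
- by apply: le_trans (l2 d1 d2); rewrite lerDl.
Qed.

End RegularityC42.

Lemma segP (R : realType) (s r : R) :
  (`|r| <= `|s| /\ 0 <= r * s) <-> ((0 <= r <= s) \/ (s <= r <= 0)).
Proof.
split=> [[h1 h2]|[/andP[h1 h2]|/andP[h1 h2]]].
- have [s0|s0|s0] := ltgtP 0 s.
  + left; move: h1 h2; rewrite (gtr0_norm s0) pmulr_lge0 // ler_norml => /andP[_ ->] ->.
    by [].
  + right; move: h1 h2; rewrite (ltr0_norm s0) nmulr_lge0 // ler_norml opprK => /andP[-> _] ->.
    by [].
  + by left; move: h1; rewrite -s0 normr0 normr_le0 => /eqP ->; rewrite lexx.
- by have h3 := le_trans h1 h2; rewrite !ger0_norm // mulr_ge0.
- by have h3 := le_trans h1 h2; rewrite !ler0_norm // lerN2 mulr_le0.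
Qed.

Lemma seg_add (R : realType) (s r1 r2 r : R) :
  `|r1| <= `|s| -> 0 <= r1 * s -> `|r2| <= `|s| -> 0 <= r2 * s ->
  `|r| <= `|r2 - r1| -> 0 <= r * (r2 - r1) -> `|r1 + r| <= `|s| /\ 0 <= (r1 + r) * s.
Proof.
move=> h1 h2 h3 h4 h5 h6.
have /segP a1 := conj h1 h2; have /segP a2 := conj h3 h4; have /segP a3 := conj h5 h6.
apply/segP; clear h1 h2 h3 h4 h5 h6.
have [s0|s0] := leP 0 s; [left|right]; move: a1 a2 a3;
  by move=> [/andP[? ?]|/andP[? ?]] [/andP[? ?]|/andP[? ?]] [/andP[? ?]|/andP[? ?]];
     apply/andP; split; lra.
Qed.

Lemma clairaut_arith (R : realType) (K s a b c p1 p2 p2' h1 h2 h2' m : R) : 0 < s -> 0 <= K ->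
  `|b - a - p1 * s - h1 / 2 * s ^+ 2| <= K * s ^+ 3 ->
  `|c - b - p2' * s - h2' / 2 * s ^+ 2| <= K * s ^+ 3 ->
  `|p2' - p2 - m * s| <= K * s * s -> `|h2' - h2| <= K * s ->
  `|c - a - s * (p1 + p2) - s ^+ 2 / 2 * (h1 + h2) - s ^+ 2 * m| <= 4 * K * s ^+ 3.
Proof.
move=> s0 K0 t1 t2 t3 t4; have s2 : 0 <= s ^+ 2 := sqr_ge0 s.
have -> : c - a - s * (p1 + p2) - s ^+ 2 / 2 * (h1 + h2) - s ^+ 2 * m =
  (b - a - p1 * s - h1 / 2 * s ^+ 2) + (c - b - p2' * s - h2' / 2 * s ^+ 2) +
  s * (p2' - p2 - m * s) + s ^+ 2 / 2 * (h2' - h2) by field.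
have t5 : `|s * (p2' - p2 - m * s)| <= K * s ^+ 3.
  rewrite normrM (gtr0_norm s0) (_ : K * s ^+ 3 = s * (K * s * s)); last by ring.
  by rewrite ler_pM2l.
have t6 : `|s ^+ 2 / 2 * (h2' - h2)| <= K * s ^+ 3.
  rewrite normrM ger0_norm ?divr_ge0 //; apply: le_trans (ler_wpM2l _ t4) _; first by rewrite divr_ge0.
  have : 0 <= K * s ^+ 3 by rewrite mulr_ge0 // exprn_ge0 // ltW.
  by rewrite (_ : s ^+ 2 / 2 * (K * s) = K * s ^+ 3 / 2); [lra|field].
have tri (A B C D e : R) : `|A| <= e -> `|B| <= e -> `|C| <= e -> `|D| <= e ->
    `|A + B + C + D| <= 4 * e.
  rewrite !ler_norml => /andP[? ?] /andP[? ?] /andP[? ?] /andP[? ?].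
  by apply/andP; split; lra.
by apply: le_trans (tri _ _ _ _ _ t1 t2 t5 t6) _; rewrite mulrA.
Qed.

Lemma taylor_step_arith (R : realType) (K X a b c y p p' m h h' : R) : 0 <= K -> `|y| <= X ->
  `|b - a - p' * y - h' / 2 * y ^+ 2| <= K * `|y| ^+ 3 ->
  `|p' - p - m| <= K * X ^+ 2 -> `|h' - h| <= K * X ->
  `|b - a - y * p - (y * m + h / 2 * y ^+ 2)| <= 3 * K * X ^+ 2 * `|y|.
Proof.
move=> K0 yX t1 t2 t3; have y0 := normr_ge0 y.
have -> : b - a - y * p - (y * m + h / 2 * y ^+ 2) =
  (b - a - p' * y - h' / 2 * y ^+ 2) + y * (p' - p - m) + y ^+ 2 / 2 * (h' - h) by field.
have y2 : `|y| ^+ 2 <= X ^+ 2 by rewrite ler_pXn2r ?nnegrE // (le_trans y0).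
have yXX : `|y| * X <= X ^+ 2 by rewrite expr2 ler_wpM2r // (le_trans y0).
have Ky : 0 <= K * `|y| by rewrite mulr_ge0.
have k1 : K * `|y| ^+ 3 <= K * X ^+ 2 * `|y|.
  by have := ler_wpM2l Ky y2; rewrite exprSr; lra.
have k2 : `|y * (p' - p - m)| <= K * X ^+ 2 * `|y| by rewrite normrM mulrC ler_wpM2r.
have k3 : `|y ^+ 2 / 2 * (h' - h)| <= K * X ^+ 2 * `|y|.
  rewrite normrM (@ger0_norm _ (y ^+ 2 / 2)) ?divr_ge0 ?sqr_ge0 //.
  apply: le_trans (ler_wpM2l _ t3) _; first by rewrite divr_ge0 ?sqr_ge0.
  have := ler_wpM2l Ky yXX; have : 0 <= K * `|y| * (`|y| * X).
    by rewrite !mulr_ge0 // (le_trans y0).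
  rewrite -[y ^+ 2]real_normK ?num_real // expr2; lra.
apply: le_trans (ler_normD _ _) _; have := ler_normD (b - a - p' * y - h' / 2 * y ^+ 2) (y * (p' - p - m)).
by move: t1 k1 k2 k3; move: `|_ + _| `|_ - _| `|_ * _| `|_ * _| => *; lra.
Qed.

Lemma smooth_arith (R : realType) (a b c v v' l q e1 e2 e3 : R) :
  `|c - b - v'| <= e1 -> `|v' - v| <= e2 -> `|b - a - l - q| <= e3 ->
  `|c - a - l - q - v| <= e3 + e2 + e1.
Proof.
rewrite !ler_norml => /andP[? ?] /andP[? ?] /andP[? ?]; apply/andP; split; lra.
Qed.

Lemma dist_add2 (R : realType) (K a b c l x t : R) :
  `|c - b| <= K * t -> `|b - a - l| <= K * x -> `|c - a - l| <= K * (x + t).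
Proof.
rewrite mulrDr !ler_norml => /andP[? ?] /andP[? ?]; apply/andP; split; lra.
Qed.

(** * Taylor expansion of [u] in space and time *)

Section TaylorC42.
Context {R : realType} {n : nat}.
Notation pt := ('rV[R]_n * R)%type.
Implicit Types (u : pt -> R) (z p : pt) (y : 'rV[R]_n) (ds : seq (option 'I_n)).

(** The vertices of the path along the coordinate axes from 0 to [y], on whose edges only
    derivatives in one variable occur. *)
Definition trunc (k : nat) y : 'rV[R]_n := \row_j (if (j < k)%N then y 0 j else 0).

Lemma trunc0 y : trunc 0 y = 0.
Proof. by apply/rowP => j; rewrite !mxE. Qed.

Lemma truncn y : trunc n y = y.
Proof. by apply/rowP => j; rewrite !mxE ltn_ord. Qed.

Lemma step_trunc z y (k : 'I_n) :
  step (Some k) (xshift z (trunc k y)) (y 0 k) = xshift z (trunc k.+1 y).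
Proof.
rewrite /step /xshift /= -addrA; congr (_ + _, _); apply/rowP => j; rewrite !mxE eqxx /= ltnS.
have [->|jk] := eqVneq j k; first by rewrite ltnn leqnn add0r mulr1.
by rewrite mulr0 addr0 [(j <= k)%N]leq_eqVlt; move: jk; rewrite -val_eqE /= => /negbTE ->.
Qed.

Lemma vn_trunc_step y (k : 'I_n) (r : R) : `|r| <= `|y 0 k| ->
  vn (trunc k y + r *: delta_mx 0 k) <= vn y.
Proof.
move=> rk; apply: ler_sum => j _; rewrite !mxE eqxx /=.
have [->|jk] := eqVneq j k; first by rewrite ltnn add0r mulr1.
by rewrite mulr0 addr0; case: ifP => // _; rewrite normr0.
Qed.

Lemma vn_trunc (k : nat) y : vn (trunc k y) <= vn y.
Proof. by apply: ler_sum => j _; rewrite mxE; case: ifP => // _; rewrite normr0. Qed.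

Lemma mn_le (H : 'M[R]_n) (c : R) : (forall i j, `|H i j| <= c) -> mn H <= n%:R * (n%:R * c).
Proof.
move=> hc; have s (a : R) : \sum_(i < n) a = n%:R * a by rewrite sumr_const card_ord mulr_natl.
by rewrite -!s; apply: ler_sum => i _; apply: ler_sum => j _.
Qed.

Lemma path_sum (f : pt -> R) z y :
  f (xshift z y) - f z = \sum_(k < n) (f (xshift z (trunc k.+1 y)) - f (xshift z (trunc k y))).
Proof.
have := telescope_sumr (fun k => f (xshift z (trunc k y))) (leq0n n).
by rewrite big_mkord truncn trunc0 => ->; rewrite /xshift addr0 -surjective_pairing.
Qed.

(** Edge [k] of the path contributes the mixed second derivatives with the earlier coordinates and
    half of the pure one; by symmetry the total is half of the form. *)
Lemma triangular_sum (H : 'M[R]_n) y : H^T = H ->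
  \sum_(k < n) (y 0 k * (\sum_(i < n) trunc k y 0 i * H i k) + H k k / 2 * y 0 k ^+ 2) = qf H y / 2.
Proof.
move=> sH; pose a (i k : 'I_n) : R := if (i < k)%N then y 0 i * H i k * y 0 k else 0.
have e1 : qf H y = \sum_(k < n) \sum_(i < n) a i k + \sum_(k < n) \sum_(i < n) a i k +
    \sum_(k < n) H k k * y 0 k ^+ 2.
  have -> : \sum_(k < n) \sum_(i < n) a i k + \sum_(k < n) \sum_(i < n) a i k =
      \sum_(k < n) \sum_(i < n) (a i k + a k i).
    rewrite {2}exchange_big /= -big_split; apply: eq_bigr => k _.
    by rewrite -big_split.
  rewrite /qf bfE -big_split exchange_big; apply: eq_bigr => k _ /=.
  rewrite (bigD1 k) //= [in RHS](bigD1 k) //= /a ltnn addr0 add0r addrC; congr (_ + _).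
    apply: eq_bigr => i ik; case: ltngtP ik => [ik _|ki _|/ord_inj ->]; last by rewrite eqxx.
      by rewrite addr0.
    by rewrite add0r -{1}sH mxE; ring.
  by rewrite expr2; ring.
have half (T D : R) : (T + T + D) / 2 = T + D / 2 by field.
rewrite e1 half mulr_suml -big_split.
apply: eq_bigr => k _ /=; congr (_ + _); last by ring.
rewrite mulr_sumr; apply: eq_bigr => i _; rewrite /a mxE; case: ifP => _; ring.
Qed.

Lemma Qbar_xshift (a b c : R) z y : Qbar a b z -> vn y <= c - a -> b <= c -> Qbar c c (xshift z y).
Proof.
move=> [h1 /andP[h2 h3]] hy bc; split; last by rewrite /= h3 andbT; lra.
by apply: le_trans (enormD _ _) _; have := enorm_vn y; lra.
Qed.

Variables (u : pt -> R) (K : R).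
Hypotheses (hu : C42_on (@Q1 R n) u) (K0 : 0 <= K).
Hypothesis hK : forall ds, (0 < size ds <= 3)%N -> (pweight ds <= 4)%N ->
  forall z, Qbar (15 / 16) (15 / 16) z -> `|pder ds u z| <= K.
Let D2 : set pt := Qbar (15 / 16) (15 / 16).
Let D7 : set pt := Qbar (7 / 8) (7 / 8).

Lemma D2_Q1 : D2 `<=` @Q1 R n.
Proof. by apply: Qbar_Q1; lra. Qed.

Lemma near_D2 z y : D7 z -> vn y <= 16^-1 -> D2 (xshift z y).
Proof. by move=> hz hy; apply: (Qbar_xshift hz); lra. Qed.

Lemma step_x_lipschitz (k : 'I_n) ds z (s : R) : (size ds <= 2)%N -> (pweight ds <= 3)%N ->
  (forall r, `|r| <= `|s| -> 0 <= r * s -> D2 (step (Some k) z r)) ->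
  `|pder ds u (step (Some k) z s) - pder ds u z| <= K * `|s|.
Proof.
move=> sds wds hr; have w4 : (pweight (Some k :: ds) <= 4)%N by rewrite /= add1n ltnS.
have := @pder_step R n u (Some k) ds z s 0 K hu w4; rewrite mul0r subr0; apply => r r1 r2.
have Dr := hr r r1 r2; split; first exact: D2_Q1.
by rewrite subr0; apply: hK.
Qed.

Lemma time_lipschitz ds z (s : R) : (size ds <= 2)%N -> (pweight ds <= 2)%N ->
  (forall r, `|r| <= `|s| -> 0 <= r * s -> D2 (step None z r)) ->
  `|pder ds u (step None z s) - pder ds u z| <= K * `|s|.
Proof.
move=> sds wds hr; have w4 : (pweight (None :: ds) <= 4)%N by rewrite /= !addSn add0n !ltnS.
have := @pder_step R n u None ds z s 0 K hu w4; rewrite mul0r subr0; apply => r r1 r2.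
have Dr := hr r r1 r2; split; first exact: D2_Q1.
by rewrite subr0; apply: hK.
Qed.

Lemma path_D2 z y (k : 'I_n) (r : R) : D7 z -> vn y <= 16^-1 -> `|r| <= `|y 0 k| ->
  exists2 y', step (Some k) (xshift z (trunc k y)) r = xshift z y' & vn y' <= vn y /\ D2 (xshift z y').
Proof.
move=> hz hy hr; exists (trunc k y + r *: delta_mx 0 k); first by rewrite /xshift /= addrA.
have h := vn_trunc_step hr; split => //; apply: near_D2 => //; exact: le_trans hy.
Qed.

Lemma lipschitz_x ds z y : (size ds <= 2)%N -> (pweight ds <= 3)%N -> D7 z -> vn y <= 16^-1 ->
  `|pder ds u (xshift z y) - pder ds u z| <= K * vn y.
Proof.
move=> sds wds hz hy; rewrite path_sum /vn mulr_sumr.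
apply: le_trans (ler_norm_sum _ _ _) _; apply: ler_sum => k _.
rewrite -step_trunc; apply: step_x_lipschitz => // r hr _.
by have [y' -> [_]] := path_D2 hz hy hr.
Qed.

Lemma first_order_x ds z y : (size ds <= 1)%N -> (pweight ds <= 2)%N -> D7 z -> vn y <= 16^-1 ->
  `|pder ds u (xshift z y) - pder ds u z - \sum_(k < n) y 0 k * pder (Some k :: ds) u z|
    <= K * vn y ^+ 2.
Proof.
move=> sds wds hz hy; rewrite path_sum -sumrB expr2 mulrA {2}/vn mulr_sumr.
apply: le_trans (ler_norm_sum _ _ _) _; apply: ler_sum => k _.
rewrite -step_trunc (mulrC (y 0 k)).
have w4 : (pweight (Some k :: ds) <= 3)%N by rewrite /= add1n ltnS.
apply: pder_step => //; first exact: leq_trans w4 _.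
move=> r hr _; have [y' -> [hy' Dy']] := path_D2 hz hy hr; split; first exact: D2_Q1.
apply: le_trans (_ : K * vn y' <= _); last by rewrite ler_wpM2l.
by apply: lipschitz_x => //; exact: le_trans hy.
Qed.

Lemma line_taylor (k : 'I_n) z (s : R) :
  (forall r, `|r| <= `|s| -> 0 <= r * s -> D2 (step (Some k) z r)) ->
  `|u (step (Some k) z s) - u z - pder [:: Some k] u z * s - pder [:: Some k; Some k] u z / 2 * s ^+ 2|
    <= K * `|s| ^+ 3.
Proof.
move=> hr; have s0 : `|0 : R| <= `|s| by rewrite normr0.
have s00 : 0 <= 0 * s by rewrite mul0r.
have := @taylor2 R (fun r => u (step (Some k) z r)) (fun r => pder [:: Some k] u (step (Some k) z r))
  (pder [:: Some k; Some k] u z) K s K0.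
cbv beta; rewrite step0; apply.
- move=> s1 s2 h1 h2 h3 h4.
  have -> : step (Some k) z s2 = step (Some k) (step (Some k) z s1) (s2 - s1) by rewrite stepD addrC subrK.
  rewrite -real_normK ?num_real // expr2 mulrA; apply: (@pder_step R n u (Some k) [::]) => // r hr1 hr2.
  have [b1 b2] := seg_add h1 h3 h2 h4 hr1 hr2.
  rewrite stepD; split; first by apply: D2_Q1; exact: hr.
  rewrite -stepD; apply: le_trans (_ : K * `|r| <= _); last by rewrite ler_wpM2l.
  apply: (step_x_lipschitz (ds := [:: Some k])) => // r' hr' hr'2; rewrite stepD.
  have e : s1 + r - s1 = r by ring.
  by have := @seg_add _ s s1 (s1 + r) r' h1 h3 b1 b2; rewrite e => /(_ hr' hr'2) [c1 c2]; apply: hr.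
- move=> s1 h1 h2; rewrite -real_normK ?num_real // expr2 mulrA.
  apply: (@pder_step R n u (Some k) [:: Some k]) => // r hr1 hr2.
  have := @seg_add _ s 0 s1 r s0 s00 h1 h2; rewrite subr0 add0r => /(_ hr1 hr2) [b1 b2].
  split; first by apply: D2_Q1; exact: hr.
  apply: le_trans (_ : K * `|r| <= _); last by rewrite ler_wpM2l.
  apply: (step_x_lipschitz (ds := [:: Some k; Some k])) => // r' hr' hr'2.
  by have := @seg_add _ s 0 r r' s0 s00 b1 b2; rewrite subr0 add0r => /(_ hr' hr'2) [c1 c2]; apply: hr.
Qed.

(** The increment of [u] to the opposite corner of a square of side [s] is expanded along both
    orders of its sides. The expansions share all terms except the mixed derivative, so the two
    mixed derivatives differ by [O(s)]. *)
Lemma hess_sym z : D7 z -> (hess u z)^T = hess u z.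
Proof.
move=> hz; apply/matrixP => i k; rewrite !mxE.
have small (j : 'I_n) (s r : R) y : vn y <= 32^-1 -> `|s| <= 32^-1 -> `|r| <= `|s| ->
    D2 (step (Some j) (xshift z y) r).
  move=> hy hs hr; have -> : step (Some j) (xshift z y) r = xshift z (y + r *: delta_mx 0 j).
    by rewrite /xshift /= addrA.
  apply: near_D2 => //; apply: le_trans (vnD _ _) _; rewrite vnZ.
  have : vn (delta_mx 0 j : 'rV[R]_n) <= 1.
    rewrite /vn (bigD1 j) //= big1 ?addr0 ?mxE ?eqxx ?normr1 // => l lj.
    by rewrite mxE eqxx (negbTE lj) normr0.
  move=> hd; have := ler_pM (normr_ge0 r) (vn_ge0 _) (le_trans hr hs) hd; rewrite mulr1.
  by move: hy; move: (vn _) (_ * _) => *; lra.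
pose q s j j' := u (step (Some j') (step (Some j) z s) s) - u z - s * (pder [:: Some j] u z + pder [:: Some j'] u z)
  - s ^+ 2 / 2 * (pder [:: Some j; Some j] u z + pder [:: Some j'; Some j'] u z).
have main (s : R) (j j' : 'I_n) : 0 < s -> s <= 32^-1 ->
    `|q s j j' - s ^+ 2 * pder [:: Some j; Some j'] u z| <= 4 * K * s ^+ 3.
  move=> s0 s1; set z1 := step (Some j) z s.
  have sn : `|s| = s := gtr0_norm s0.
  have z0E : z = xshift z 0 by rewrite /xshift addr0 -surjective_pairing.
  have vs : vn (s *: delta_mx 0 j : 'rV[R]_n) <= 32^-1.
    rewrite vnZ sn; apply: le_trans s1; rewrite ler_piMr ?(ltW s0) //.
    rewrite /vn (bigD1 j) //= big1 ?addr0 ?mxE ?eqxx ?normr1 // => l lj.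
    by rewrite mxE eqxx (negbTE lj) normr0.
  have pts r : `|r| <= `|s| -> 0 <= r * s -> D2 (step (Some j) z r).
    by move=> hr _; rewrite z0E; apply: (small j s) => //; rewrite ?vn0 ?sn.
  have pts1 r : `|r| <= `|s| -> 0 <= r * s -> D2 (step (Some j') z1 r).
    by move=> hr _; rewrite (_ : z1 = xshift z (s *: delta_mx 0 j)) //; apply: (small j' s) => //; rewrite sn.
  have t1 := line_taylor pts; have t2 := line_taylor pts1; rewrite -/z1 sn in t1 t2.
  have t3 : `|pder [:: Some j'] u z1 - pder [:: Some j'] u z - pder [:: Some j; Some j'] u z * s| <= K * s * s.
    rewrite -[X in _ <= _ * X]sn; apply: (@pder_step R n u (Some j) [:: Some j']) => // r hr1 hr2.
    split; first by apply: D2_Q1; exact: pts.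
    apply: le_trans (_ : K * `|r| <= _); last by rewrite ler_wpM2l // -sn.
    apply: (step_x_lipschitz (ds := [:: Some j; Some j'])) => // r' hr' hr'2; apply: pts.
      exact: le_trans hr1.
    have s00 : `|0 : R| <= `|s| by rewrite normr0.
    by have := @seg_add _ s 0 r r' s00 _ hr1 hr2; rewrite mul0r subr0 add0r => /(_ (lexx 0) hr' hr'2) [].
  have t4 : `|pder [:: Some j'; Some j'] u z1 - pder [:: Some j'; Some j'] u z| <= K * s.
    by rewrite -sn; apply: (step_x_lipschitz (ds := [:: Some j'; Some j'])).
  exact: clairaut_arith s0 K0 t1 t2 t3 t4.
have eq0 (s : R) : 0 < s -> s <= 32^-1 ->
    `|pder [:: Some i; Some k] u z - pder [:: Some k; Some i] u z| <= s * (8 * K).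
  move=> s0 s1; have := main s i k s0 s1; have := main s k i s0 s1.
  have -> : q s k i = q s i k.
    rewrite /q (stepC (Some i) (Some k) z s s).
    move: (pder [:: Some k] u z) (pder [:: Some i] u z) (pder [:: Some k; Some k] u z)
      (pder [:: Some i; Some i] u z) (u _) => a b c d e.
    by rewrite (addrC a) (addrC c).
  move: (q s i k) (pder [:: Some i; Some k] u z) (pder [:: Some k; Some i] u z) => x a b h1 h2.
  have s2 : 0 < s ^+ 2 by rewrite exprn_gt0.
  rewrite -(ler_pM2l s2) -{1}(gtr0_norm s2) -normrM.
  have -> : s ^+ 2 * (a - b) = (x - s ^+ 2 * b) - (x - s ^+ 2 * a) by ring.
  have -> : s ^+ 2 * (s * (8 * K)) = 4 * K * s ^+ 3 + 4 * K * s ^+ 3 by ring.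
  by apply: le_trans (ler_normB _ _) _; apply: lerD.
have : 0 <= - `|pder [:: Some i; Some k] u z - pder [:: Some k; Some i] u z|.
  by apply: (@ge0_of_small _ _ (8 * K) 32^-1); [lra|move=> s s0 s1; rewrite lerN2; exact: eq0].
by rewrite oppr_ge0 normr_le0 subr_eq0 => /eqP/esym.
Qed.

Lemma second_order_x z y : D7 z -> vn y <= 16^-1 ->
  `|u (xshift z y) - u z - \sum_(k < n) y 0 k * pder [:: Some k] u z - qf (hess u z) y / 2|
    <= 3 * K * vn y ^+ 3.
Proof.
move=> hz hy; rewrite -(triangular_sum y (hess_sym hz)) path_sum -!sumrB.
rewrite (_ : 3 * K * vn y ^+ 3 = \sum_(k < n) 3 * K * vn y ^+ 2 * `|y 0 k|); last first.
  by rewrite -mulr_sumr -/(vn y) exprSr mulrA.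
apply: le_trans (ler_norm_sum _ _ _) _; apply: ler_sum => k _.
set P := xshift z (trunc k y).
have pts r : `|r| <= `|y 0 k| -> 0 <= r * y 0 k -> D2 (step (Some k) P r).
  by move=> hr _; have [y' -> [_ h]] := path_D2 hz hy hr.
have hty : vn (trunc k y) <= 16^-1 := le_trans (vn_trunc k y) hy.
have t1 := line_taylor pts; rewrite /P step_trunc -/P in t1.
have t2 : `|pder [:: Some k] u P - pder [:: Some k] u z - \sum_(i < n) trunc k y 0 i * pder [:: Some i; Some k] u z|
    <= K * vn y ^+ 2.
  apply: le_trans (first_order_x (ds := [:: Some k]) isT isT hz hty) _.
  by rewrite ler_wpM2l // ler_pXn2r ?nnegrE ?vn_ge0 // vn_trunc.
have t3 : `|pder [:: Some k; Some k] u P - pder [:: Some k; Some k] u z| <= K * vn y.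
  apply: le_trans (lipschitz_x (ds := [:: Some k; Some k]) isT isT hz hty) _.
  by rewrite ler_wpM2l // vn_trunc.
have -> : \sum_(i < n) trunc k y 0 i * hess u z i k = \sum_(i < n) trunc k y 0 i * pder [:: Some i; Some k] u z.
  by apply: eq_bigr => i _; rewrite [hess u z i k]mxE.
have -> : hess u z k k = pder [:: Some k; Some k] u z by rewrite mxE.
exact: taylor_step_arith K0 (coord_vn y k) t1 t2 t3.
Qed.

Definition grad z : 'rV[R]_n := \row_k pder [:: Some k] u z.

(** Moves first in space, then in time. In between the time derivative changes by the mixed
    derivatives of weight 3, which produces the remainder [vn dx * |dt|]. *)
Lemma smooth_C42 : smoothC ((n%:R + 3) * K) 32^-1 D7 u grad (hess u) (pder [:: None] u).
Proof.
split; [by rewrite mulr_ge0 // addr_ge0|by rewrite invr_gt0|].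
move=> z1 z2 hz1 hz2 hx ht dx dt.
have X0 : 0 <= vn dx := vn_ge0 dx; have T0 : 0 <= `|dt| := normr_ge0 dt.
have hy : vn dx <= 16^-1 by apply: le_trans hx _; rewrite lef_pV2 ?posrE // ler_nat.
have e2 : z2 = step None (xshift z1 dx) dt.
  by rewrite /step /xshift /dx /dt /= [z1.1 + _]addrC subrK [z1.2 + _]addrC subrK -surjective_pairing.
have pts r : `|r| <= `|dt| -> 0 <= r * dt -> D2 (step None (xshift z1 dx) r).
  move=> h1 h2; have /segP h := conj h1 h2; move: hz1 hz2 => [_ /andP[a1 a2]] [b0 /andP[b1 b2]].
  have e : z1.1 + dx = z2.1 by rewrite /dx addrC subrK.
  split; rewrite /step /xshift /= ?e; first by lra.
  by move: h; rewrite /dt => -[/andP[? ?]|/andP[? ?]]; apply/andP; split; lra.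
have lx ds : (size ds <= 2)%N -> (pweight ds <= 3)%N ->
    `|pder ds u (xshift z1 dx) - pder ds u z1| <= K * vn dx := fun a b => lipschitz_x a b hz1 hy.
have lt ds : (size ds <= 2)%N -> (pweight ds <= 2)%N ->
    `|pder ds u z2 - pder ds u (xshift z1 dx)| <= K * `|dt|.
  by move=> a b; rewrite e2; apply: time_lipschitz.
have kd1 : `|u z2 - u (xshift z1 dx) - pder [:: None] u (xshift z1 dx) * dt| <= K * dt ^+ 2.
  rewrite -real_normK ?num_real // expr2 mulrA e2; apply: (@pder_step R n u None [::]) => // r h1 h2.
  split; first by apply: D2_Q1; exact: pts.
  apply: le_trans (_ : K * `|r| <= _); last by rewrite ler_wpM2l.
  apply: (time_lipschitz (ds := [:: None])) => // r' h3 h4; apply: pts; first exact: le_trans h1.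
  have s00 : `|0 : R| <= `|dt| by rewrite normr0.
  by have := @seg_add _ dt 0 r r' s00 _ h1 h2; rewrite mul0r subr0 add0r => /(_ (lexx 0) h3 h4) [].
split.
- exact: hess_sym.
- have -> : dot (grad z1) dx = \sum_(k < n) dx 0 k * pder [:: Some k] u z1.
    by rewrite dotE; apply: eq_bigr => k _; rewrite mxE mulrC.
  have := second_order_x hz1 hy.
  have vd : `|pder [:: None] u (xshift z1 dx) * dt - pder [:: None] u z1 * dt| <= K * (vn dx * `|dt|).
    by rewrite -mulrBl normrM mulrA ler_wpM2r // lx.
  move=> h4; apply: le_trans (smooth_arith kd1 vd h4) _.
  rewrite (_ : 3 * K * vn dx ^+ 3 + K * (vn dx * `|dt|) + K * dt ^+ 2 =
     K * (3 * vn dx ^+ 3 + vn dx * `|dt| + dt ^+ 2)); last by ring.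
  rewrite [(_ + 3) * K]mulrC -mulrA ler_wpM2l //.
  have a1 : 0 <= vn dx ^+ 3 := exprn_ge0 3 X0; have a2 := mulr_ge0 X0 T0; have a3 := sqr_ge0 dt.
  have nR : 0 <= n%:R :> R by [].
  have := mulr_ge0 nR a1; have := mulr_ge0 nR a2; have := mulr_ge0 nR a3.
  by move: (vn dx ^+ 3) (vn dx * _) (dt ^+ 2) (n%:R : R) a1 a2 a3 => *; lra.
- apply: le_trans (_ : n%:R * (K * (vn dx ^+ 2 + `|dt|)) <= _); last first.
    rewrite mulrA ler_wpM2r ?addr_ge0 ?exprn_ge0 // ler_wpM2r //; lra.
  apply: vn_le => j.
  have := first_order_x (ds := [:: Some j]) isT isT hz1 hy; have := lt [:: Some j] isT isT.
  have -> : (grad z2 - grad z1 - dx *m hess u z1) 0 j = pder [:: Some j] u z2 - pder [:: Some j] u z1 -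
     \sum_(k < n) dx 0 k * pder [:: Some k; Some j] u z1.
    by rewrite !mxE; congr (_ - _); apply: eq_bigr => k _; rewrite !mxE.
  exact: dist_add2.
- have h1 := lx [::] isT isT; have h2 := lt [::] isT isT.
  apply: le_trans (_ : K * (vn dx + `|dt|) <= _); last first.
    by rewrite ler_wpM2r ?addr_ge0 // ler_peMl //; have : 0 <= n%:R :> R by []; lra.
  by have := ler_distD (u (xshift z1 dx)) (u z2) (u z1); rewrite mulrDr; lra.
Qed.

Lemma lipschitz_xt ds z1 z2 : (size ds <= 2)%N -> (pweight ds <= 2)%N -> D7 z1 -> D7 z2 ->
  vn (z2.1 - z1.1) <= 16^-1 ->
  `|pder ds u z2 - pder ds u z1| <= K * (vn (z2.1 - z1.1) + `|z2.2 - z1.2|).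
Proof.
move=> sds wds hz1 hz2 hy; set y := z2.1 - z1.1 in hy *; set t := z2.2 - z1.2.
have e : z1.1 + y = z2.1 by rewrite /y addrC subrK.
have e2 : z2 = step None (xshift z1 y) t.
  by rewrite /step /xshift /= e /t [z1.2 + _]addrC subrK -surjective_pairing.
have h1 := lipschitz_x sds (leqW wds) hz1 hy.
have h2 : `|pder ds u z2 - pder ds u (xshift z1 y)| <= K * `|t|.
  rewrite e2; apply: time_lipschitz => // r r1 r2.
  have /segP h := conj r1 r2; move: hz1 hz2 => [_ /andP[a1 a2]] [b0 /andP[b1 b2]].
  split; rewrite /step /xshift /= ?e; first lra.
  by move: h; rewrite /t => -[/andP[? ?]|/andP[? ?]]; apply/andP; split; lra.
have := ler_distD (pder ds u (xshift z1 y)) (pder ds u z2) (pder ds u z1).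
by move: h1 h2; rewrite mulrDr; move: `|_| `|_ - _| `|_ - _| => *; lra.
Qed.

(** Supplies the qualitative constant [Lp] of [hessian_holder]. Pairs too far apart for
    [lipschitz_xt] are covered by the bound on the second derivatives. *)
Lemma hess_lipschitz : exists Lp : R, forall p q, Qbar (3 / 4) (9 / 16) p -> Qbar (3 / 4) (9 / 16) q ->
  mn (hess u p - hess u q) <= Lp * pdist p q.
Proof.
exists (n%:R * (n%:R * (32 * K * (n%:R + 1)))) => p q hp hq.
have nR : 0 <= n%:R :> R by [].
have D37 z : Qbar (3 / 4) (9 / 16) z -> D7 z.
  by move=> [h1 /andP[h2 h3]]; split; [|apply/andP; split]; lra.
have r0 := pdist_ge0 p q.
suff hij i j : `|(hess u p - hess u q) i j| <= 32 * K * (n%:R + 1) * pdist p q.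
  by apply: le_trans (mn_le hij) _; apply: eq_imp_le; rewrite -!(mulrA n%:R).
rewrite !mxE; have [far|near] := ltP 1 (16 * (n%:R + 1) * pdist p q).
  have D2' z : Qbar (3 / 4) (9 / 16) z -> D2 z.
    by move=> [h1 /andP[h2 h3]]; split; [|apply/andP; split]; lra.
  have h1 := hK (ds := [:: Some i; Some j]) isT isT (D2' p hp).
  have h2 := hK (ds := [:: Some i; Some j]) isT isT (D2' q hq).
  apply: le_trans (ler_normB _ _) _; apply: le_trans (lerD h1 h2) _.
  have h3 := ler_wpM2l K0 (ltW far); rewrite mulr1 in h3.
  apply: le_trans (lerD h3 h3) _; apply: eq_imp_le.
  by move: (pdist p q) (n%:R : R) => r m; ring.
have vx : vn (p.1 - q.1) <= n%:R * pdist p q.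
  by apply: vn_le => k; rewrite !mxE; exact: pdist_coord.
have nr := mulr_ge0 nR r0.
have r1 : pdist p q <= 1 by lra.
have ht : `|p.2 - q.2| <= pdist p q.
  by apply: le_trans (pdist_time p q) _; rewrite expr2 ler_piMl.
have := @lipschitz_xt [:: Some i; Some j] q p isT isT (D37 q hq) (D37 p hp).
move=> /(_ ltac:(lra)) /le_trans; apply.
apply: le_trans (ler_wpM2l K0 (lerD vx ht)) _.
have := mulr_ge0 K0 nr; have := mulr_ge0 K0 r0; move: (pdist p q) => r; lra.
Qed.

End TaylorC42.

(** * Assembly of the estimate on the half cylinder *)

Lemma pweight2 (n : nat) (ds : seq (option 'I_n)) : pweight ds = 2%N ->
  ds = [:: None] \/ exists i j, ds = [:: Some i; Some j].
Proof.
case: ds => [|[i|] [|[j|] [|[k|] ds]]] //=; by [right; exists i, j|left].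
Qed.

(** Passes from the exponent [beta] of the time derivative to the smaller [alpha] on a bounded
    set. *)
Lemma powR_lower (R : realType) (r a b : R) : 0 <= r -> r <= 2 -> 0 < a -> a <= b ->
  r `^ b <= 2 `^ b * r `^ a.
Proof.
move=> r0 r2 a0 ab; have b0 : 0 < b by apply: lt_le_trans ab.
have [->|rn] := eqVneq r 0; first by rewrite !powR0 ?mulr0 // gt_eqF.
have rp : 0 < r by rewrite lt_def rn.
have p1 : 1 <= 2 `^ b :> R.
  have : 1 `^ b <= 2 `^ b :> R by apply: ge0_ler_powR; rewrite ?nnegrE ?ler1n // ltW.
  by rewrite powR1.
have [h|h] := leP r 1.
  apply: le_trans (_ : r `^ a <= _); first by apply: ger_powR; rewrite ?rp.
  by rewrite ler_peMl ?powR_ge0.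
apply: le_trans (_ : 2 `^ b <= _).
  by apply: ge0_ler_powR; rewrite ?nnegrE // ltW.
rewrite ler_peMr ?powR_ge0 //.
have : 1 `^ a <= r `^ a by apply: ge0_ler_powR; rewrite ?nnegrE // ltW.
by rewrite powR1.
Qed.

Lemma pdist_le2 (R : realType) (n : nat) (p q : spt R n) :
  Qhalf_closed p -> Qhalf_closed q -> pdist p q <= 2.
Proof.
move=> [hp /andP[p1 p2]] [hq /andP[q1 q2]]; rewrite /pdist.
have h1 : enorm (p.1 - q.1) <= 1 by have := enormD p.1 (- q.1); rewrite enormN; lra.
have h2 : Num.sqrt `|p.2 - q.2| <= 1.
  rewrite -(ler_pXn2r (n := 2)) ?nnegrE ?sqrtr_ge0 // sqr_sqrtr // expr1n ler_norml.
  by apply/andP; split; lra.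
by lra.
Qed.

Theorem theorem5p1 (R : realType) (n : nat) (lam Lam : R) :
  0 < lam -> lam <= Lam ->
  exists alpha : R, 0 < alpha < 1 /\
  forall K : R, exists C : R,
  forall (F : 'M[R]_n -> R) (u : spt R n -> R),
    C2_sym F -> quasiconcave F -> unif_parabolic lam Lam F ->
    C42_on (@Q1 R n) u ->
    (forall p, Q1 p -> F (hess u p) - pder [:: None] u p = 0) ->
    C21_bounded (@Q1 R n) K u ->
    C2a1a_bounded (@Qhalf_closed R n) alpha C u.
Proof.
move=> lam0 lamL; have Lam0 : 0 <= Lam by lra.
have [beta b0 [Cv Cv0 hv]] := @time_derivative_holder R n lam Lam lam0 Lam0.
have [alpha [/andP[al0 al1] alb] hC] : exists2 alpha : R, 0 < alpha < 1 /\ alpha <= beta &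
  forall K : R, 0 <= K -> exists2 C : R, 0 <= C & forall F u g (M : _ -> 'M[R]_n) v,
    unif_parabolic lam Lam F -> quasiconcave F -> smooth (Qbar (7 / 8) (7 / 8)) u g M v ->
    (forall z, Qbar (7 / 8) (7 / 8) z -> F (M z) = v z) ->
    (forall z, Qbar (3 / 4) (9 / 16) z -> mn (M z) <= n%:R * (n%:R * K)) ->
    (exists Lp : R, forall p q, Qbar (3 / 4) (9 / 16) p -> Qbar (3 / 4) (9 / 16) q ->
      mn (M p - M q) <= Lp * pdist p q) ->
    (forall p q, Qbar (3 / 4) (9 / 16) p -> Qbar (3 / 4) (9 / 16) q ->
      `|v p - v q| <= K * Cv * pdist p q `^ beta) ->
    forall p q, Qbar 2^-1 4^-1 p -> Qbar 2^-1 4^-1 q -> forall i j,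
      `|M p i j - M q i j| <= 2 * C * pdist p q `^ alpha.
  (* In dimension 0 there are no entries to bound, and [hessian_holder] requires [0 < n]. *)
  have [n0|n0] := posnP n.
    exists (Num.min beta 2^-1).
      split; last by rewrite ge_min lexx.
      by rewrite lt_min b0 /=; apply/andP; split; [lra|rewrite gt_min; apply/orP; right; lra].
    by move=> K K0; exists 0 => // F u g M v _ _ _ _ _ _ _ p q _ _ [i hi]; exfalso; rewrite n0 in hi.
  have [alpha ha hh] := @hessian_holder R n lam Lam lam0 lamL n0 beta b0.
  exists alpha => // K K0.
  have [||C C0 hC] := hh (n%:R * (n%:R * K)) (K * Cv); [by rewrite !mulr_ge0|by rewrite mulr_ge0|].
  exists C => // F u g M v ell qc sm eqF MK ML vH p q hp hq i j.
  have D7 : @Qbar R n 2^-1 4^-1 `<=` Qbar (7 / 8) (7 / 8) by apply: Qbar_sub; clear; lra.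
  have -> : M p i j - M q i j = (M p - M q) i j by rewrite !mxE.
  rewrite -mulrA; apply: projection_entry.
  - by rewrite linearB /= (smooth_sym sm (D7 p hp)) (smooth_sym sm (D7 q hq)).
  - by move=> B hB; apply: (hC F u g M v).
  - by move=> B hB; rewrite opprB pdistC; apply: (hC F u g M v).
exists alpha; split; first by rewrite al0.
move=> K0; pose K := `|K0|; have Kge : 0 <= K := normr_ge0 _.
have [C C0 {}hC] := hC K Kge.
pose Cm := K + 2 * C + K * Cv * 2 `^ beta.
have P0 : 0 <= K * Cv * 2 `^ beta by rewrite !mulr_ge0 ?powR_ge0.
exists Cm => F u _ qc ell hu eqF bu.
have {}bu ds p : (pweight ds <= 2)%N -> Q1 p -> `|pder ds u p| <= K.
  by move=> w Qp; apply: le_trans (bu ds w p Qp) (ler_norm _).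
have Q1b (a b : R) : a < 1 -> b < 1 -> @Qbar R n a b `<=` @Q1 R n := @Qbar_Q1 R n a b.
have halfQ : @Qhalf_closed R n `<=` @Q1 R n by apply: Q1b; clear; lra.
(* [K'] depends on [u]; it only serves to establish [smooth] and the Lipschitz hypothesis, and does
   not enter [Cm]. *)
have [K' K'0 hK'] := @pder_bounded R n u (15 / 16) (15 / 16) ltac:(lra) ltac:(lra) hu.
have sm : smooth (Qbar (7 / 8) (7 / 8)) u (grad u) (hess u) (pder [:: None] u).
  by eexists; eexists; exact: (smooth_C42 hu K'0 hK').
have D7 : @Qbar R n (7 / 8) (7 / 8) `<=` @Q1 R n by apply: Q1b; clear; lra.
have D3 : @Qbar R n (3 / 4) (9 / 16) `<=` @Q1 R n by apply: Q1b; clear; lra.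
have eqM z : Qbar (7 / 8) (7 / 8) z -> F (hess u z) = pder [:: None] u z.
  by move=> /D7 /eqF /eqP; rewrite subr_eq0 => /eqP.
have vH := hv F u _ _ _ K ell sm eqM Kge (fun z hz => bu [:: None] z isT (D7 z hz)).
have D3half : @Qhalf_closed R n `<=` Qbar (3 / 4) (9 / 16).
  by apply: Qbar_sub; clear; lra.
split=> [ds w p hp|ds w].
  by apply: le_trans (bu ds p w (halfQ p hp)) _; rewrite /Cm -addrA lerDl addr_ge0 // mulr_ge0.
have [->|[i [j ->]]] := pweight2 w => p q hp hq.
  apply: le_trans (vH p q (D3half p hp) (D3half q hq)) _.
  apply: le_trans (ler_wpM2l _ (powR_lower (pdist_ge0 p q) (pdist_le2 hp hq) al0 alb)) _.
    exact: mulr_ge0.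
  by rewrite mulrA ler_wpM2r ?powR_ge0 // /Cm lerDr addr_ge0 // mulr_ge0.
have := hC F u _ (hess u) (pder [:: None] u) ell qc sm eqM.
have mnK z : Qbar (3 / 4) (9 / 16) z -> mn (hess u z) <= n%:R * (n%:R * K).
  move=> /D3 Qz; have hij a b : `|hess u z a b| <= K by rewrite mxE; apply: bu.
  exact: mn_le.
have hE z : hess u z i j = pder [:: Some i; Some j] u z by rewrite mxE.
move=> /(_ mnK (hess_lipschitz hu K'0 hK') vH p q hp hq i j) hpq.
rewrite -(hE p) -(hE q); apply: le_trans hpq _.
by rewrite ler_wpM2r ?powR_ge0 // /Cm addrAC lerDr addr_ge0.
Qed.
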